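(* For an integer $t \geq 1$ put \[ A=(364t+1)\bigl(16(364t+1)-(364t+5)\bigr),\qquad B=16\bigl(16(364t+5)^2-(364t+1)^2\bigr), \] \[ A'=16(364t+5)^2-(364t+1)^2,\qquad B'=16(364t+5)\bigl(16(364t+1)-(364t+5)\bigr), \] and let $E_{(A,B)}/\mathbb{Q}$ and $E_{(A',B')}/\mathbb{Q}$ be the elliptic curves given by the Weierstrass equations \[ E_{(A,B)}:\ y^2=x(x-A)(x+B),\qquad E_{(A',B')}:\ y^2=x(x-A')(x+B'). \] Then for every integer $t\ge 1$ the curves $E_{(A,B)}/\mathbb{Q}$ and $E_{(A',B')}/\mathbb{Q}$ are semi-stable, are not isogenous over $\mathbb{Q}$, and are discriminant twins. In particular, there exist infinitely many semi-stable discriminant twins.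
   Context: Two elliptic curves $E_1/\mathbb{Q}$ and $E_2/\mathbb{Q}$ are called discriminant twins if they have the same minimal discriminant and the same conductor. An elliptic curve over $\mathbb{Q}$ is semi-stable if it has good or multiplicative reduction at every prime. *)

(* Defs.v *)
From HB Require Import structures.
From mathcomp Require Import all_boot all_order all_fingroup all_algebra.
From mathcomp Require Import all_field.
From mathcomp Require Import boolp mpoly.

Set Implicit Arguments.
Unset Strict Implicit.
Unset Printing Implicit Defensive.

Import Order.TTheory GRing.Theory Num.Theory.
Local Open Scope ring_scope.

(* y^2 + a1 x y + a3 y = x^3 + a2 x^2 + a4 x + a6 *)
Record weierstrass (K : Type) : Type := Weierstrass {
  a1 : K; a2 : K; a3 : K; a4 : K; a6 : K }.

Definition map_weierstrass (K L : Type) (f : K -> L) (W : weierstrass K) :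
    weierstrass L :=
  Weierstrass (f (a1 W)) (f (a2 W)) (f (a3 W)) (f (a4 W)) (f (a6 W)).

Section Weierstrass.
Variable K : fieldType.
Implicit Types W : weierstrass K.

Definition disc W : K :=
  let b2 := a1 W ^+ 2 + 4 * a2 W in
  let b4 := 2 * a4 W + a1 W * a3 W in
  let b6 := a3 W ^+ 2 + 4 * a6 W in
  let b8 := a1 W ^+ 2 * a6 W + 4 * a2 W * a6 W - a1 W * a3 W * a4 W
            + a2 W * a3 W ^+ 2 - a4 W ^+ 2 in
  - b2 ^+ 2 * b8 - 8 * b4 ^+ 3 - 27 * b6 ^+ 2 + 9 * b2 * b4 * b6.

(* W' is obtained from W by x = u^2 x' + r, y = u^3 y' + s u^2 x' + t. *)
Definition isomorphic W W' : Prop :=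
  exists u r s t : K, u != 0 /\
  [/\ u * a1 W' = a1 W + 2 * s,
      u ^+ 2 * a2 W' = a2 W - s * a1 W + 3 * r - s ^+ 2,
      u ^+ 3 * a3 W' = a3 W + r * a1 W + 2 * t,
      u ^+ 4 * a4 W' = a4 W - s * a3 W + 2 * r * a2 W - (t + r * s) * a1 W
                       + 3 * r ^+ 2 - 2 * s * t
    & u ^+ 6 * a6 W' = a6 W + r * a4 W + r ^+ 2 * a2 W + r ^+ 3 - t * a3 W
                       - t ^+ 2 - r * t * a1 W].

(* [None] is the point at infinity O = [0 : 1 : 0]. *)
Definition point : Type := option (K * K).

Definition on_curve W (P : point) : bool :=
  if P is Some (x, y) then
    y ^+ 2 + a1 W * x * y + a3 W * y
      == x ^+ 3 + a2 W * x ^+ 2 + a4 W * x + a6 W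
  else true.

Definition hcoord (P : point) : 'rV[K]_3 :=
  if P is Some (x, y) then \row_i [:: x; y; 1]`_i else \row_i [:: 0; 1; 0]`_i.

(* Chord-tangent addition. *)
Definition addp W (P Q : point) : point :=
  match P, Q with
  | None, _ => Q
  | _, None => P
  | Some (x1, y1), Some (x2, y2) =>
      if (x1 == x2) && (y1 + y2 + a1 W * x2 + a3 W == 0) then None else
      let l :=
        if x1 == x2 then
          (3 * x1 ^+ 2 + 2 * a2 W * x1 + a4 W - a1 W * y1)
            / (2 * y1 + a1 W * x1 + a3 W)
        else (y2 - y1) / (x2 - x1) in
      let x3 := l ^+ 2 + a1 W * l - a2 W - x1 - x2 in
      Some (x3, - (l + a1 W) * x3 - (y1 - l * x1) - a3 W)
  end.

Definition mulp W (n : nat) (P : point) : point := iter n (addp W P) None.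

(* The last two equations are the vanishing of the partial derivatives of
   y^2 + a1 x y + a3 y - x^3 - a2 x^2 - a4 x - a6. *)
Definition singular_point W (x y : K) : Prop :=
  [/\ on_curve W (Some (x, y)),
      a1 W * y - 3 * x ^+ 2 - 2 * a2 W * x - a4 W = 0
    & 2 * y + a1 W * x + a3 W = 0].

(* The quadratic part of the equation at a singular point (x, y) is
   dy^2 + a1 dx dy - (a2 + 3 x) dx^2 = (dy - alpha dx) (dy - beta dx). *)
Definition tangent_slopes W (x alpha beta : K) : Prop :=
  'X^2 + a1 W *: 'X - (a2 W + 3 * x)%:P
    = ('X - alpha%:P) * ('X - beta%:P) :> {poly K}.

End Weierstrass.

(* Geometric conditions: quantifying over all extensions L of K amounts to
   working over an algebraic closure.  The point at infinity is never
   singular. *)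
Definition nonsingular (K : fieldType) (W : weierstrass K) : Prop :=
  forall (L : fieldType) (iota : {rmorphism K -> L}) (x y : L),
    ~ singular_point (map_weierstrass iota W) x y.

Definition has_node (K : fieldType) (W : weierstrass K) : Prop :=
  exists (L : fieldType) (iota : {rmorphism K -> L}) (x y alpha beta : L),
    let WL := map_weierstrass iota W in
    [/\ singular_point WL x y, tangent_slopes WL x alpha beta
      & alpha != beta].

Definition has_cusp (K : fieldType) (W : weierstrass K) : Prop :=
  exists (L : fieldType) (iota : {rmorphism K -> L}) (x y alpha : L),
    let WL := map_weierstrass iota W in
    singular_point WL x y /\ tangent_slopes WL x alpha alpha.

(* A Weierstrass curve, pointed at infinity, is an elliptic curve exactly when
   it is nonsingular. *)
Definition elliptic (E : weierstrass rat) : Prop := nonsingular E.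

(* p-adic valuation; only meaningful for x != 0. *)
Definition vp (p : nat) (x : rat) : int :=
  (logn p `|numq x|%N)%:Z - (logn p `|denq x|%N)%:Z.

Definition p_int (p : nat) (x : rat) : bool := ~~ (p %| `|denq x|)%N.

Definition p_integral (p : nat) (E : weierstrass rat) : bool :=
  [&& p_int p (a1 E), p_int p (a2 E), p_int p (a3 E), p_int p (a4 E)
    & p_int p (a6 E)].

Definition minimal_at (p : nat) (E : weierstrass rat) : Prop :=
  p_integral p E /\
  forall E' : weierstrass rat, isomorphic E E' -> p_integral p E' ->
    vp p (disc E) <= vp p (disc E').

Definition integral (E : weierstrass rat) : bool :=
  [&& a1 E \is a Num.int, a2 E \is a Num.int, a3 E \is a Num.int,
      a4 E \is a Num.int & a6 E \is a Num.int].

Definition global_minimal (E : weierstrass rat) : Prop :=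
  integral E /\ forall p : nat, prime p -> minimal_at p E.

(* The minimal discriminant of E/Q, as an integer with its sign. *)
Definition minimal_discriminant (E : weierstrass rat) (D : int) : Prop :=
  exists E' : weierstrass rat,
    [/\ isomorphic E E', global_minimal E' & disc E' = D%:~R].

(* On rationals n / d with d prime to p, [ratr] at 'F_p, which sends n / d to
   n%:~R / d%:~R, is reduction modulo p. *)
Definition reduction (p : nat) (E : weierstrass rat) : weierstrass 'F_p :=
  map_weierstrass (@ratr 'F_p) E.

Definition good_reduction (p : nat) (E : weierstrass rat) : Prop :=
  exists E' : weierstrass rat,
    [/\ isomorphic E E', minimal_at p E' & nonsingular (reduction p E')].

Definition multiplicative_reduction (p : nat) (E : weierstrass rat) : Prop :=
  exists E' : weierstrass rat,
    [/\ isomorphic E E', minimal_at p E' & has_node (reduction p E')].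

Definition additive_reduction (p : nat) (E : weierstrass rat) : Prop :=
  exists E' : weierstrass rat,
    [/\ isomorphic E E', minimal_at p E' & has_cusp (reduction p E')].

Definition semistable (E : weierstrass rat) : Prop :=
  forall p : nat, prime p -> good_reduction p E \/ multiplicative_reduction p E.

(* Normalized discrete valuations of L above p; w is only meaningful away
   from 0. *)
Definition valuation_above (p : nat) (L : fieldType) (w : L -> int) : Prop :=
  [/\ forall x y, x != 0 -> y != 0 -> w (x * y) = w x + w y,
      forall x y, x != 0 -> y != 0 -> x + y != 0 ->
        Num.min (w x) (w y) <= w (x + y),
      exists x, x != 0 /\ w x = 1
    & 0 < w p%:R].

(* The i-th ramification group, in the lower numbering, of the place w of
   L/Q.  For i >= 0 the condition forces s to lie in the decomposition group,
   so that this is also the ramification group of the completion L_w/Q_p. *)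
Definition ramification_group (L : splittingFieldType rat) (w : L -> int)
    (i : nat) : {set gal_of {:L}} :=
  [set s : gal_of {:L} |
    `[< forall x : L, x != 0 -> 0 <= w x -> s x != x ->
          i.+1%:Z <= w (s x - x) >]].

Definition map_point (K L : fieldType) (f : K -> L) (P : point K) : point L :=
  if P is Some (x, y) then Some (f x, f y) else None.

Definition affine_coords (K : fieldType) (T : seq (point K)) : seq K :=
  [seq q.1 | q <- pmap id T] ++ [seq q.2 | q <- pmap id T].

(* The wild part of the conductor exponent at p:
     delta = \sum_(i >= 1) g_i / g_0 * dim (E[l] / E[l]^(G_i)),
   for a prime l != p, with G_i the ramification groups above p of
   L = Q(E[l]), g_i = #|G_i|, and dimensions over F_l.  Here T lists E[l], of
   dimension 2, and n is such that G_n = 1, so that the terms i >= n vanish.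
   The value depends neither on l nor on the place w. *)
Definition wild_exponent (p : nat) (E : weierstrass rat) (delta : nat) : Prop :=
  exists (l : nat) (L : splittingFieldType rat) (T : seq (point L))
         (w : L -> int) (n : nat),
    let EL := map_weierstrass (@ratr L) E in
    let G := ramification_group w in
    let fixed i := [pred P | [forall s in G i, map_point s P == P]] in
    [/\ prime l /\ l != p,
        [/\ uniq T, size T = (l ^ 2)%N
          & forall P, P \in T <-> on_curve EL P /\ mulp EL l P = None],
        <<1%VS & affine_coords T>>%VS = fullv,
        valuation_above p w /\ G n = 1%g
      & delta%:R = \sum_(1 <= i < n) #|G i|%:R / #|G 0%N|%:R
                     * (2 - (logn l (count (fixed i) T))%:R) :> rat].

Definition conductor_exponent (p : nat) (E : weierstrass rat) (f : nat) : Prop :=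
  [\/ good_reduction p E /\ f = 0%N,
      multiplicative_reduction p E /\ f = 1%N
    | additive_reduction p E /\
      exists delta : nat, wild_exponent p E delta /\ f = (2 + delta)%N].

Definition conductor (E : weierstrass rat) (N : nat) : Prop :=
  (0 < N)%N /\ forall p : nat, prime p -> conductor_exponent p E (logn p N).

Definition discriminant_twins (E1 E2 : weierstrass rat) : Prop :=
  (exists D : int, minimal_discriminant E1 D /\ minimal_discriminant E2 D) /\
  (exists N : nat, conductor E1 N /\ conductor E2 N).

Definition eval_forms (F : 'I_3 -> {mpoly rat[3]}) (v : 'rV[algC]_3) :
    'rV[algC]_3 :=
  \row_i (map_mpoly (@ratr algC) (F i)).@[fun j => v 0 j].

(* Morphisms of projective curves over Q, as maps on points over the algebraic
   closure algC of Q: near each point, phi is given by forms of the same degree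
   over Q.  Equality of points of the projective plane is equality of the lines
   spanned by their coordinate vectors. *)
Definition morphism_over_Q (E1 E2 : weierstrass rat)
    (phi : point algC -> point algC) : Prop :=
  let C1 := map_weierstrass (@ratr algC) E1 in
  let C2 := map_weierstrass (@ratr algC) E2 in
  (forall P, on_curve C1 P -> on_curve C2 (phi P)) /\
  forall P, on_curve C1 P ->
    exists (d : nat) (F : 'I_3 -> {mpoly rat[3]}),
      [/\ forall i, F i \is d.-homog,
          eval_forms F (hcoord P) != 0
        & forall Q, on_curve C1 Q -> eval_forms F (hcoord Q) != 0 ->
            (eval_forms F (hcoord Q) == hcoord (phi Q))%MS].

Definition isogenous (E1 E2 : weierstrass rat) : Prop :=
  exists phi : point algC -> point algC,
    [/\ morphism_over_Q E1 E2 phi, phi None = None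
      & exists2 P, on_curve (map_weierstrass (@ratr algC) E1) P
                 & phi P <> None].

(* y^2 = x (x - A) (x + B) *)
Definition frey_curve (A B : int) : weierstrass rat :=
  Weierstrass 0 (B - A)%:~R 0 (- (A * B))%:~R 0.

Definition famA (t : int) : int :=
  (364 * t + 1) * (16 * (364 * t + 1) - (364 * t + 5)).
Definition famB (t : int) : int :=
  16 * (16 * (364 * t + 5) ^+ 2 - (364 * t + 1) ^+ 2).
Definition famA' (t : int) : int :=
  16 * (364 * t + 5) ^+ 2 - (364 * t + 1) ^+ 2.
Definition famB' (t : int) : int :=
  16 * (364 * t + 5) * (16 * (364 * t + 1) - (364 * t + 5)).

(* Main.v *)
(* Non-isogeny is a 2-descent on functions. Let [phi] be an isogeny from
   [y^2 = f(x)] to [Y^2 = g(X)]. As the sum of [phi P] and its conjugate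
   [phi (- P)] is constant, [X] may be taken in [Q(x)], with [f S^2 = g(X)] for
   some [S]; comparing zeros and poles, [f X'^2 = c^2 g(X)] with [c] constant.
   This differential equation has at most one solution with a pole at infinity.
   Hence, if [phi] kills a 2-torsion point, then [X] is invariant under
   translation by it, so [phi] factors through the 2-isogeny with that kernel and
   the degree drops. Throughout the descent the source curve keeps one of two
   explicit shapes over [Z_2], both having good ordinary reduction with trace
   [1], whereas the target has trace [-1]. In the end [phi] is injective on the
   2-torsion, so it matches the differences of the roots of [f] with those of [g]
   up to squares, which fails modulo 8.

   With [A = 4 k - 1] and [B = 16 b], the curve has the integral model
   [y^2 + x y = x^3 + (4 b - k) x^2 - A b x]. Its discriminant
   [(A B (A + B) / 16)^2] is the same for both curves of the family, and is
   coprime to [c4 = A^2 + A B + B^2]: the model is minimal and semistable at every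
   prime. As [c4^3] over the discriminant is in lowest terms and the discriminant
   grows with [t], the family meets infinitely many isomorphism classes. *)

(* Write m = 364 t + 1 and n = 364 t + 5. Then A = m (16 m - n), B = 16 (16 n^2 - m^2), A + B = n
   (256 n - m), whereas A' = 16 n^2 - m^2, B' = 16 n (16 m - n), A' + B' = m (256 n - m): the same
   five factors distributed differently, which is why the two discriminants agree.

   Isogenous curves have the same trace at 2, but an isogeny is given here by forms over Q, with no
   model over Z_2 to reduce. The rational 2-torsion, which is visible in factorisations of
   polynomials, takes the place of reduction. All root differences of the target are plus or minus
   squares in Q_2, while a source in either shape has, once its cubic splits, two roots whose
   difference is 3 or 5 modulo 8. An isogeny that kills 2-torsion could hide this contrast, hence
   the induction on the degree. *)
Require Import Defs.
From mathcomp Require Import all_boot all_order all_algebra all_field.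
From mathcomp Require Import boolp mpoly ring zify.
Import Order.TTheory GRing.Theory Num.Theory.
Local Open Scope ring_scope.

Set Implicit Arguments.
Unset Strict Implicit.
Unset Printing Implicit Defensive.

(** * Polynomials, Wronskians and the quartic form of the curve *)

(* The instance paths under [size] differ between library lemmas, which [lia]
   does not see through. *)
Definition psize (F : numFieldType) (p : {poly F}) : nat := size p.
Ltac plia := rewrite -?size_poly_gt0;
  repeat match goal with |- context [@size ?T (@polyseq ?R ?p)] =>
    change (@size T (@polyseq R p)) with (psize p)
  | H : context [@size ?T (@polyseq ?R ?p)] |- _ =>
    change (@size T (@polyseq R p)) with (psize p) in H end; lia.

Section WronskianFactor.
Variable F : numFieldType.
Implicit Types a b f p q s : {poly F}.

Lemma sqr_dvd_split2 s a b : coprimep a b -> s != 0 -> s ^+ 2 %| a * b ->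
  exists s1 s2, [/\ s = s1 * s2, s1 ^+ 2 %| a & s2 ^+ 2 %| b].
Proof.
move=> cab s0 sab; pose s1 := gcdp s a.
have s1s : s1 %| s by rewrite dvdp_gcdl.
have s1a : s1 %| a by rewrite dvdp_gcdr.
have s10 : s1 != 0 by rewrite gcdp_eq0 negb_and s0.
exists s1, (s %/ s1); rewrite mulrC divpK //.
have s_ab : s %| a * b by apply: dvdp_trans sab; rewrite dvdp_exp.
have s2b : s %/ s1 %| b.
  have : s %/ s1 %| (a %/ s1) * b.
    by rewrite -(dvdp_mul2r _ _ s10) divpK // mulrAC divpK.
  by rewrite Gauss_dvdpr // coprimep_div_gcd // s0.
split=> //.
  rewrite -(@Gauss_dvdpl _ _ b); last first.
    by apply: coprimep_expl; apply: coprimep_dvdr cab.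
  by apply: dvdp_trans sab; rewrite dvdp_exp2r.
rewrite -(@Gauss_dvdpr _ _ a); last first.
  by apply: coprimep_expl; rewrite coprimep_sym; apply: coprimep_dvdl cab.
by apply: dvdp_trans sab; rewrite dvdp_exp2r // divp_dvd.
Qed.

(** By unique factorisation, the class modulo squares of a product of pairwise coprime factors is
    distributed over these factors. The [d1], ..., [d4] are the values of the 2-descent map. *)
Lemma sqr_dvd_split4 f s a1 a2 a3 a4 :
    coprimep a1 (a2 * (a3 * a4)) -> coprimep a2 (a3 * a4) -> coprimep a3 a4 ->
    s != 0 -> f * s ^+ 2 = a1 * (a2 * (a3 * a4)) ->
  exists s1 s2 s3 s4 d1 d2 d3 d4, [/\ s = s1 * (s2 * (s3 * s4)),
    f = d1 * (d2 * (d3 * d4)) &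
    [/\ a1 = d1 * s1 ^+ 2, a2 = d2 * s2 ^+ 2, a3 = d3 * s3 ^+ 2 &
      a4 = d4 * s4 ^+ 2]].
Proof.
move=> c1 c2 c3 s0 fE.
have [|s1 [t1 [sE /dvdpP[d1 a1E] /dvdpP[m1 m1E]]]] := sqr_dvd_split2 c1 s0.
  by rewrite -fE dvdp_mull.
have : t1 != 0 by apply: contraNneq s0 => t0; rewrite sE t0 mulr0.
move=> t10; have [|s2 [t2 [t1E /dvdpP[d2 a2E] /dvdpP[m2 m2E]]]] := sqr_dvd_split2 c2 t10.
  by rewrite m1E dvdp_mull.
have : t2 != 0 by apply: contraNneq t10 => t0; rewrite t1E t0 mulr0.
move=> t20; have [|s3 [s4 [t2E /dvdpP[d3 a3E] /dvdpP[d4 a4E]]]] := sqr_dvd_split2 c3 t20.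
  by rewrite m2E dvdp_mull.
exists s1, s2, s3, s4, d1, d2, d3, d4; split=> //.
  by rewrite sE t1E t2E.
apply: (mulIf (expf_neq0 2 s0)); rewrite fE a1E a2E a3E a4E sE t1E t2E; ring.
Qed.

Lemma size_mul_top p q m n : (size p <= m.+1)%N -> (size q <= n.+1)%N ->
  (size (p * q)%R <= (m + n).+1)%N.
Proof. by move=> sp sq; apply: leq_trans (size_polyMleq _ _) _; lia. Qed.

Lemma coef_mul_top p q m n : (size p <= m.+1)%N -> (size q <= n.+1)%N ->
  (p * q)`_(m + n) = p`_m * q`_n.
Proof.
move=> sp sq; have mlt : (m < (m + n).+1)%N by lia.
rewrite coefM (bigD1 (Ordinal mlt)) //= addKn big1 ?addr0 // => i ine.
have {}ine : (i : nat) != m by apply: contraNneq ine => im; apply/eqP/val_inj.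
case: (ltngtP i m) ine => // him _.
  by rewrite [X in _ * X]nth_default ?mulr0 // (leq_trans sq) //; lia.
by rewrite nth_default ?mul0r // (leq_trans sp).
Qed.

Definition wronskian p q := p^`() * q - p * q^`().

(** This is q^4 g(p / q) for g(X) = X (X - e2) (X - e3). Its degree is four rather than three, so
    that infinity contributes a factor [q] on a par with the three roots. *)
Definition quartic (e2 e3 : F) p q :=
  p * ((p - e2%:P * q) * ((p - e3%:P * q) * q)).

(** The Wronskian does not change when [p] is replaced by p - e q, and if s'^2 divides one entry of
    a Wronskian then s' divides the Wronskian. The four square parts are coprime, so their product
    divides it as well. *)
Lemma sqr_dvd_wronskian e2 e3 p q f s : coprimep p q -> e2 != 0 -> e3 != 0 -> e2 != e3 ->
    s != 0 -> f * s ^+ 2 = quartic e2 e3 p q ->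
  exists s1 s2 s3 s4 d1 d2 d3 d4, [/\ s = s1 * (s2 * (s3 * s4)),
    f = d1 * (d2 * (d3 * d4)), 
    [/\ p = d1 * s1 ^+ 2, p - e2%:P * q = d2 * s2 ^+ 2, p - e3%:P * q = d3 * s3 ^+ 2 &
      q = d4 * s4 ^+ 2] & s %| wronskian p q].
Proof.
move=> cpq e20 e30 e23 s0 fE.
have cop (x y x' y' : F) : x * y' != y * x' -> 
  coprimep (x%:P * p + y%:P * q) (x'%:P * p + y'%:P * q).
  move=> d0; apply/Bezout_coprimepP.
  have [[u v] /= uv1] := Bezout_eq1_coprimepP _ _ cpq.
  exists (y'%:P * u - x'%:P * v, x%:P * v - y%:P * u) => /=.
  have -> : (y'%:P * u - x'%:P * v) * (x%:P * p + y%:P * q)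
      + (x%:P * v - y%:P * u) * (x'%:P * p + y'%:P * q)
      = (x * y' - y * x')%:P * (u * p + v * q).
    by rewrite polyCB !polyCM; ring.
  by rewrite uv1 mulr1 polyC_eqp1 subr_eq0.
have pE : p = 1%:P * p + 0%:P * q by rewrite polyC0 polyC1; ring.
have qE : q = 0%:P * p + 1%:P * q by rewrite polyC0 polyC1; ring.
have p2E e : p - e%:P * q = 1%:P * p + (- e)%:P * q by rewrite polyC1 polyCN; ring.
have C12 : coprimep p (p - e2%:P * q).
  by rewrite p2E [X in coprimep X _]pE; apply: cop; rewrite !mul1r mul0r oppr_eq0.
have C13 : coprimep p (p - e3%:P * q).
  by rewrite p2E [X in coprimep X _]pE; apply: cop; rewrite !mul1r mul0r oppr_eq0.
have C23 : coprimep (p - e2%:P * q) (p - e3%:P * q).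
  by rewrite !p2E; apply: cop; rewrite mul1r mulr1 eqr_opp eq_sym.
have C24 : coprimep (p - e2%:P * q) q.
  by rewrite p2E [X in coprimep _ X]qE; apply: cop; rewrite !mulr1 mulr0 oner_eq0.
have C34 : coprimep (p - e3%:P * q) q.
  by rewrite p2E [X in coprimep _ X]qE; apply: cop; rewrite !mulr1 mulr0 oner_eq0.
have [||] := @sqr_dvd_split4 f s p (p - e2%:P * q) (p - e3%:P * q) q _ _ C34 s0 fE.
- by rewrite !coprimepMr cpq C12 C13.
- by rewrite coprimepMr C23 C24.
move=> s1 [s2 [s3 [s4 [d1 [d2 [d3 [d4 [sE fE' [E1 E2 E3 E4]]]]]]]]].
exists s1, s2, s3, s4, d1, d2, d3, d4; split=> //.
have dW (s' d' r : {poly F}) : r = d' * s' ^+ 2 -> s' %| wronskian r q * 1.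
  move=> ->; rewrite mulr1 /wronskian derivM expr2 derivM.
  by apply/dvdpP; exists ((d'^`() * s' + 2 * d' * s'^`()) * q - d' * s' * q^`()); ring.
have Wsub e : wronskian (p - e%:P * q) q = wronskian p q.
  by rewrite /wronskian derivB derivM derivC; ring.
have := dW _ _ _ E1; have := dW _ _ _ E2; have := dW _ _ _ E3.
rewrite !Wsub !mulr1 => W3 W2 W1.
have W4 : s4 %| wronskian p q.
  rewrite /wronskian E4 expr2 !derivM.
  by apply/dvdpP; exists (p^`() * d4 * s4 - p * (d4^`() * s4 + 2 * d4 * s4^`())); ring.
have sq a d s' : a = d * s' ^+ 2 -> s' %| a by move=> ->; rewrite dvdp_mull // dvdp_exp.
have cop2 a b d d' s' s'' : coprimep a b -> a = d * s' ^+ 2 -> b = d' * s'' ^+ 2 ->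
    coprimep s' s''.
  by move=> cab /sq ha /sq hb; apply: coprimep_dvdl hb (coprimep_dvdr ha cab).
rewrite sE !Gauss_dvdp ?W1 ?W2 ?W3 ?W4 // ?coprimepMr.
- by rewrite (cop2 _ _ _ _ _ _ C34 E3 E4).
- by rewrite (cop2 _ _ _ _ _ _ C23 E2 E3) (cop2 _ _ _ _ _ _ C24 E2 E4).
by rewrite (cop2 _ _ _ _ _ _ C12 E1 E2) (cop2 _ _ _ _ _ _ C13 E1 E3) (cop2 _ _ _ _ _ _ cpq E1 E4).
Qed.

(** Multiplication by ['X] turns the derivative into the Euler operator, which keeps formal degrees;
    top coefficients of Wronskians can then be compared without lowering any degree. *)
Lemma coef_Xderiv p i : ('X * p^`())`_i = i%:R * p`_i.
Proof.
rewrite mulrC coefMX; case: i => [|i] /=; first by rewrite mul0r.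
by rewrite coef_deriv mulr_natl.
Qed.

Lemma size_Xderiv p n : (size p <= n.+1)%N -> (size ('X * p^`())%R <= n.+1)%N.
Proof.
move=> sp; apply/leq_sizeP => i ni; rewrite coef_Xderiv nth_default ?mulr0 //.
exact: leq_trans sp ni.
Qed.

Lemma Xwronskian p q : 'X * wronskian p q = ('X * p^`()) * q - p * ('X * q^`()).
Proof. by rewrite /wronskian; ring. Qed.

Lemma size_Xwronskian p q n m : (size p <= n.+1)%N -> (size q <= m.+1)%N ->
  (size ('X * wronskian p q)%R <= (n + m).+1)%N.
Proof.
move=> sp sq; rewrite Xwronskian; apply: leq_trans (size_polyD _ _) _.
by rewrite size_polyN geq_max !size_mul_top ?size_Xderiv.
Qed.

Lemma coef_Xwronskian p q n m : (size p <= n.+1)%N -> (size q <= m.+1)%N ->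
  ('X * wronskian p q)`_(n + m) = (n%:R - m%:R) * p`_n * q`_m.
Proof.
move=> sp sq; rewrite Xwronskian coefB !coef_mul_top ?size_Xderiv // !coef_Xderiv.
by ring.
Qed.

Lemma deriv_eq0 p : p^`() = 0 -> (size p <= 1)%N.
Proof.
move=> dp; rewrite leqNgt; apply/negP=> sp.
have : p^`()`_(size p).-2 = 0 by rewrite dp coef0.
have -> : p^`()`_(size p).-2 = lead_coef p *+ (size p).-1.
  by rewrite coef_deriv lead_coefE; case: (size p) sp => [|[]].
move/eqP; rewrite mulrn_eq0 lead_coef_eq0 -size_poly_eq0.
by case: (size p) sp => [|[]].
Qed.

(** If a' b = a b' with a and b coprime, then b divides b', so b' = 0 by degree, and b is constant
    in characteristic zero. *)
Lemma coprime_wronskian0 p q : coprimep p q -> wronskian p q = 0 ->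
  (size p <= 1)%N /\ (size q <= 1)%N.
Proof.
have aux a b : coprimep a b -> wronskian a b = 0 -> (size b <= 1)%N.
  move=> cab /eqP; rewrite subr_eq0 => /eqP W0; apply: deriv_eq0; apply/eqP.
  apply: contraT => db0.
  have : b %| a * b^`() by rewrite -W0 dvdp_mull.
  rewrite Gauss_dvdpr 1?coprimep_sym // => /(dvdp_leq db0).
  rewrite leqNgt lt_size_deriv //; apply: contraNneq db0 => ->.
  by rewrite deriv0.
move=> cpq W0; split; last exact: aux W0.
apply: (@aux q); first by rewrite coprimep_sym.
by apply/eqP; rewrite -oppr_eq0 -W0; apply/eqP; rewrite /wronskian; ring.
Qed.

End WronskianFactor.

Section CurveToOde.
Variable F : numFieldType.
Implicit Types a b f p q s : {poly F}.
Lemma size_wronskian_le a b : a != 0 -> b != 0 ->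
  (size (wronskian a b) <= size a + size b - 2)%N.
Proof.
have aux (u v : {poly F}) : u != 0 -> v != 0 -> (size (u^`() * v)%R <= size u + size v - 2)%N.
  move=> u0 v0; have := lt_size_deriv u0; have := size_polyMleq u^`() v.
  have [->|] := eqVneq u^`() 0; first by rewrite mul0r size_poly0.
  by plia.
move=> a0 b0; apply: leq_trans (size_polyD _ _) _; rewrite size_polyN geq_max.
by rewrite aux //= mulrC addnC aux.
Qed.

(* No nonconstant map from the line to the curve [y^2 = x (x - e2) (x - e3)]. *)
Lemma quartic_sqr_const e2 e3 p q s :
    coprimep p q -> e2 != 0 -> e3 != 0 -> e2 != e3 ->
    s ^+ 2 = quartic e2 e3 p q -> q != 0 -> (size p <= 1)%N /\ (size q <= 1)%N.
Proof.
move=> cpq e20 e30 e23 sE q0.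
have size_q_le : forall e, p = e%:P * q -> (size p <= 1)%N /\ (size q <= 1)%N.
  move=> e pE; have sq : size q == 1.
    by rewrite -coprimepp; apply: coprimep_dvdr cpq; rewrite pE dvdp_mull.
  split; last by rewrite (eqP sq).
  by rewrite pE mul_polyC (leq_trans (size_scale_leq _ _)) // (eqP sq).
have [s0|s0] := eqVneq s 0.
  move/eqP: sE; rewrite s0 expr0n /= eq_sym !mulf_eq0 (negPf q0) orbF !subr_eq0.
  case/or3P => /eqP; try exact: size_q_le.
  by move=> p0; apply: (size_q_le 0); rewrite p0 polyC0 mul0r.
have [||||||s1 [s2 [s3 [s4 [d1 [d2 [d3 [d4 [_ _ _ sW]]]]]]]]] :=
  @sqr_dvd_wronskian _ e2 e3 p q 1 s => //; first by rewrite mul1r.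
apply: coprime_wronskian0 => //; apply/eqP; apply: contraT => W0.
have sle := dvdp_leq W0 sW.
have G0 : quartic e2 e3 p q != 0 by rewrite -sE expf_neq0.
move: (G0); rewrite /quartic !mulf_eq0 !negb_or => /and4P[p0 p20 p30 _].
set P2 := p - e2%:P * q in p20 *; set P3 := p - e3%:P * q in p30 *.
have sz : (size s + size s = size p + size P2 + size P3 + size q - 2)%N.
  have : size (s * s) = size (p * (P2 * (P3 * q))) by rewrite -expr2 sE.
  rewrite !size_mul ?mulf_neq0 //.
  by move: p0 p20 p30 q0 s0; plia.
(* The Wronskian is bounded once by [p], [q] and once by [P2], [P3]. The two degree bounds add up to
   less than twice the degree of [s], which contradicts the divisibility. *)
have W2 : size (wronskian P2 P3) = size (wronskian p q).
  have -> : wronskian P2 P3 = (e2 - e3) *: wronskian p q.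
    by rewrite -mul_polyC polyCB /wronskian /P2 /P3 !derivB !derivM !derivC; ring.
  by rewrite size_scale // subr_eq0.
have := size_wronskian_le p0 q0; have := size_wronskian_le p20 p30.
by rewrite W2; move: sle sz W0 p0 p20 p30 q0; clear; plia.
Qed.

Lemma size_sub_mul e p q : (size q < size p)%N -> size (p - e%:P * q) = size p.
Proof.
move=> qp; rewrite size_polyDl // size_polyN mul_polyC.
exact: leq_ltn_trans (size_scale_leq _ _) qp.
Qed.

(** The pullback of the invariant differential is regular, hence a constant multiple of dx / y.
    Concretely, the Wronskian is w s with deg w at most (deg q - deg p + 1) / 2; the pole at
    infinity makes this bound at most 0, so w is constant and deg p = deg q + 1. *)
Lemma ode_of_curve e2 e3 p q f s : coprimep p q -> q != 0 -> (size q < size p)%N ->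
    size f = 4%N -> e2 != 0 -> e3 != 0 -> e2 != e3 ->
    f * s ^+ 2 = quartic e2 e3 p q ->
  size p = (size q).+1 /\ exists2 c, c != 0 &
    wronskian p q ^+ 2 * f = (c ^+ 2)%:P * quartic e2 e3 p q.
Proof.
move=> cpq q0 qp sf e20 e30 e23 fE.
have p0 : p != 0 by rewrite -size_poly_gt0 (leq_ltn_trans _ qp).
have pe0 e : p - e%:P * q != 0 by rewrite -size_poly_gt0 size_sub_mul // size_poly_gt0.
have f0 : f != 0 by rewrite -size_poly_gt0 sf.
have s0 : s != 0.
  have : quartic e2 e3 p q != 0 by rewrite !mulf_neq0.
  by apply: contraNneq => s0; rewrite -fE s0 expr0n mulr0.
have W0 : wronskian p q != 0.
  apply: contraTneq qp => /(coprime_wronskian0 cpq)[p1 _].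
  by rewrite -leqNgt (leq_trans p1) // size_poly_gt0.
have [s1 [s2 [s3 [s4 [d1 [d2 [d3 [d4 [_ _ _ sW]]]]]]]]] :=
  sqr_dvd_wronskian cpq e20 e30 e23 s0 fE.
have sz : (size s + size s + 5 = 3 * size p + size q)%N.
  have : size (f * (s * s)) = size (quartic e2 e3 p q) by rewrite -fE expr2.
  rewrite /quartic !size_mul ?mulf_neq0 ?pe0 // !size_sub_mul // sf.
  by move: p0 q0 s0; plia.
have szW := size_wronskian_le p0 q0.
have /dvdpP[w wE] := sW.
have w0 : w != 0 by apply: contraNneq W0 => w0; rewrite wE w0 mul0r.
have := size_mul w0 s0; rewrite -wE => sws.
have sw : size w = 1%N.
  by move: szW sws sz qp w0 s0 p0 q0; plia.
split; first by move: szW sws sz qp w0 s0 p0 q0; plia.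
have [c c0 wc] := size_poly1P _ (introT eqP sw).
by exists c => //; rewrite wE wc -fE polyC_exp; ring.
Qed.

End CurveToOde.

(** * The differential equation of an isogeny *)

Section OdeUniqueness.
Variable F : numFieldType.
Implicit Types (a b f p q s : {poly F}) (c e : F).

(** The equation f X'^2 = c^2 g(X) for X = p / q, multiplied by q^4. *)
Definition isogeny_ode c e2 e3 f p q :=
  wronskian p q ^+ 2 * f = (c ^+ 2)%:P * quartic e2 e3 p q.

(** The top terms force p / q to behave as x / c^2 at infinity: degrees give n = m + 1, so the
    factor n - m coming from the Wronskian is 1, and the leading coefficients follow. *)
Lemma ode_lead f c e2 e3 p q : f \is monic -> size f = 4%N -> c != 0 ->
    q != 0 -> (size q < size p)%N -> isogeny_ode c e2 e3 f p q ->
  size p = (size q).+1 /\ lead_coef q = c ^+ 2 * lead_coef p.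
Proof.
move=> fm sf c0 q0 qp ode.
have p0 : p != 0 by rewrite -size_poly_gt0 (leq_ltn_trans _ qp).
have [m sq] : exists m, size q = m.+1 by exists (size q).-1; move: q0; plia.
have [n sp] : exists n, size p = n.+1 by exists (size p).-1; move: p0; plia.
have lp : p`_n = lead_coef p by rewrite lead_coefE sp.
have lq : q`_m = lead_coef q by rewrite lead_coefE sq.
have mn : (m < n)%N by move: qp; plia.
have cW : ('X * wronskian p q)`_(n + m) != 0.
  rewrite coef_Xwronskian ?sp ?sq // lp lq !mulf_neq0 ?lead_coef_eq0 //.
  by rewrite subr_eq0 eqr_nat gtn_eqF.
have szW : size ('X * wronskian p q) = (n + m).+1.
  apply/anti_leq; rewrite size_Xwronskian ?sp ?sq //=.
  by rewrite ltnNge; apply: contra cW => h; rewrite nth_default.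
have lW : lead_coef ('X * wronskian p q) = (n%:R - m%:R) * lead_coef p * lead_coef q.
  by rewrite lead_coefE szW coef_Xwronskian ?sp ?sq // lp lq.
have XW0 : 'X * wronskian p q != 0 by rewrite -size_poly_gt0 szW.
have {}ode : ('X * wronskian p q) * ('X * wronskian p q) * f = 
    ('X * 'X) * ((c ^+ 2)%:P * (p * ((p - e2%:P * q) * ((p - e3%:P * q) * q)))).
  by rewrite -[p * _]/(quartic e2 e3 p q) -ode; ring.
move: ('X * wronskian p q) cW szW lW XW0 ode => Z cW szW lW XW0 ode.
have pe0 e : p - e%:P * q != 0 by rewrite -size_poly_gt0 size_sub_mul // size_poly_gt0.
have lpe e : lead_coef (p - e%:P * q) = lead_coef p.
  rewrite lead_coefDl // size_polyN mul_polyC.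
  exact: leq_ltn_trans (size_scale_leq _ _) qp.
have f0 : f != 0 by rewrite monic_neq0.
have C0 : (c ^+ 2)%:P != 0 :> {poly F} by rewrite polyC_eq0 expf_neq0.
have X0 : 'X != 0 :> {poly F} by rewrite polyX_eq0.
move: (pe0 e2) (pe0 e3) (size_sub_mul e2 qp) (size_sub_mul e3 qp) (lpe e2) (lpe e3) ode.
move: (p - e2%:P * q) (p - e3%:P * q) => P2 P3 P20 P30 sP2 sP3 lP2 lP3 ode.
have sC : size (c ^+ 2)%:P = 1%N by rewrite size_polyC expf_neq0.
have lC : lead_coef (c ^+ 2)%:P = c ^+ 2 by rewrite lead_coefC.
move: (c ^+ 2)%:P sC lC C0 ode => C sC lC C0 ode.
have mnE : n = m.+1.
  have := congr1 (fun r : {poly F} => size r) ode.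
  rewrite !size_mul ?mulf_neq0 // size_polyX sC.
  by rewrite sP2 sP3 szW sf sp sq; move: mn; clear; lia.
split; first by rewrite sp sq mnE.
have := congr1 (fun r : {poly F} => lead_coef r) ode.
rewrite !lead_coefM lW lP2 lP3 lead_coefX (eqP (fm : lead_coef f == 1)) lC mnE.
have : lead_coef p != 0 by rewrite lead_coef_eq0.
have : lead_coef q != 0 by rewrite lead_coef_eq0.
move: (lead_coef p) (lead_coef q) => x y y0 x0 E.
have m1 : m.+1%:R - m%:R = 1 :> F by rewrite -natrB // subSnn.
have : x ^+ 2 * y * y = x ^+ 2 * y * (c ^+ 2 * x).
  move: E; rewrite m1 !mul1r !mulr1 => E.
  have -> : x ^+ 2 * y * y = x * y * (x * y) by ring.
  by rewrite E; ring.
by apply: mulfI; rewrite !mulf_neq0 ?expf_neq0.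
Qed.

(** A formal leading term: [u] may be zero, so sums and products need no nonvanishing conditions,
    unlike with [lead_coef]. *)
Definition top n (u : F) p := (size p <= n.+1)%N /\ p`_n = u.

Lemma top_mul n m u v p q : top n u p -> top m v q -> top (n + m) (u * v) (p * q).
Proof. by case=> sp <- [sq <-]; split; [exact: size_mul_top | exact: coef_mul_top]. Qed.

Lemma top_add n u v p q : top n u p -> top n v q -> top n (u + v) (p + q).
Proof.
case=> sp <- [sq <-]; split; last by rewrite coefD.
by apply: leq_trans (size_polyD _ _) _; rewrite geq_max sp.
Qed.

Lemma top_sub n u v p q : top n u p -> top n v q -> top n (u - v) (p - q).
Proof.
case=> sp <- [sq <-]; split; last by rewrite coefB.
by apply: leq_trans (size_polyD _ _) _; rewrite size_polyN geq_max sp.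
Qed.

Lemma top_cast n m u p : n = m -> top n u p -> top m u p.
Proof. by move->. Qed.

Lemma top_const u : top 0 u u%:P.
Proof. by split; [exact: size_polyC_leq1 | rewrite coefC]. Qed.

Lemma top_low n p : (size p <= n)%N -> top n 0 p.
Proof. by move=> sp; split; [exact: leqW | rewrite nth_default]. Qed.

Lemma top_Xwronskian n m u v p q : top n u p -> top m v q ->
  top (n + m) ((n%:R - m%:R) * u * v) ('X * wronskian p q).
Proof. by case=> sp <- [sq <-]; split; [exact: size_Xwronskian | exact: coef_Xwronskian]. Qed.

(** Let Z = X1 - X2 have degree k at infinity; here k is [e] minus [d1 + d2]. Subtracting the two
    equations gives f Z' (X1' + X2') = c^2 Z H, where H is the divided difference of g. As X1 and X2
    both grow as x / c^2, the top coefficients yield 2 k = 3, impossible for an integer. *)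
Lemma ode_unique f c e2 e3 p1 q1 p2 q2 : f \is monic -> size f = 4%N -> c != 0 ->
    q1 != 0 -> (size q1 < size p1)%N -> isogeny_ode c e2 e3 f p1 q1 ->
    q2 != 0 -> (size q2 < size p2)%N -> isogeny_ode c e2 e3 f p2 q2 ->
  p1 * q2 = p2 * q1.
Proof.
move=> fm sf c0 q10 qp1 ode1 q20 qp2 ode2.
have [sp1 lq1] := ode_lead fm sf c0 q10 qp1 ode1.
have [sp2 lq2] := ode_lead fm sf c0 q20 qp2 ode2.
have [d1 sq1] : exists d, size q1 = d.+1 by exists (size q1).-1; move: q10; plia.
have [d2 sq2] : exists d, size q2 = d.+1 by exists (size q2).-1; move: q20; plia.
rewrite sq1 in sp1; rewrite sq2 in sp2.
apply/eqP; rewrite -subr_eq0; apply/eqP; set D := p1 * q2 - p2 * q1.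
apply/eqP/negPn/negP => D0.
have [e sD] : exists d, size D = d.+1 by exists (size D).-1; move: D0; plia.
pose Q := q1 * q2; pose P1 := p1 * q2; pose P2 := p2 * q1.
pose W1 := 'X * wronskian p1 q1; pose W2 := 'X * wronskian p2 q2.
pose H := P1 * P1 + P1 * P2 + P2 * P2 
  - ((e2 + e3)%:P * (P1 + P2) * Q - (e2 * e3)%:P * (Q * Q)).
have key : ('X * wronskian D Q) * (W1 * (q2 * q2) + W2 * (q1 * q1)) * f
    = ('X * 'X) * ((c ^+ 2)%:P * D * Q * H).
  have WE : wronskian D Q = wronskian p1 q1 * q2 ^+ 2 - wronskian p2 q2 * q1 ^+ 2.
    by rewrite /wronskian /D /Q !(derivB, derivM); ring.
  have : (wronskian p1 q1 ^+ 2 * f) * q2 ^+ 4 - (wronskian p2 q2 ^+ 2 * f) * q1 ^+ 4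
     = (c ^+ 2)%:P * (quartic e2 e3 p1 q1 * q2 ^+ 4 - quartic e2 e3 p2 q2 * q1 ^+ 4).
    by rewrite ode1 ode2; ring.
  have -> : quartic e2 e3 p1 q1 * q2 ^+ 4 - quartic e2 e3 p2 q2 * q1 ^+ 4 = D * Q * H.
    by rewrite /quartic /H /D /P1 /P2 /Q polyCD polyCM; ring.
  move=> E; rewrite -[_ * D * Q * H]mulrA -[_ * D * _]mulrA [D * (Q * H)]mulrA -E.
  by rewrite WE /W1 /W2; ring.
set x := lead_coef p1 in lq1; set y := lead_coef p2 in lq2.
have tp1 : top d1.+1 x p1 by split; rewrite ?sp1 // /x lead_coefE sp1.
have tp2 : top d2.+1 y p2 by split; rewrite ?sp2 // /y lead_coefE sp2.
have tq1 : top d1 (c ^+ 2 * x) q1 by split; rewrite ?sq1 // -lq1 lead_coefE sq1.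
have tq2 : top d2 (c ^+ 2 * y) q2 by split; rewrite ?sq2 // -lq2 lead_coefE sq2.
have tD : top e (lead_coef D) D by split; rewrite ?sD // lead_coefE sD.
have tQ : top (d1 + d2) (c ^+ 4 * x * y) Q.
  by rewrite (_ : c ^+ 4 * x * y = (c ^+ 2 * x) * (c ^+ 2 * y)); [exact: top_mul | ring].
have tP1 : top (d1 + d2).+1 (c ^+ 2 * x * y) P1.
  by rewrite -addSn (_ : _ * y = x * (c ^+ 2 * y)); [exact: top_mul | ring].
have tP2 : top (d1 + d2).+1 (c ^+ 2 * x * y) P2.
  rewrite addnC -addSn (_ : _ * y = y * (c ^+ 2 * x)); [exact: top_mul | ring].
have tH := top_sub (top_add (top_add (top_mul tP1 tP1) (top_mul tP1 tP2)) (top_mul tP2 tP2))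
  (top_sub (top_mul (top_mul (top_const (e2 + e3)) (top_add tP1 tP2)) (top_low tQ.1))
    (top_mul (top_const (e2 * e3)) (top_mul (top_low tQ.1) (top_low tQ.1)))).
have tF : top 3 1 f by split; rewrite ?sf //; move: fm; rewrite monicE lead_coefE sf => /eqP.
have tX : top 1 1 ('X : {poly F}) by split; rewrite ?size_polyX // coefX.
have tR := top_mul (top_mul tX tX) (top_mul (top_mul (top_mul (top_const (c ^+ 2)) tD) tQ) tH).
have tW1 := top_Xwronskian tp1 tq1; have tW2 := top_Xwronskian tp2 tq2.
have tW2' := top_cast (_ : _ = d1.+1 + d1 + (d2 + d2))%N (top_mul tW2 (top_mul tq1 tq1)).
have {tW2'}tL := top_mul (top_mul (top_Xwronskian tD tQ)
  (top_add (top_mul tW1 (top_mul tq2 tq2)) (tW2' _))) tF.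
have {}tL := tL ltac:(lia).
have {}tR := top_cast (_ : _ = e + (d1 + d2) + (d1.+1 + d1 + (d2 + d2)) + 3)%N tR.
have {}tR := (tR ltac:(lia)).2.
rewrite -key tL.2 in tR.
have z0 : lead_coef D != 0 by rewrite lead_coef_eq0.
have x0 : x != 0 by rewrite /x lead_coef_eq0 -size_poly_gt0 sp1.
have y0 : y != 0 by rewrite /y lead_coef_eq0 -size_poly_gt0 sp2.
move: (lead_coef D) z0 tR => z z0 E.
have {E} : c ^+ 10 * x ^+ 3 * y ^+ 3 * z * ((e%:R - (d1 + d2)%:R) * 2 - 3) = 0.
  move: E; rewrite -[d1.+1]addn1 -[d2.+1]addn1 !natrD => /eqP; rewrite -subr_eq0 => /eqP <-.
  by ring.
move/eqP; rewrite !mulf_eq0 ?expf_eq0 /= (negPf c0) (negPf x0) (negPf y0) (negPf z0) /=.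
rewrite mulrBl subr_eq0 subr_eq -!natrM -natrD eqr_nat => /eqP; lia.
Qed.
End OdeUniqueness.

(** * Quotient by a rational 2-torsion point *)

Section Substitution.
Variable F : numFieldType.
Implicit Types (f p q r s u v : {poly F}) (a b c e x : F).

Lemma poly_eq0_nonroot v p : v != 0 -> (forall x, v.[x] != 0 -> p.[x] = 0) -> p = 0.
Proof.
move=> v0 pv; apply: (mulIf v0); rewrite mul0r; apply/eqP/negPn/negP => pv0.
pose rs : seq F := [seq i%:R | i <- iota 0 (size (p * v))].
suff: (size rs < size (p * v)%R)%N by rewrite size_map size_iota ltnn.
apply: max_poly_roots => //.
  apply/allP => _ /mapP[i _ ->]; rewrite rootE hornerM.
  by have [->|/pv->] := eqVneq v.[i%:R] 0; rewrite ?mulr0 ?mul0r.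
by rewrite map_inj_uniq ?iota_uniq // => i j /eqP; rewrite eqr_nat => /eqP.
Qed.

(** The polynomial v^n p(u / v), for n at least the degree of [p]. *)
Definition hom n p u v := \sum_(i < n.+1) p`_i *: (u ^+ i * v ^+ (n - i)).

Lemma horner_hom n p u v x : (size p <= n.+1)%N -> v.[x] != 0 ->
  (hom n p u v).[x] = v.[x] ^+ n * p.[u.[x] / v.[x]].
Proof.
move=> sp v0; rewrite (horner_coef_wide _ sp) horner_sum mulr_sumr.
apply: eq_bigr => i _; rewrite hornerZ hornerM !horner_exp exprMn exprVn.
by rewrite expfB_cond ?(negPf v0) ?add0n -1?ltnS //; ring.
Qed.

Lemma deriv_hom n p u v x : (size p <= n.+1)%N -> v.[x] != 0 ->
  (hom n p u v)^`().[x] = n%:R * v^`().[x] / v.[x] * (hom n p u v).[x]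
    + v.[x] ^+ n * p^`().[u.[x] / v.[x]]
      * ((u^`().[x] * v.[x] - u.[x] * v^`().[x]) / v.[x] ^+ 2).
Proof.
move=> sp v0; rewrite horner_hom //.
have -> : p^`().[u.[x] / v.[x]] = \sum_(i < n.+1) p`_i * (i%:R * (u.[x] / v.[x]) ^+ i.-1).
  rewrite [in LHS](_ : p = \sum_(i < n.+1) p`_i *: 'X^i); last first.
    by rewrite -poly_def; apply/polyP=> i; rewrite coef_poly; case: ltnP => // /(leq_trans sp)/(nth_default 0)->.
  rewrite linear_sum horner_sum; apply: eq_bigr => i _.
  by rewrite /= derivZ derivXn hornerZ hornerMn hornerXn mulr_natl.
rewrite (horner_coef_wide _ sp) linear_sum horner_sum !mulr_sumr mulr_suml -big_split /=.
apply: eq_bigr => i _; rewrite /= derivZ hornerZ derivM !deriv_exp !(hornerD, hornerM, hornerMn, horner_exp).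
have ni : (i <= n)%N by rewrite -ltnS.
have -> : v.[x] ^+ n = v.[x] ^+ i * v.[x] ^+ (n - i) by rewrite -exprD subnKC.
have -> : n%:R = i%:R + (n - i)%:R :> F by rewrite -natrD subnKC.
set U := u.[x]; set V := v.[x] in v0 *; rewrite -!(mulr_natl (_ * _)).
move: (n - i)%N => m; case: (nat_of_ord i) => [|k] /=; case: m => [|m] /=;
  rewrite ?exprS ?exprMn ?exprVn ?expr0; field; rewrite ?v0 ?expf_neq0 //.
Qed.

Lemma wronskian_hom n p q u v x : (size p <= n.+1)%N -> (size q <= n.+1)%N -> v.[x] != 0 ->
  (wronskian (hom n p u v) (hom n q u v)).[x] = v.[x] ^+ n * v.[x] ^+ n
    * ((u^`().[x] * v.[x] - u.[x] * v^`().[x]) / v.[x] ^+ 2)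
    * (wronskian p q).[u.[x] / v.[x]].
Proof.
move=> sp sq v0; rewrite /wronskian !(hornerD, hornerN, hornerM) !deriv_hom // !horner_hom //.
by field.
Qed.

Lemma quartic_hom n e2 e3 p q u v x : (size p <= n.+1)%N -> (size q <= n.+1)%N -> v.[x] != 0 ->
  (quartic e2 e3 (hom n p u v) (hom n q u v)).[x] = v.[x] ^+ n * v.[x] ^+ n * v.[x] ^+ n * v.[x] ^+ n
    * (quartic e2 e3 p q).[u.[x] / v.[x]].
Proof.
move=> sp sq v0; rewrite /quartic !(hornerD, hornerN, hornerM) !horner_hom // !hornerC.
by ring.
Qed.

(** The equation concerns only the function p / q, so it passes to any other fraction with the same
    value. *)
Lemma ode_ratio c e2 e3 f p q r s : q != 0 -> q * r = p * s ->
  isogeny_ode c e2 e3 f p q -> isogeny_ode c e2 e3 f r s.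
Proof.
move=> q0 qr ode; apply: (mulfI (expf_neq0 4 q0)).
have Wq : q ^+ 2 * wronskian r s = wronskian p q * s ^+ 2.
  have dqr : q^`() * r + q * r^`() = p^`() * s + p * s^`() by rewrite -!derivM qr.
  rewrite (_ : _ * _ = q * ((q * r^`()) * s - (q * r) * s^`())); last by rewrite /wronskian; ring.
  have -> : q * r^`() = p^`() * s + p * s^`() - q^`() * r by rewrite -dqr; ring.
  rewrite qr (_ : _ * _ = s * (q * p^`() * s - q^`() * (q * r))); last by ring.
  by rewrite qr /wronskian; ring.
have -> : q ^+ 4 * (wronskian r s ^+ 2 * f) = (q ^+ 2 * wronskian r s) ^+ 2 * f by ring.
rewrite Wq (_ : _ * f = (wronskian p q ^+ 2 * f) * s ^+ 4); last by ring.
rewrite ode /quartic.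
transitivity ((c ^+ 2)%:P * ((q * r) * ((q * r - e2%:P * (q * s)) * ((q * r - e3%:P * (q * s)) * (q * s))))).
  by rewrite qr; ring.
by ring.
Qed.

Lemma hom_const_top n p b : (size p <= n.+1)%N -> top n p.[0] (hom n p b%:P 'X).
Proof.
move=> sp; rewrite horner_coef0 /hom big_ord_recl /= expr0 mul1r subn0 -[X in top _ X _]addr0.
apply: top_add.
  split; last by rewrite coefZ coefXn eqxx mulr1.
  by rewrite (leq_trans (size_scale_leq _ _)) // size_polyXn.
apply: top_low; apply: leq_trans (size_sum _ _ _) _; apply/bigmax_leqP => i _.
rewrite (leq_trans (size_scale_leq _ _)) // -polyC_exp mul_polyC (leq_trans (size_scale_leq _ _)) //.
by rewrite size_polyXn /bump /=; case: i => i /=; lia.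
Qed.

End Substitution.

Section Trace.
Variable F : numFieldType.
Implicit Types (f p q r s u v : {poly F}) (a b c e x : F).

Definition cubic a b : {poly F} := 'X * ('X^2 + a%:P * 'X + b%:P).

Lemma top_exp n k a p : top n a p -> top (k * n) (a ^+ k) (p ^+ k).
Proof.
move=> tp; elim: k => [|k IH]; first by rewrite mul0n !expr0; apply: (top_const 1).
by rewrite mulSn !exprS; apply: top_mul.
Qed.

Lemma top_X : top 1 1 ('X : {poly F}).
Proof. by split; rewrite ?size_polyX // coefX. Qed.

Lemma top_quad a b : top 2 1 ('X^2 + a%:P * 'X + b%:P).
Proof.
have s2 : (size (b%:P : {poly F}) <= 2)%N by rewrite (leq_trans (size_polyC_leq1 _)).
have s1 : (size (a%:P * 'X : {poly F})%R <= 2)%N.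
  by rewrite mul_polyC (leq_trans (size_scale_leq _ _)) // size_polyX.
have := top_add (top_add (top_exp 2 top_X) (top_low s1)) (top_low s2).
by rewrite expr1n !addr0.
Qed.

Lemma top_monic n p : top n 1 p -> size p = n.+1 /\ p \is monic.
Proof.
case=> sp pn; have sz : size p = n.+1.
  apply/anti_leq; rewrite sp ltnNge; apply/negP=> h.
  by move/eqP: pn; rewrite nth_default // eq_sym oner_eq0.
by rewrite monicE lead_coefE sz pn.
Qed.

Lemma top_cubic a b : top 3 1 (cubic a b).
Proof. by rewrite -[1]mulr1; apply: (top_mul top_X (top_quad a b)). Qed.

Lemma hom_quad_top n p a b : (size p <= n.+1)%N ->
  top (2 * n) p`_n (hom n p ('X^2 + a%:P * 'X + b%:P) 'X).
Proof.
move=> sp; rewrite /hom big_ord_recr /= subnn expr0 mulr1 -[X in top _ X _]add0r.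
have tq k := top_exp k (top_quad a b).
apply: top_add; last first.
  by have := top_mul (top_const p`_n) (tq n); rewrite expr1n mulr1 add0n mulnC mul_polyC.
apply: top_low; apply: leq_trans (size_sum _ _ _) _; apply/bigmax_leqP => i _.
rewrite (leq_trans (size_scale_leq _ _)) //.
have [h _] := top_mul (tq i) (top_exp (n - i) top_X).
by apply: leq_trans h _; have := ltn_ord i; lia.
Qed.

Lemma horner0_hom_quad n p a b :
  (hom n p ('X^2 + a%:P * 'X + b%:P) 'X).[0] = p`_n * b ^+ n.
Proof.
rewrite /hom horner_sum big_ord_recr /= big1 ?add0r => [|i _].
  by rewrite subnn expr0 mulr1 hornerZ horner_exp !hornerE ?expr0n /= ?mulr0 ?add0r.
rewrite hornerZ hornerM hornerXn expr0n /=.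
by rewrite subn_eq0 leqNgt ltn_ord !mulr0.
Qed.

Lemma hom_quad_neq0 p a b : p != 0 -> hom (size p).-1 p ('X^2 + a%:P * 'X + b%:P) 'X != 0.
Proof.
move=> p0; have [|_ top_p] := @hom_quad_top (size p).-1 p a b; first exact: leqSpred.
by apply: contra_neq p0 => h0; apply/eqP; rewrite -lead_coef_eq0 lead_coefE -top_p h0 coef0.
Qed.

(* [trace_poly a b n] is [x ^ n + (b / x) ^ n] as a polynomial in [x + a + b / x]. *)
Fixpoint trace_poly a b n : {poly F} :=
  match n with
  | 0 => 2%:P
  | k.+1 => match k with
    | 0 => 'X - a%:P
    | j.+1 => ('X - a%:P) * trace_poly a b k - b%:P * trace_poly a b j
    end
  end.

Lemma horner_trace_poly a b n x : x != 0 ->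
  (trace_poly a b n).[x + a + b / x] = x ^+ n + (b / x) ^+ n.
Proof.
move=> x0; suff: (trace_poly a b n).[x + a + b / x] = x ^+ n + (b / x) ^+ n /\
   (trace_poly a b n.+1).[x + a + b / x] = x ^+ n.+1 + (b / x) ^+ n.+1 by case.
elim: n => [|n [IH1 IH2]]; first by rewrite /= !hornerE !expr0 !expr1; split; [|ring].
split=> //; rewrite [trace_poly _ _ _]/(('X - a%:P) * trace_poly a b n.+1 - b%:P * trace_poly a b n).
by rewrite hornerD hornerN !hornerM IH1 IH2 !hornerE !exprS; field.
Qed.

Lemma top_trace_poly a b n : (size (trace_poly a b n) <= n.+1)%N /\ top n.+1 1 (trace_poly a b n.+1).
Proof.
have tX : top 1 1 ('X - a%:P) by split; rewrite ?size_XsubC // coefB coefX coefC subr0.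
elim: n => [|n [IH1 IH2]]; first by split; [exact: size_polyC_leq1 |].
split; first by case: IH2.
rewrite [trace_poly _ _ _]/(('X - a%:P) * trace_poly a b n.+1 - b%:P * trace_poly a b n).
rewrite -[1]subr0; apply: top_sub; first by rewrite -[1]mulr1 -add1n; apply: top_mul.
apply: top_low; rewrite mul_polyC (leq_trans (size_scale_leq _ _)) //.
exact: leqW.
Qed.

(** The sum of [p] over an orbit of the translation x |-> b / x, as a function of u = x + a + b / x.
    This u is the coordinate of the quotient by (0, 0), whose cubic is u (u^2 - 2 a u + a^2 - 4
    b). *)
Definition trace a b p := \sum_(i < size p) p`_i *: trace_poly a b i.

Lemma horner_trace a b p x : x != 0 -> (trace a b p).[x + a + b / x] = p.[x] + p.[b / x].
Proof.
move=> x0; rewrite horner_sum !horner_coef -big_split /=; apply: eq_bigr => i _.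
by rewrite hornerZ horner_trace_poly // mulrDr.
Qed.

Lemma top_trace a b p n : size p = n.+2 -> top n.+1 (lead_coef p) (trace a b p).
Proof.
move=> sp; rewrite /trace sp big_ord_recr /= lead_coefE sp -[X in top _ X _]add0r.
apply: top_add; last first.
  by have := top_mul (top_const p`_n.+1) (top_trace_poly a b n).2; rewrite mulr1 mul_polyC.
apply: top_low; apply: leq_trans (size_sum _ _ _) _; apply/bigmax_leqP => i _.
rewrite (leq_trans (size_scale_leq _ _)) // (leq_trans (top_trace_poly a b i).1) //.
Qed.
End Trace.

Section Descent.
Variable F : numFieldType.
Implicit Types (f p q r s u v : {poly F}) (a b c e x : F).

Lemma size_succ m p : (m < size p)%N -> exists n, size p = n.+1.
Proof. by case: (size p) => [|n] // _; exists n. Qed.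

Lemma horner_cubic a b x : (cubic a b).[x] = x * (x ^+ 2 + a * x + b).
Proof. by rewrite /cubic !hornerE. Qed.

(* Translation by the 2-torsion point [(0, 0)] acts as [x |-> b / x]; it fixes
   [p / q] because both satisfy the same differential equation and have a pole
   at infinity. *)
Lemma ode_translation_invariant c e2 e3 a b p q : b != 0 -> c != 0 ->
    coprimep p q -> q != 0 -> (size q < size p)%N -> root q 0 ->
    isogeny_ode c e2 e3 (cubic a b) p q ->
  forall x, x != 0 -> p.[x] * q.[b / x] = p.[b / x] * q.[x].
Proof.
move=> b0 c0 cpq q0 qp rq ode.
have [N sp] := size_succ qp.
have lep : (size p <= N.+1)%N by rewrite sp.
have leq : (size q <= N.+1)%N by rewrite -sp ltnW.
pose p' := hom N p b%:P 'X; pose q' := hom N q b%:P 'X.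
have bX x : x != 0 -> (b%:P).[x] / ('X : {poly F}).[x] = b / x by rewrite hornerC hornerX.
have p'E x : x != 0 -> p'.[x] = x ^+ N * p.[b / x].
  by move=> x0; rewrite horner_hom ?hornerX // hornerC.
have q'E x : x != 0 -> q'.[x] = x ^+ N * q.[b / x].
  by move=> x0; rewrite horner_hom ?hornerX // hornerC.
have p00 : p.[0] != 0 by apply: (coprimep_root (p := q)); rewrite 1?coprimep_sym.
have [sp' p'N] := hom_const_top b lep.
have [sq' q'N] := hom_const_top b leq.
have {}sp' : size p' = N.+1.
  by apply/anti_leq; rewrite sp' ltnNge; apply: contra p00 => h; rewrite -p'N nth_default.
(* As [q] vanishes at 0 and [p] does not, the translated function has a pole at infinity, as
   uniqueness requires. *)
have {}sq' : (size q' < size p')%N.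
  rewrite sp' ltnS; apply/leq_sizeP => j; rewrite leq_eqVlt => /predU1P[<-|Nj].
    by rewrite q'N; apply/eqP.
  by rewrite nth_default // (leq_trans sq').
have q'0 : q' != 0.
  apply: contra_neq q0 => q'0.
  apply: (@poly_eq0_nonroot _ 'X); rewrite ?polyX_eq0 // => x; rewrite hornerX => x0.
  have bx0 : b / x != 0 by rewrite mulf_neq0 ?invr_eq0.
  have := q'E _ bx0; rewrite q'0 horner0 => /esym/eqP; rewrite mulf_eq0 expf_eq0 (negPf bx0) andbF /=.
  have -> : b / (b / x) = x by field; rewrite b0 x0.
  by move/eqP.
have ode' : isogeny_ode c e2 e3 (cubic a b) p' q'.
  apply/eqP; rewrite -subr_eq0; apply/eqP.
  apply: (@poly_eq0_nonroot _ 'X); rewrite ?polyX_eq0 // => x x0.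
  rewrite hornerD hornerN !(hornerM (_ ^+ 2)) !(hornerM _%:P) horner_exp hornerC.
  rewrite wronskian_hom // quartic_hom //; rewrite hornerX in x0 *.
  rewrite !hornerC derivC horner0 derivX.
  have := congr1 (fun r => r.[b / x]) ode.
  rewrite !(hornerM (_ ^+ 2)) !(hornerM _%:P) horner_exp hornerC !horner_cubic hornerC.
  move: (wronskian p q).[_] (quartic e2 e3 p q).[_] => W G E.
  (* The translation preserves dx / y up to sign: the cubic at b / x is (b / x^2)^2 times the cubic
     at x. *)
  transitivity (x ^+ N * x ^+ N * x ^+ N * x ^+ N * (W ^+ 2 * (b / x * ((b / x) ^+ 2 + a * (b / x) + b)) - c ^+ 2 * G)).
    by field.
  by rewrite E subrr mulr0.
have tm := top_monic (top_cubic a b).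
have key := ode_unique tm.2 tm.1 c0 q0 qp ode q'0 sq' ode'.
move=> x x0; have := congr1 (fun r => r.[x]) key.
rewrite !hornerM p'E // q'E // => E; apply: (mulfI (expf_neq0 N x0)).
by rewrite mulrCA E mulrA.
Qed.

(** By invariance p / q equals [trace a b p] over [trace a b q], taken at u = x + a + b / x. The
    constant [c] survives because the cubic of the quotient at u is (1 - b / x^2)^2 times the cubic
    at x, and 1 - b / x^2 is the derivative of u. Since u has degree 2 in x, the degree drops. *)
Lemma ode_descent c e2 e3 a b p q : b != 0 -> c != 0 ->
    coprimep p q -> q != 0 -> (size q < size p)%N -> root q 0 ->
    isogeny_ode c e2 e3 (cubic a b) p q ->
  exists p1 q1, [/\ coprimep p1 q1, q1 != 0, (size q1 < size p1)%N, (size p1 < size p)%N &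
    isogeny_ode c e2 e3 (cubic (- 2 * a) (a ^+ 2 - 4 * b)) p1 q1].
Proof.
move=> b0 c0 cpq q0 qp rq ode.
have inv := ode_translation_invariant b0 c0 cpq q0 qp rq ode.
have [m sq] : exists m, size q = m.+2.
  have : (1 < size q)%N by rewrite (root_size_gt1 q0 rq).
  by case: (size q) => [|[|m]] // _; exists m.
have [n sp] : exists n, size p = n.+2.
  by move: qp; rewrite sq; case: (size p) => [|[|n]] // _; exists n.
have mn : (m < n)%N by move: qp; rewrite sp sq.
pose P := trace a b p; pose Q := trace a b q.
have p0 : p != 0 by rewrite -size_poly_gt0 sp.
have size_trace r k : r != 0 -> size r = k.+2 -> size (trace a b r) = k.+2.
  move=> r0 sr; have [s1 s2] := top_trace a b sr; apply/anti_leq; rewrite s1 ltnNge.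
  by apply/negP => h; move: s2; rewrite nth_default // => /eqP; rewrite eq_sym lead_coef_eq0 (negPf r0).
have sP : size P = n.+2 by exact: size_trace.
have sQ : size Q = m.+2 by exact: size_trace.
have P0 : P != 0 by rewrite -size_poly_gt0 sP.
have Q0 : Q != 0 by rewrite -size_poly_gt0 sQ.
pose g := gcdp P Q; have g0 : g != 0 by rewrite gcdp_eq0 negb_and P0.
pose p1 := P %/ g; pose q1 := Q %/ g.
have PE : P = p1 * g by rewrite divpK // dvdp_gcdl.
have QE : Q = q1 * g by rewrite divpK // dvdp_gcdr.
have p10 : p1 != 0 by apply: contraNneq P0 => h; rewrite PE h mul0r.
have q10 : q1 != 0 by apply: contraNneq Q0 => h; rewrite QE h mul0r.
have cpq1 : coprimep p1 q1 by apply: coprimep_div_gcd; rewrite P0.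
have qp1 : (size q1 < size p1)%N.
  have := size_mul p10 g0; have := size_mul q10 g0; rewrite -PE -QE sP sQ.
  by move: g0 p10 q10 mn; clear; plia.
have [k sp1] := size_succ qp1.
have le_p1 : (size p1 <= k.+1)%N by rewrite sp1.
have le_q1 : (size q1 <= k.+1)%N by rewrite -sp1 ltnW.
pose u : {poly F} := 'X^2 + a%:P * 'X + b%:P.
have uX x : x != 0 -> u.[x] / ('X : {poly F}).[x] = x + a + b / x.
  by move=> x0; rewrite !hornerE; field.
have homE j r x : (size r <= j.+1)%N -> x != 0 -> (hom j r u 'X).[x] = x ^+ j * r.[x + a + b / x].
  by move=> sr x0; rewrite horner_hom ?hornerX // -uX // hornerX.
have X0 : 'X != 0 :> {poly F} by rewrite polyX_eq0.
pose Ph := hom k p1 u 'X; pose Qh := hom k q1 u 'X.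
have pQh : p * Qh = q * Ph.
  have hg0 := hom_quad_neq0 a b g0; rewrite -/u in hg0.
  apply: (mulIf hg0); apply/eqP; rewrite -subr_eq0; apply/eqP.
  apply: (poly_eq0_nonroot X0) => x; rewrite hornerX => x0.
  rewrite !hornerE !homE ?leqSpred //.
  have E : p.[x] * Q.[x + a + b / x] = q.[x] * P.[x + a + b / x].
    by rewrite !horner_trace // !mulrDr inv //; ring.
  move: E; rewrite PE QE !hornerM.
  move: (x ^+ k) (x ^+ (size g).-1) p.[x] q.[x] p1.[_] q1.[_] g.[_] => y z A B C D G E.
  have -> : A * (y * D) * (z * G) = y * z * (A * (D * G)) by ring.
  by rewrite E; ring.
have Qh0 : Qh != 0.
  apply: contraNneq q10 => Qh0; apply/eqP.
  have E : hom (size q1).-1 q1 u 'X = 0.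
    apply: (poly_eq0_nonroot X0) => x; rewrite hornerX => x0.
    have := congr1 (fun r => r.[x]) Qh0; rewrite horner0 !homE ?leqSpred // => /eqP.
    by rewrite mulf_eq0 expf_eq0 (negPf x0) andbF /= => /eqP->; rewrite mulr0.
  by apply: contra_eq E; apply: hom_quad_neq0.
have odeh : isogeny_ode c e2 e3 (cubic a b) Ph Qh by apply: ode_ratio ode => //; rewrite pQh.
have lp1 : p1`_k = lead_coef p1 by rewrite lead_coefE sp1.
have Ph00 : Ph.[0] != 0 by rewrite horner0_hom_quad lp1 mulf_neq0 ?lead_coef_eq0 ?expf_neq0.
have sPh : size Ph = (2 * k).+1.
  have [s1 s2] := hom_quad_top a b le_p1; apply/anti_leq; rewrite s1 ltnNge.
  by apply/negP => h; move: s2; rewrite nth_default // => /esym/eqP; rewrite lp1 lead_coef_eq0 (negPf p10).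
(* The Bezout relation of [p1] and [q1], composed with x + a + b / x and cleared of denominators,
   shows that a common divisor divides a power of ['X]; but [Ph] does not vanish at 0. *)
have cPQh : coprimep Ph Qh.
  have [[v w] /= vw] := Bezout_eq1_coprimepP _ _ cpq1.
  pose j := maxn (size v) (size w).
  have bez : hom j v u 'X * Ph + hom j w u 'X * Qh = 'X^(k + j).
    apply/eqP; rewrite -subr_eq0; apply/eqP; apply: (poly_eq0_nonroot X0) => x; rewrite hornerX => x0.
    rewrite hornerD hornerN hornerD !hornerM hornerXn !homE //; last 2 first.
    - by rewrite leqW // leq_maxr.
    - by rewrite leqW // leq_maxl.
    have := congr1 (fun r => r.[x + a + b / x]) vw; rewrite hornerD !hornerM hornerC => E.
    rewrite exprD -[X in _ - X]mulr1 -E; ring.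
  apply/coprimepP => d dP dQ.
  have : d %| 'X^(k + j) by rewrite -bez dvdp_add // dvdp_mull.
  move=> dX; have cPX : coprimep Ph 'X^(k + j).
    by rewrite coprimep_expr // -['X]subr0 -polyC0 coprimep_XsubC.
  by have /coprimepP := cPX; apply.
have sPhp : (size Ph <= size p)%N.
  apply: dvdp_leq => //; rewrite -(@Gauss_dvdpl _ _ Qh) // pQh dvdp_mull //.
exists p1, q1; split=> //.
  have k0 : (0 < k)%N by rewrite -ltnS -sp1 (leq_trans _ qp1) // ltnS size_poly_gt0.
  by apply: leq_trans sPhp; rewrite sPh sp1; move: k0; clear; lia.
have hom0 (R : {poly F}) : hom (size R).-1 R u 'X = 0 -> R = 0.
  by move=> h; apply/eqP; apply: contra_eqT h; apply: hom_quad_neq0.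
apply/eqP; rewrite -subr_eq0; apply/eqP; apply: hom0.
apply: (poly_eq0_nonroot X0) => x; rewrite hornerX => x0.
rewrite homE ?leqSpred //; apply/eqP; rewrite mulf_eq0; apply/orP; right; apply/eqP.
have := congr1 (fun r => r.[x]) odeh.
rewrite hornerD hornerN !(hornerM (_ ^+ 2)) !(hornerM _%:P) !(horner_exp (wronskian _ _)) !hornerC.
have vx : ('X : {poly F}).[x] != 0 by rewrite hornerX.
rewrite (wronskian_hom u le_p1 le_q1 vx) (quartic_hom e2 e3 u le_p1 le_q1 vx) uX //.
have -> : (u^`().[x] * ('X : {poly F}).[x] - u.[x] * ('X : {poly F})^`().[x]) / ('X : {poly F}).[x] ^+ 2
    = 1 - b / x ^+ 2.
  have -> : u^`().[x] = 2 * x + a.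
    rewrite /u !derivD derivXn derivM !derivC derivX /= !hornerD !hornerM !hornerX !hornerC.
    by ring.
  by rewrite derivX !hornerE; field.
rewrite hornerX !horner_cubic.
move: (wronskian p1 q1).[_] (quartic e2 e3 p1 q1).[_] => W G E.
have xk : x ^+ k * x ^+ k * x ^+ k * x ^+ k != 0 by rewrite !mulf_neq0 ?expf_neq0.
apply: (mulfI xk); rewrite mulr0 mulrBr [X in _ - X]mulrCA -E.
move: (x ^+ k) => y; by field.
Qed.
End Descent.

(** * Injectivity on 2-torsion *)

Section TwoTorsion.
Variable F : numFieldType.
Implicit Types (d f g p q s t : {poly F}) (a b c e x r : F).

Lemma size2_factor d : size d = 2%N -> exists l r : F, l != 0 /\ d = l%:P * ('X - r%:P).
Proof.
move=> sd; have l0 : d`_1 != 0.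
  by rewrite -[1%N]/(2.-1) -sd -lead_coefE lead_coef_eq0 -size_poly_eq0 sd.
exists d`_1, (- d`_0 / d`_1); split=> //; apply/polyP => i.
rewrite coefCM coefB coefX coefC; case: i => [|[|i]] /=.
- by field.
- by rewrite subr0 mulr1.
by rewrite subr0 mulr0 nth_default // sd.
Qed.

Lemma size_mul_sqr d t g : d != 0 -> t != 0 -> g = d * t ^+ 2 ->
  (size g + 2 = size d + 2 * size t)%N.
Proof.
move=> d0 t0 ->; rewrite expr2 size_mul ?mulf_neq0 // size_mul //.
by move: d0 t0; plia.
Qed.

(** Modulo squares [l1] and [l2] both equal [l], so l1 l2 is a square, and therefore so is l3 l4.
    The constants thus disappear from the last hypothesis, leaving [D] equal to [e] modulo
    squares. *)
Lemma square_ratio (l l1 l2 l3 l4 t1 t2 e D x y : F) :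
    t1 != 0 -> t2 != 0 -> y != 0 ->
    l = l1 * t1 ^+ 2 -> l = l2 * t2 ^+ 2 -> l1 * l2 * l3 * l4 = 1 ->
    e * (l4 * x ^+ 2) = l3 * D * y ^+ 2 ->
  D = e * (l / (t1 * t2) / (l1 * l2 * l3) * (x / y)) ^+ 2.
Proof.
move=> t10 t20 y0 L1 L2 lf h.
have : l1 * l2 * l3 * l4 != 0 by rewrite lf oner_neq0.
rewrite !mulf_eq0 !negb_or -!andbA => /and4P[l10 l20 l30 l40].
have lt : (l / (t1 * t2)) ^+ 2 = l1 * l2.
  rewrite expr2 {1}L1 L2; field; rewrite ?t10 ?t20 //.
have l4E : l4 = (l1 * l2 * l3)^-1 by apply: (mulfI (mulf_neq0 (mulf_neq0 l10 l20) l30)); rewrite lf mulfV ?mulf_neq0.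
apply: (mulfI l30); apply: (mulIf (expf_neq0 2 y0)); rewrite -h [(_ * (x / y)) ^+ 2]exprMn [(l / _ / _) ^+ 2]exprMn lt l4E.
by field; rewrite l10 l20 l30 y0.
Qed.

(** The degrees of [d1], ..., [d4] add up to 3; those of [d1], [d2], [d3] have the parity of deg p =
    deg q + 1, that of [d4] the parity of deg q. The roots of [d4] are the 2-torsion points sent to
    infinity. If deg d4 is odd, one of them is rational. Otherwise [d4] is constant, the others are
    linear, and their roots go to 0, [e2], [e3]; evaluating the linear forms in [p], [q] at these
    roots compares the differences up to squares. *)
Lemma ode_cases c e2 e3 f p q r0 : e2 != 0 -> e3 != 0 -> e2 != e3 ->
    f \is monic -> size f = 4%N -> root f r0 -> c != 0 ->
    coprimep p q -> q != 0 -> (size q < size p)%N -> isogeny_ode c e2 e3 f p q ->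
  (exists r, root f r /\ root q r) \/
  exists r1 r2 r3 z1 z2 z3 : F, [/\ f = ('X - r1%:P) * (('X - r2%:P) * ('X - r3%:P)),
    r1 - r2 = - e2 * z1 ^+ 2, r1 - r3 = - e3 * z2 ^+ 2 & r2 - r3 = (e2 - e3) * z3 ^+ 2].
Proof.
move=> e20 e30 e23 fm sf rf c0 cpq q0 qp ode.
have [sp lq] := ode_lead fm sf c0 q0 qp ode.
have p0 : p != 0 by rewrite -size_poly_gt0 (leq_ltn_trans _ qp).
have pe0 e : p - e%:P * q != 0 by rewrite -size_poly_gt0 size_sub_mul // size_poly_gt0.
have lpe e : lead_coef (p - e%:P * q) = lead_coef p.
  rewrite lead_coefDl // size_polyN mul_polyC.
  exact: leq_ltn_trans (size_scale_leq _ _) qp.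
pose s := (c^-1)%:P * wronskian p q.
have fs : f * s ^+ 2 = quartic e2 e3 p q.
  transitivity ((c^-1)%:P ^+ 2 * (wronskian p q ^+ 2 * f)); first by rewrite /s; ring.
  by rewrite ode mulrA -polyC_exp -polyCM -exprMn mulVf // expr1n mul1r.
have s0 : s != 0.
  have : quartic e2 e3 p q != 0 by rewrite !mulf_neq0.
  by apply: contraNneq => s0; rewrite -fs s0 expr0n mulr0.
have [s1 [s2 [s3 [s4 [d1 [d2 [d3 [d4 [sE fE [E1 E2 E3 E4] _]]]]]]]]] :=
  sqr_dvd_wronskian cpq e20 e30 e23 s0 fs.
have f0 : f != 0 by rewrite monic_neq0.
have [d10 d20 d30 d40] : [/\ d1 != 0, d2 != 0, d3 != 0 & d4 != 0].
  by move: f0; rewrite fE !mulf_eq0 !negb_or => /and4P[].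
have [s10 s20 s30 s40] : [/\ s1 != 0, s2 != 0, s3 != 0 & s4 != 0].
  by move: s0; rewrite sE !mulf_eq0 !negb_or => /and4P[].
have sz := size_mul_sqr.
have z1 := sz _ _ _ d10 s10 E1; have z2 := sz _ _ _ d20 s20 E2.
have z3 := sz _ _ _ d30 s30 E3; have z4 := sz _ _ _ d40 s40 E4.
rewrite size_sub_mul // in z2; rewrite size_sub_mul // in z3.
have z5 : (size d1 + size d2 + size d3 + size d4 = 7)%N.
  have := congr1 (fun g => size g) fE; rewrite /= sf !size_mul ?mulf_neq0 //.
  by move: d10 d20 d30 d40; clear; plia.
have rootq d r : q = d * s4 ^+ 2 -> root d r -> root q r.
  by move=> ->; rewrite !rootE hornerM => /eqP->; rewrite mul0r.
have dpos d : d != 0 -> (0 < size d)%N by rewrite size_poly_gt0.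
have := odd_double_half (size q); case: (boolP (odd (size q))) => [_|_] qE; last first.
  left; have [s4E|s4E] : size d4 = 2%N \/ size d4 = 4%N.
    have p1 := dpos _ d10; have p2 := dpos _ d20; have p3 := dpos _ d30.
    have p4 := dpos _ d40.
    by move: z1 z2 z3 z4 z5 qE; rewrite sp; move: p1 p2 p3 p4; clear; plia.
  - have [l [r [l0 dE]]] := size2_factor s4E.
    have r4 : root d4 r by rewrite dE rootE !hornerE subrr mulr0.
    exists r; split; last exact: rootq r4.
    by rewrite fE rootE !hornerM (eqP (r4 : d4.[r] == 0)) !mulr0.
  (* Here [d4] is [f] up to a constant: all the 2-torsion is killed, and the rational root given in
     advance serves. *)
  - exists r0; split=> //; apply: (rootq d4) => //.
    have [c1 c2 c3] : [/\ size d1 = 1%N, size d2 = 1%N & size d3 = 1%N].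
      have p1 := dpos _ d10; have p2 := dpos _ d20; have p3 := dpos _ d30.
      by move: z5 p1 p2 p3; rewrite s4E; clear; split; plia.
    have nr d : size d = 1%N -> root d r0 = false.
      by move/eqP/size_poly1P=> [k k0 ->]; rewrite rootC (negPf k0).
    by move: rf; rewrite fE !rootM (nr d1) // (nr d2) // (nr d3).
have [c1 c2 c3 c4] : [/\ size d1 = 2%N, size d2 = 2%N, size d3 = 2%N & size d4 = 1%N].
  have p1 := dpos _ d10; have p2 := dpos _ d20; have p3 := dpos _ d30; have p4 := dpos _ d40.
  by move: z1 z2 z3 z4 z5 qE; rewrite sp; move: p1 p2 p3 p4; clear; split; plia.
right.
have [l1 [r1 [l10 d1E]]] := size2_factor c1.
have [l2 [r2 [l20 d2E]]] := size2_factor c2.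
have [l3 [r3 [l30 d3E]]] := size2_factor c3.
have [l4 l40 d4E] := size_poly1P _ (introT eqP c4).
pose t1 := lead_coef s1; pose t2 := lead_coef s2; pose t3 := lead_coef s3; pose l := lead_coef p.
have lc d t g k m : g = d * t ^+ 2 -> d = k%:P * ('X - m%:P) -> lead_coef g = k * lead_coef t ^+ 2.
  by move=> -> ->; rewrite !lead_coefM lead_coefC lead_coefXsubC mulr1 expr2.
have L1 : l = l1 * t1 ^+ 2 by apply: lc E1 d1E.
have L2 : l = l2 * t2 ^+ 2 by rewrite /l -(lpe e2); apply: lc E2 d2E.
have L3 : l = l3 * t3 ^+ 2 by rewrite /l -(lpe e3); apply: lc E3 d3E.
have t10 : t1 != 0 by rewrite lead_coef_eq0.
have t20 : t2 != 0 by rewrite lead_coef_eq0.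
have t30 : t3 != 0 by rewrite lead_coef_eq0.
have l0 : l != 0 by rewrite lead_coef_eq0.
have lf : l1 * l2 * l3 * l4 = 1.
  have := fm; rewrite fE d1E d2E d3E d4E monicE !lead_coefM !lead_coefC !lead_coefXsubC.
  by move/eqP <-; ring.
have rp : root p r1 by rewrite rootE E1 d1E !hornerM hornerXsubC subrr mulr0 mul0r.
have q1 : q.[r1] != 0 by apply: coprimep_root rp.
have p2 : p.[r2] = e2 * q.[r2].
  have : (p - e2%:P * q).[r2] = 0 by rewrite E2 d2E !hornerM hornerXsubC subrr mulr0 mul0r.
  by rewrite hornerD hornerN hornerM hornerC => /eqP; rewrite subr_eq0 => /eqP.
have q2 : q.[r2] != 0.
  apply/negP=> /eqP h; have : root p r2 by rewrite rootE p2 h mulr0.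
  by move/(coprimep_root cpq); rewrite h eqxx.
have {}qE x : q.[x] = l4 * s4.[x] ^+ 2 by rewrite E4 d4E !hornerE.
have H2 x : p.[x] - e2 * q.[x] = l2 * (x - r2) * s2.[x] ^+ 2.
  rewrite -[e2](hornerC e2 x) -hornerM -hornerN -hornerD E2 d2E !hornerM hornerXsubC hornerC.
  by ring.
have H3 x : p.[x] - e3 * q.[x] = l3 * (x - r3) * s3.[x] ^+ 2.
  rewrite -[e3](hornerC e3 x) -hornerM -hornerN -hornerD E3 d3E !hornerM hornerXsubC hornerC.
  by ring.
have pr1 : p.[r1] = 0 by apply/eqP.
have nz k m (n y : F) : k * q.[m] = n * y ^+ 2 -> k != 0 -> q.[m] != 0 -> y != 0.
  move=> h k0 qm; apply: contra_neq (mulf_neq0 k0 qm) => y0.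
  by rewrite h y0 expr0n mulr0.
have h2 : - e2 * q.[r1] = l2 * (r1 - r2) * s2.[r1] ^+ 2 by rewrite -H2 pr1 add0r mulNr.
have h3 : - e3 * q.[r1] = l3 * (r1 - r3) * s3.[r1] ^+ 2 by rewrite -H3 pr1 add0r mulNr.
have h4 : (e2 - e3) * q.[r2] = l3 * (r2 - r3) * s3.[r2] ^+ 2 by rewrite -H3 p2 mulrBl.
have e2N : - e2 != 0 by rewrite oppr_eq0.
have e3N : - e3 != 0 by rewrite oppr_eq0.
have e23' : e2 - e3 != 0 by rewrite subr_eq0.
have [y2 y3 y4] := And3 (nz _ _ _ _ h2 e2N q1) (nz _ _ _ _ h3 e3N q1) (nz _ _ _ _ h4 e23' q2).
move: h2 h3 h4; rewrite !qE => h2 h3 h4.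
have lf2 : l1 * l3 * l2 * l4 = 1 by rewrite -lf; ring.
exists r1, r2, r3, (l / (t1 * t3) / (l1 * l3 * l2) * (s4.[r1] / s2.[r1])),
  (l / (t1 * t2) / (l1 * l2 * l3) * (s4.[r1] / s3.[r1])),
  (l / (t1 * t2) / (l1 * l2 * l3) * (s4.[r2] / s3.[r2])); split.
- by rewrite fE d1E d2E d3E d4E -[RHS]mul1r -polyC1 -lf !polyCM; ring.
- exact: (square_ratio t10 t30 y2 L1 L3 lf2 h2).
- exact: (square_ratio t10 t20 y3 L1 L2 lf h3).
- exact: (square_ratio t10 t20 y4 L1 L2 lf h4).
Qed.

End TwoTorsion.

(** * Affine changes of the coordinate x *)

Section AffineChange.
Variable F : numFieldType.
Implicit Types (f g p q : {poly F}) (a b c e l m r : F).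

Lemma ode_affine c e2 e3 f g p q l m r : m != 0 ->
    f \Po (l%:P * 'X + r%:P) = (m ^+ 2)%:P * g -> isogeny_ode c e2 e3 f p q ->
  isogeny_ode (l * c / m) e2 e3 g (p \Po (l%:P * 'X + r%:P)) (q \Po (l%:P * 'X + r%:P)).
Proof.
set s := _ + _ => m0 fE ode.
have ds : s^`() = l%:P by rewrite /s derivD derivM !derivC derivX; ring.
have m0' : (m ^+ 2)%:P != 0 :> {poly F} by rewrite polyC_eq0 expf_neq0.
apply: (mulfI m0').
have -> : wronskian (p \Po s) (q \Po s) = l%:P * (wronskian p q \Po s).
  by rewrite /wronskian !deriv_comp ds comp_polyB !comp_polyM; ring.
have -> : quartic e2 e3 (p \Po s) (q \Po s) = quartic e2 e3 p q \Po s.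
  by rewrite /quartic !comp_polyM !comp_polyB !comp_polyM !comp_polyC.
have : (wronskian p q \Po s) ^+ 2 * (f \Po s) = (c ^+ 2)%:P * (quartic e2 e3 p q \Po s).
  by rewrite -[X in X * (quartic _ _ _ _ \Po s)](comp_polyC _ s) expr2 -!comp_polyM -expr2 ode.
rewrite fE; move: (quartic e2 e3 p q \Po s) (wronskian p q \Po s) => G W E.
transitivity (l%:P ^+ 2 * (W ^+ 2 * ((m ^+ 2)%:P * g))); first by ring.
rewrite E; transitivity ((l ^+ 2 * c ^+ 2)%:P * G); first by rewrite -polyC_exp mulrA -polyCM.
have -> : l ^+ 2 * c ^+ 2 = m ^+ 2 * (l * c / m) ^+ 2 by field.
by rewrite [RHS]mulrA -polyCM.
Qed.

Lemma ode_affine_sides p q l r : l != 0 -> let s := l%:P * 'X + r%:P in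
  [/\ size (p \Po s) = size p, (q != 0 -> q \Po s != 0) & (coprimep p q -> coprimep (p \Po s) (q \Po s))].
Proof.
move=> l0 s; have ss : size s = 2%N by rewrite size_MXaddC polyC_eq0 (negPf l0) size_polyC l0.
have sz h : size (h \Po s) = size h by rewrite size_comp_poly2.
by split=> [|q0|]; rewrite ?sz -?size_poly_gt0 ?sz ?size_poly_gt0 //; apply: coprimep_comp_poly.
Qed.

(** The new coefficients are the Taylor coefficients f''(r) / 2 and f'(r) of the cubic f at its
    root, the second one simplified by the equation of [r]. *)
Lemma cubic_shift a b r : r ^+ 2 + a * r + b = 0 ->
  cubic a b \Po (1%:P * 'X + r%:P) = (1 ^+ 2)%:P * cubic (3 * r + a) (r * (2 * r + a)).
Proof.
move=> rE; have -> : b = - (r ^+ 2 + a * r) by apply/eqP; rewrite -addr_eq0 addrC rE.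
rewrite /cubic !(rmorphM, rmorphD, rmorphXn) /= !comp_polyX !comp_polyC.
by ring.
Qed.

(** Applied twice, (a, b) |-> (-2 a, a^2 - 4 b) gives (4 a, 16 b). The scaling returns to the
    original curve, since a 2-isogeny followed by its dual is multiplication by 2. *)
Lemma cubic_scale a b : cubic (4 * a) (16 * b) \Po (4%:P * 'X + 0%:P) = (8 ^+ 2)%:P * cubic a b.
Proof.
rewrite /cubic !(rmorphM, rmorphD, rmorphXn) /= !comp_polyX !comp_polyC.
by ring.
Qed.

End AffineChange.

(** * Descent over the rationals at the prime 2 *)

Lemma rat_sqr_int (x : rat) (n : int) : x ^+ 2 = n%:~R -> exists m : int, x = m%:~R.
Proof.
move=> xn; have d0 : (denq x)%:~R != 0 :> rat by rewrite intr_eq0 denq_neq0.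
have : (numq x)%:~R * (numq x)%:~R = n%:~R * (denq x)%:~R * (denq x)%:~R :> rat.
  by rewrite -xn -{3}[x]divq_num_den; field.
rewrite -!rmorphM /= => /intr_inj E; exists (numq x).
have cnd : coprimez (denq x) (numq x) by rewrite coprimezE coprime_sym coprime_num_den.
have : (denq x %| numq x * numq x)%Z by rewrite E dvdz_mull.
rewrite Gauss_dvdzr // => dn.
have : (denq x %| gcdz (denq x) (numq x))%Z by rewrite dvdz_gcd dvdzz.
rewrite (eqP cnd) dvdz1 => d1.
have := divq_num_den x; have := denq_gt0 x; case: (denq x) d1 => // k /eqP /= ->.
by rewrite divr1.
Qed.

Lemma int_parity (x : int) : exists y, x = 2 * y \/ x = 2 * y + 1.
Proof.
by exists (x %/ 2)%Z; have := divz_eq x 2; have := modz_ge0 x (isT : 2 != 0 :> int);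
  have := ltz_pmod x (isT : 0 < 2 :> int); lia.
Qed.

Lemma odd_mul_even (x y z : int) : (2 * x + 1) * y = 2 * z ->
  exists2 w, y = 2 * w & (2 * x + 1) * w = z.
Proof.
move=> E; have [w [yw|yw]] := int_parity y; subst y; last by lia.
by exists w => //; lia.
Qed.

Lemma odd_mul_dvd16 (x y z : int) : (2 * x + 1) * y = 16 * z ->
  exists2 w, y = 16 * w & (2 * x + 1) * w = z.
Proof.
rewrite (_ : 16 * z = 2 * (2 * (2 * (2 * z)))) => [|]; last by lia.
move=> /odd_mul_even[a -> /odd_mul_even[b -> /odd_mul_even[c -> /odd_mul_even[d -> E]]]].
by exists d => //; lia.
Qed.

(** A square that is a unit of Z_2 is 1 modulo 8, whereas d / D is 3 or 5. By parity, the numerator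
    and denominator of [z] must both be odd. *)
Lemma nonsquare_ratio (D d : int) (z : rat) :
    (exists k, D = 8 * k + 1 \/ D = 8 * k - 1) -> (exists k, d = 8 * k + 3 \/ d = 8 * k + 5) ->
  d%:~R = D%:~R * z ^+ 2 -> False.
Proof.
move=> [i Di] [j dj] E.
have d0 : (denq z)%:~R != 0 :> rat by rewrite intr_eq0 denq_neq0.
have : d%:~R * (denq z)%:~R * (denq z)%:~R = D%:~R * (numq z)%:~R * (numq z)%:~R :> rat.
  by rewrite E -{1}[z]divq_num_den; field.
rewrite -!rmorphM /= => /intr_inj {}E.
have := coprime_num_den z; move: (numq z) (denq z) E => n m E cnm.
have [n' nE] := int_parity n; have [m' mE] := int_parity m.
have even2 : n = 2 * n' -> m = 2 * m' -> False.
  move=> n2 m2; have : (2 %| gcdz n m)%Z by rewrite dvdz_gcd n2 m2 !dvdz_mulr.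
  by rewrite (eqP (cnm : coprimez n m)).
have sqr_odd (k : int) : exists l, (2 * k + 1) * (2 * k + 1) = 8 * l + 1.
  by have [l [->| ->]] := int_parity k; [exists (2 * l * l + l) | exists (2 * l * l + 3 * l + 1)]; ring.
have [a aE] := sqr_odd n'; have [b bE] := sqr_odd m'.
case: nE => nE; case: mE => mE; first exact: even2.
- have : d * (8 * b + 1) = 2 * (2 * D * n' * n') by rewrite -bE -mE mulrA E nE; ring.
  by case: dj => ->; lia.
- have : D * (8 * a + 1) = 2 * (2 * d * m' * m') by rewrite -aE -nE mulrA -E mE; ring.
  by case: Di => ->; lia.
have : d * (8 * b + 1) = D * (8 * a + 1) by rewrite -aE -bE -nE -mE !mulrA.
by case: Di => ->; case: dj => ->; lia.
Qed.

(* Over [Q_2], the two shapes below are those of the curves with good ordinary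
   reduction and trace of Frobenius [1] having a rational 2-torsion point
   [(0, 0)]; that point lies outside, resp. inside, the kernel of reduction. *)
Definition etale_shape (f : {poly rat}) := exists k j : int,
  f = cubic (8 * k + 5)%:~R (16 * (2 * j + 1))%:~R.

Definition canonical_shape (f : {poly rat}) := exists k j : int,
  f = cubic (- 2 * (8 * k + 5))%:~R ((8 * k + 5) ^+ 2 - 64 * (2 * j + 1))%:~R.

Lemma etale_const_neq0 (j : int) : (16 * (2 * j + 1))%:~R != 0 :> rat.
Proof. by rewrite intr_eq0; lia. Qed.

Lemma canonical_const_neq0 (k j : int) : ((8 * k + 5) ^+ 2 - 64 * (2 * j + 1))%:~R != 0 :> rat.
Proof. by rewrite intr_eq0; apply/eqP; lia. Qed.

(** At 2 the sum of the roots is a unit and their product is 16 times a unit, so one root is 16 w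
    with w odd and the other is -(8 k + 5) - 16 w, which is 3 modulo 8. The same w describes both,
    whichever of them [x] is. *)
Lemma etale_root (k j : int) (x : rat) :
    x ^+ 2 + (8 * k + 5)%:~R * x + (16 * (2 * j + 1))%:~R = 0 ->
  exists i : int, let w := 2 * i + 1 in w * (16 * w + (8 * k + 5)) = - (2 * j + 1) /\
   (x = (16 * w)%:~R \/ x = (- (8 * k + 5) - 16 * w)%:~R).
Proof.
set al := 8 * k + 5; set u := 2 * j + 1 => E.
have odd_w w : w * (16 * w + al) = - u -> exists i, w = 2 * i + 1.
  move=> wE; have [i [wi|wi]] := int_parity w; last by exists i.
  by move: wE; rewrite wi /u /al; lia.
have sqE : (2 * x + al%:~R) ^+ 2 = (al * al - 64 * u)%:~R.
  rewrite rmorphB !rmorphM /=.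
  transitivity (4 * (x ^+ 2 + al%:~R * x + (16 * u)%:~R) + al%:~R * al%:~R - 64 * u%:~R).
    by rewrite rmorphM /=; ring.
  by rewrite E mulr0 add0r.
have [m mE] := rat_sqr_int sqE.
have {sqE} mm : m * m = al * al - 64 * u.
  by apply: (@intr_inj rat); rewrite -sqE mE rmorphM.
have [N mN] : exists N, m = 2 * N + al.
  have [m' [m'E|m'E]] := int_parity m; last by exists (m' - 4 * k - 2); rewrite m'E /al; ring.
  by move: mm; rewrite m'E /al /u => mm; exfalso; lia.
have xN : x = N%:~R.
  have : 2 * x = 2 * N%:~R.
    by apply: (addIr al%:~R); rewrite mE mN rmorphD rmorphM.
  by apply: mulfI.
have NE : N * (N + al) = - (16 * u).
  have : 4 * (N * (N + al)) = 4 * - (16 * u); last by lia.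
  transitivity (m * m - al * al); first by rewrite mN; ring.
  by rewrite mm; ring.
have [M [NM|NM]] := int_parity N.
  have : (2 * (M + 4 * k + 2) + 1) * N = 16 * - u.
    by rewrite mulrN -NE NM /al; ring.
  move=> /odd_mul_dvd16[w Nw wE].
  have {}wE : w * (16 * w + al) = - u.
    have MW : M = 8 * w by lia.
    by rewrite -wE MW /al; ring.
  have [i wi] := odd_w w wE; exists i => /=; rewrite -wi; split=> //.
  by left; rewrite -Nw.
have : (2 * M + 1) * (N + al) = 16 * - u by rewrite mulrN -NE NM; ring.
move=> /odd_mul_dvd16[w Nw wE].
have wE' : (- w) * (16 * (- w) + al) = - u.
  by rewrite -wE -NM (_ : N = 16 * w - al); [ring | lia].
have [i wi] := odd_w _ wE'; exists i => /=; rewrite -wi; split=> //.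
by right; rewrite xN; congr _%:~R; lia.
Qed.

(** Completing the square gives ((x - (8 k + 5)) / 8)^2 = 2 j + 1, an odd square. *)
Lemma canonical_root (k j : int) (x : rat) :
    x ^+ 2 + (- 2 * (8 * k + 5))%:~R * x + ((8 * k + 5) ^+ 2 - 64 * (2 * j + 1))%:~R = 0 ->
  exists i : int, x = (8 * k + 5 + 8 * (2 * i + 1))%:~R.
Proof.
set al := 8 * k + 5; set u := 2 * j + 1 => E.
have sqE : ((x - al%:~R) / 8) ^+ 2 = u%:~R.
  transitivity ((x ^+ 2 + (- 2 * al)%:~R * x + (al ^+ 2 - 64 * u)%:~R) / 64 + u%:~R).
    by rewrite !(rmorphB, rmorphM, rmorphXn) /=; field.
  by rewrite E mul0r add0r.
have [v vE] := rat_sqr_int sqE.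
have vv : v * v = u by apply: (@intr_inj rat); rewrite -sqE vE rmorphM.
have xE : x = (al + 8 * v)%:~R.
  by rewrite rmorphD rmorphM /= -vE; field.
have [i [vi|vi]] := int_parity v; last by exists i; rewrite xE vi.
by move: vv; rewrite vi /u; lia.
Qed.

(** Exactly one point of order 2 lies in the kernel of reduction at 2. From the étale shape, the
    root 16 w again gives the étale shape, while the odd root is that point and gives the canonical
    shape. From the canonical shape every other root gives the étale one. *)
Lemma shape_shift f r : etale_shape f \/ canonical_shape f -> root f r ->
  exists2 g, etale_shape g \/ canonical_shape g & f \Po (1%:P * 'X + r%:P) = (1 ^+ 2)%:P * g.
Proof.
move=> fE; rewrite rootE; have [->|r0] := eqVneq r 0.
  by exists f => //; rewrite expr1n polyC0 addr0 polyC1 !mul1r comp_polyXr.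
case: fE => [[k [j ->]]|[k [j ->]]]; rewrite horner_cubic mulf_eq0 (negPf r0) /= => /eqP rE.
  have [i [wE [xE|xE]]] := etale_root rE.
    exists (cubic (3 * r + (8 * k + 5)%:~R) (r * (2 * r + (8 * k + 5)%:~R))); last exact: cubic_shift.
    left; exists (k + 6 * (2 * i + 1)).
    have [l lE] : exists l, (2 * i + 1) * (32 * (2 * i + 1) + (8 * k + 5)) = 2 * l + 1.
      by exists (16 * (2 * i + 1) * (2 * i + 1) + 4 * k * (2 * i + 1) + 5 * i + 2); ring.
    exists l; rewrite -lE xE; congr cubic; ring.
  exists (cubic (3 * r + (8 * k + 5)%:~R) (r * (2 * r + (8 * k + 5)%:~R))); last exact: cubic_shift.
  (* The second witness encodes the odd square (2 i + 1)^2: all 2-torsion is rational here, so the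
     new discriminant is a square. *)
  right; exists (k + 3 * (2 * i + 1)), (2 * i * i + 2 * i).
  rewrite xE; congr cubic; ring.
have [i xE] := canonical_root rE.
exists (cubic (3 * r + (- 2 * (8 * k + 5))%:~R) (r * (2 * r + (- 2 * (8 * k + 5))%:~R))); last exact: cubic_shift.
left; exists (k + 3 * (2 * i + 1)).
have [l lE] : exists l, (2 * i + 1) * (8 * k + 5 + 8 * (2 * i + 1)) = 2 * l + 1.
  by exists (8 * i * i + 8 * i * 2 + 6 + 5 * i + 4 * k * (2 * i + 1) + 8 * i * i); ring.
exists l; rewrite -lE xE; congr cubic; ring.
Qed.

(** The difference between this root and the root 0 is neither a square nor minus a square in Q_2;
    this separates the source from the target. *)
Lemma shape_odd_root f r s t : etale_shape f \/ canonical_shape f ->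
    f = ('X - r%:P) * (('X - s%:P) * ('X - t%:P)) ->
  exists2 d : int, root f d%:~R & exists k, d = 8 * k + 3 \/ d = 8 * k + 5.
Proof.
move=> fE fr.
have [a [b [b0 fab]]] : exists a b, b != 0 /\ f = cubic a b.
  case: fE => [[k [j ->]]|[k [j ->]]]; [exists (8 * k + 5)%:~R | exists (- 2 * (8 * k + 5))%:~R].
    by exists (16 * (2 * j + 1))%:~R; split; first exact: etale_const_neq0.
  by exists ((8 * k + 5) ^+ 2 - 64 * (2 * j + 1))%:~R; split; first exact: canonical_const_neq0.
have [x x0 fx] : exists2 x, x != 0 & root f x.
  have [r0|r0] := eqVneq r 0; last first.
    by exists r => //; rewrite fr rootE hornerM hornerXsubC subrr mul0r.
  have [s0|s0] := eqVneq s 0; last first.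
    by exists s => //; rewrite fr rootE !hornerM [X in _ * (X * _)]hornerXsubC subrr mul0r mulr0.
  have : f`_1 = b by rewrite fab /cubic coefXM /= -horner_coef0 !hornerE.
  by rewrite fr r0 s0 polyC0 !subr0 !coefXM /= => b00; rewrite -b00 eqxx in b0.
move: fx; rewrite rootE; case: fE => [[k [j ->]]|[k [j ->]]]; rewrite horner_cubic mulf_eq0 (negPf x0) /= => /eqP rE.
  have [i [wE _]] := etale_root rE; set w := 2 * i + 1 in wE.
  (* The root [x] may be 16 w; the odd root is then the other one. *)
  exists (- (8 * k + 5) - 16 * w); last by exists (- k - 2 * w - 1); left; lia.
  rewrite rootE horner_cubic; apply/eqP; rewrite -rmorphXn -rmorphM -!rmorphD -rmorphM /=.
  by rewrite -(rmorph0 (intr : int -> rat)); congr _%:~R; rewrite -[2 * j + 1]opprK -wE; ring.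
have [i xE] := canonical_root rE.
exists (8 * k + 5 + 8 * (2 * i + 1)); last by exists (k + 2 * i + 1); right; lia.
by rewrite rootE horner_cubic mulf_eq0 -xE rE eqxx orbT.
Qed.

(** Plus or minus a square in Q_2, as are all differences of the roots 0, A', -B' of the target. *)
Definition square_type (D : int) := exists k, [\/ D = 8 * k + 1, D = 8 * k - 1, D = 16 * (8 * k + 1) | D = 16 * (8 * k - 1)].

Lemma square_type_ratio (D d : int) (z : rat) : square_type D ->
  (exists k, d = 8 * k + 3 \/ d = 8 * k + 5) -> d%:~R = D%:~R * z ^+ 2 -> False.
Proof.
move=> [k kD] dE E; case: kD => DE.
- by apply: (nonsquare_ratio _ dE E); exists k; left.
- by apply: (nonsquare_ratio _ dE E); exists k; right.
- apply: (@nonsquare_ratio (8 * k + 1) d (4 * z) _ dE); first by exists k; left.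
  by rewrite E DE rmorphM /=; ring.
- apply: (@nonsquare_ratio (8 * k - 1) d (4 * z) _ dE); first by exists k; right.
  by rewrite E DE rmorphM /=; ring.
Qed.

Lemma square_type_ratioN (D d : int) (z : rat) : square_type D ->
  (exists k, d = 8 * k + 3 \/ d = 8 * k + 5) -> d%:~R = - D%:~R * z ^+ 2 -> False.
Proof.
move=> DE [k dE] E; apply: (@square_type_ratio D (- d) z DE).
  by exists (- k - 1); case: dE => ->; [right|left]; ring.
by rewrite rmorphN /= E mulNr opprK.
Qed.

Lemma odd_root_neq0 (d : int) : (exists k, d = 8 * k + 3 \/ d = 8 * k + 5) -> d%:~R != 0 :> rat.
Proof. by rewrite intr_eq0 => -[k [] ->]; lia. Qed.

(** Strong induction on the degree of [p]. Once the killed point is moved to the origin, the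
    quotient exchanges the two shapes with the same [k] and [j]: étale becomes canonical, and
    canonical becomes étale after [cubic_scale]. *)
Lemma no_isogeny_ode (e2 e3 : int) f (c : rat) (p q : {poly rat}) :
    e2 != 0 -> e3 != 0 -> e2 != e3 -> square_type e2 -> square_type e3 -> square_type (e2 - e3) ->
    etale_shape f \/ canonical_shape f -> c != 0 ->
    coprimep p q -> q != 0 -> (size q < size p)%N ->
  ~ isogeny_ode c e2%:~R e3%:~R f p q.
Proof.
move=> e20 e30 e23 t2 t3 t23.
have [n] := ubnP (size p); elim: n => // n IH in f c p q *; rewrite ltnS => pn fE c0 cpq q0 qp ode.
have [a [b fab]] : exists a b, f = cubic a b.
  by case: fE => [[k [j ->]]|[k [j ->]]]; do 2 eexists.
have [sf fm] := top_monic (top_cubic a b); rewrite -fab in sf fm.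
have f0 : root f 0 by rewrite fab rootE horner_cubic mul0r.
have e20' : e2%:~R != 0 :> rat by rewrite intr_eq0.
have e30' : e3%:~R != 0 :> rat by rewrite intr_eq0.
have e23' : e2%:~R != e3%:~R :> rat by rewrite eqr_int.
case: (ode_cases e20' e30' e23' fm sf f0 c0 cpq q0 qp ode) => [[r [fr qr]]|]; last first.
  move=> [r1 [r2 [r3 [z1 [z2 [z3 [fE' E1 E2 E3]]]]]]].
  have [d fd dE] := shape_odd_root fE fE'.
  have d0 := odd_root_neq0 dE.
  rewrite -rmorphB /= in E3.
  move: f0 fd; rewrite fE' !rootM !root_XsubC.
  (* The roots 0 and [d] are distinct, so they form one of six ordered pairs among [r1], [r2],
     [r3]. *)
  case/or3P => /eqP ri; case/or3P => /eqP rj; try by move: d0; rewrite rj -ri eqxx.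
  - by apply: (square_type_ratio t2 dE (z := z1)); rewrite rj -[RHS]opprK -mulNr -E1 -ri; ring.
  - by apply: (square_type_ratio t3 dE (z := z2)); rewrite rj -[RHS]opprK -mulNr -E2 -ri; ring.
  - by apply: (square_type_ratioN t2 dE (z := z1)); rewrite rj -E1 -ri; ring.
  - by apply: (square_type_ratioN t23 dE (z := z3)); rewrite rj mulNr -E3 -ri; ring.
  - by apply: (square_type_ratioN t3 dE (z := z2)); rewrite rj -E2 -ri; ring.
  - by apply: (square_type_ratio t23 dE (z := z3)); rewrite rj -E3 -ri; ring.
have [g gE fg] := shape_shift fE fr.
have ode' := ode_affine (oner_neq0 _) fg ode.
have [sp' q0' cpq'] := ode_affine_sides p q r (oner_neq0 rat).
have [sq' _ _] := ode_affine_sides q q r (oner_neq0 rat).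
rewrite mul1r divr1 in ode'.
have rq' : root (q \Po (1%:P * 'X + r%:P)) 0.
  by rewrite root_comp !hornerE.
set p' := p \Po _ in ode' sp' cpq'; set q' := q \Po _ in ode' q0' cpq' sq' rq'.
have {cpq'}cpq' := cpq' cpq; have {q0'}q0' := q0' q0.
have qp' : (size q' < size p')%N by rewrite sp' sq'.
case: gE => [[k [j gE]]|[k [j gE]]]; rewrite gE in ode'.
  have b0 := etale_const_neq0 j.
  have [p1 [q1 [cpq1 q10 qp1 pp1 ode1]]] := ode_descent b0 c0 cpq' q0' qp' rq' ode'.
  apply: (IH _ c p1 q1) ode1 => //; first by rewrite (leq_trans pp1) // sp'.
  right; exists k, j; congr cubic; ring.
have b0 := canonical_const_neq0 k j.
have [p1 [q1 [cpq1 q10 qp1 pp1 ode1]]] := ode_descent b0 c0 cpq' q0' qp' rq' ode'.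
have sE : cubic (-2 * (-2 * (8 * k + 5))%:~R)
     ((-2 * (8 * k + 5))%:~R ^+ 2 - 4 * ((8 * k + 5) ^+ 2 - 64 * (2 * j + 1))%:~R) =
  cubic (4 * (8 * k + 5)%:~R) (16 * (16 * (2 * j + 1))%:~R) :> {poly rat}.
  by congr cubic; ring.
rewrite sE in ode1.
have n4 : 4 != 0 :> rat by []. have n8 : 8 != 0 :> rat by [].
have ode2 := ode_affine n8 (cubic_scale _ _) ode1.
have [sp1 _ cpq1'] := ode_affine_sides p1 q1 0 n4.
have [sq1 q10' _] := ode_affine_sides q1 q1 0 n4.
apply: (IH _ _ _ _) ode2 => //.
- by rewrite sp1 (leq_trans pp1) // sp'.
- by left; exists k, j.
- by rewrite !mulf_neq0 ?invr_eq0.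
- exact: cpq1'.
- exact: q10'.
by rewrite sp1 sq1.
Qed.

(** * Points over the function field of an elliptic curve *)

(** The hypotheses are the two components, over 1 and y with y^2 = f, of the equation of the curve
    at (u + v y, r + w y). The chord through this point and its conjugate has slope w / v; (x, y) is
    its third intersection, and the last identity is the second symmetric function of the three
    abscissae. *)
Lemma chord_conjugate (K : fieldType) (u v r w f s1 s2 : K) : v != 0 ->
    r ^+ 2 + f * w ^+ 2 = u ^+ 3 + 3 * f * u * v ^+ 2 - s1 * (u ^+ 2 + f * v ^+ 2) + s2 * u ->
    2 * r * w = 3 * u ^+ 2 * v + f * v ^+ 3 - 2 * s1 * u * v + s2 * v ->
  let l := w / v in let x := l ^+ 2 + s1 - 2 * u in let y := l * x + (r - l * u) in
  y ^+ 2 = x ^+ 3 - s1 * x ^+ 2 + s2 * x /\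
  u ^+ 2 - f * v ^+ 2 + 2 * u * x = s2 - 2 * l * (r - l * u).
Proof.
move=> v0 Re Im l x y; pose m := r - l * u.
have wE : w = l * v by rewrite /l; field.
have rE : r = m + l * u by rewrite /m; ring.
have Im' : 2 * (m + l * u) * l = 3 * u ^+ 2 + f * v ^+ 2 - 2 * s1 * u + s2.
  by apply: (mulIf v0); transitivity (2 * (m + l * u) * (l * v)); [ring | rewrite -rE -wE Im; ring].
have s2E : s2 = 2 * (m + l * u) * l - (3 * u ^+ 2 + f * v ^+ 2 - 2 * s1 * u).
  by rewrite Im'; ring.
have mE : m ^+ 2 = (u ^+ 2 - f * v ^+ 2) * x.
  have : (m + l * u) ^+ 2 + f * (l * v) ^+ 2 = u ^+ 3 + 3 * f * u * v ^+ 2 - s1 * (u ^+ 2 + f * v ^+ 2) + s2 * u.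
    by rewrite -Re -rE -wE.
  rewrite s2E => /eqP; rewrite -subr_eq0 => /eqP E.
  by apply/eqP; rewrite -subr_eq0 -E; apply/eqP; rewrite /x; ring.
split; last by rewrite -/m s2E /x; ring.
rewrite /y -/m; transitivity (l ^+ 2 * x ^+ 2 + 2 * l * m * x + m ^+ 2); first by ring.
by rewrite mE s2E /x; ring.
Qed.

Section FunctionField.
Variable F : numFieldType.
Implicit Types (f g h p q s a b c d : {poly F}) (e k : F).

Lemma sqr_dvd_sqrfree f s h g : coprimep f f^`() -> h != 0 -> h ^+ 2 * g = f * s ^+ 2 -> h %| s.
Proof.
move=> sf h0 E; pose d := gcdp h s.
have d0 : d != 0 by rewrite gcdp_eq0 negb_and h0.
have hE : h = h %/ d * d by rewrite divpK // dvdp_gcdl.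
have sE : s = s %/ d * d by rewrite divpK // dvdp_gcdr.
have ch : coprimep (h %/ d) (s %/ d) by apply: coprimep_div_gcd; rewrite h0.
move: (h %/ d) (s %/ d) hE sE ch => h' s' hE sE ch.
have {}E : h' ^+ 2 * g = f * s' ^+ 2.
  by apply: (mulIf (expf_neq0 2 d0)); rewrite -mulrA [X in _ * X = _]mulrC mulrA -exprMn -hE E sE; ring.
have : h' ^+ 2 %| f.
  rewrite -(@Gauss_dvdpl _ _ (s' ^+ 2)); last by apply: coprimep_expl; apply: coprimep_expr.
  by rewrite -E dvdp_mulr.
move=> /dvdpP[w fE].
have hf : h' %| f by rewrite fE dvdp_mull ?dvdp_exp.
have hf' : h' %| f^`().
  rewrite fE derivM expr2 derivM; apply/dvdpP.
  by exists (w^`() * h' + w * (h'^`() + h'^`())); ring.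
have /coprimepP/(_ _ hf hf') h1 := sf.
have hd : h %= d by rewrite hE -[X in _ %= X]mul1r eqp_mulr.
by rewrite (eqp_dvdl _ hd) dvdp_gcdr.
Qed.

Lemma reduce_fraction a b : b != 0 -> exists g p q, [/\ g != 0, coprimep p q, q != 0, a = p * g & b = q * g].
Proof.
move=> b0; pose g := gcdp a b.
have g0 : g != 0 by rewrite gcdp_eq0 negb_and b0 orbT.
have bE : b = b %/ g * g by rewrite divpK // dvdp_gcdr.
exists g, (a %/ g), (b %/ g); split=> //.
- by apply: coprimep_div_gcd; rewrite b0 orbT.
- by apply: contraNneq b0 => h; rewrite bE h mul0r.
by rewrite divpK // dvdp_gcdl.
Qed.

(* A point of the curve with coordinates in [F(x)] has coordinates in [F]. *)
Lemma rational_point_const e2 e3 a b c d : e2 != 0 -> e3 != 0 -> e2 != e3 -> b != 0 -> d != 0 ->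
    c ^+ 2 * b ^+ 3 = d ^+ 2 * (a * ((a - e2%:P * b) * (a - e3%:P * b))) ->
  exists k, a = k%:P * b.
Proof.
move=> e20 e30 e23 b0 d0 E.
have [g [p [q [g0 cpq q0 aE bE]]]] := reduce_fraction a b0.
have E' : (d * g ^+ 2) ^+ 2 * quartic e2 e3 p q = 1 * (c * b ^+ 2) ^+ 2.
  transitivity (d ^+ 2 * (a * ((a - e2%:P * b) * (a - e3%:P * b))) * b); last by rewrite -E; ring.
  by rewrite -[RHS]mulrA aE bE /quartic; ring.
have dg0 : d * g ^+ 2 != 0 by rewrite mulf_neq0 ?expf_neq0.
have /dvdpP[s sE] : d * g ^+ 2 %| c * b ^+ 2.
  by apply: sqr_dvd_sqrfree E' => //; rewrite coprime1p.
have sG : s ^+ 2 = quartic e2 e3 p q.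
  by apply: (mulfI (expf_neq0 2 dg0)); rewrite E' sE; ring.
have [sp sq] := quartic_sqr_const cpq e20 e30 e23 sG q0.
have [k k0 qk] : exists2 k, k != 0 & q = k%:P.
  by apply/size_poly1P; rewrite eqn_leq sq size_poly_gt0.
exists (p`_0 / k); rewrite aE bE qk (size1_polyC sp) mulrA -polyCM coefC eqxx mulfVK //.
Qed.

(** The degree of a^2 is even and that of f b^2 is odd, so the top terms cannot cancel. *)
Lemma size_norm_l f a b : size f = 4%N -> (size (a ^+ 2)%R <= size (a ^+ 2 - f * b ^+ 2)%R)%N.
Proof.
move=> sf; have [->|b0] := eqVneq b 0; first by rewrite expr0n mulr0 subr0.
have [->|a0] := eqVneq a 0; first by rewrite expr0n size_poly0.
have f0 : f != 0 by rewrite -size_poly_gt0 sf.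
have sb : size (f * b ^+ 2) = (size b + size b + 2)%N.
  by rewrite expr2 !size_mul ?mulf_neq0 // sf; move: b0; plia.
have sa : size (a ^+ 2) = (size a + size a - 1)%N by rewrite expr2 size_mul // subn1.
have [h|h] := ltnP (size (f * b ^+ 2)) (size (a ^+ 2)).
  by rewrite size_polyDl ?size_polyN.
rewrite addrC size_polyDl size_polyN //.
rewrite ltn_neqAle h andbT sa sb; move: a0; rewrite -size_poly_gt0; clear.
by move: (size a) (size b) => m n m0; apply/eqP; lia.
Qed.

(** Since deg u is at most, and deg q less than, half of deg n, the left side has degree 2 deg n and
    the right side a smaller one. *)
Lemma pole_size_contra (n u q : {poly F}) (k1 k2 k3 k4 : F) : (size (u ^+ 2)%R <= size n)%N -> q != 0 ->
    (size (q ^+ 2)%R < size n)%N ->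
    (n - k1%:P * u * q - k2%:P * q ^+ 2) ^+ 2 = k3%:P * (2 * u + k4%:P * q) * q ^+ 3 ->
  False.
Proof.
move=> un q0 qn key; have sC k p : (size (k%:P * p)%R <= size p)%N.
  by rewrite mul_polyC size_scale_leq.
have sq2 : (size (q ^+ 2)%R = size q + size q - 1)%N by rewrite expr2 size_mul // subn1.
have sq3 : (size (q ^+ 3)%R = size q + size q + size q - 2)%N.
  rewrite exprS size_mul ?expf_neq0 // sq2; move: q0; rewrite -size_poly_gt0; clear.
  by move: (size q) => m; lia.
have su : (size u + size u <= size n + 1)%N.
  have [->|u0] := eqVneq u 0; first by rewrite size_poly0.
  move: un; rewrite expr2 size_mul //; clear.
  by move: (size u) (size n) => i j; lia.
have qpos : (0 < size q)%N by rewrite size_poly_gt0.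
have suq : (size (k1%:P * u * q)%R < size n)%N.
  apply: leq_ltn_trans (size_polyMleq _ _) _; have := sC k1 u.
  move: su qpos qn; rewrite sq2; clear.
  by move: (size (_ * u)) (size u) (size q) (size n) => i j l m; lia.
have sL : size (n - k1%:P * u * q - k2%:P * q ^+ 2) = size n.
  have s1 : size (n - k1%:P * u * q) = size n by rewrite size_polyDl // size_polyN.
  rewrite size_polyDl // size_polyN s1.
  by apply: leq_ltn_trans (sC _ _) _.
have sM : (size (2 * u + k4%:P * q)%R <= maxn (size u) (size q))%N.
  apply: leq_trans (size_polyD _ _) _; rewrite geq_max !leq_max sC orbT andbT.
  have -> : 2 * u = 2%:P * u by ring.
  by rewrite sC.
have n0 : n != 0 by rewrite -size_poly_gt0 (leq_ltn_trans _ qn).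
have L0 : n - k1%:P * u * q - k2%:P * q ^+ 2 != 0 by rewrite -size_poly_gt0 sL size_poly_gt0.
have : (size ((n - k1%:P * u * q - k2%:P * q ^+ 2) ^+ 2)%R = size n + size n - 1)%N.
  by rewrite expr2 size_mul // sL subn1.
rewrite key => sz.
have := size_polyMleq (k3%:P * (2 * u + k4%:P * q)) (q ^+ 3); rewrite sz sq3.
have := leq_trans (sC k3 _) sM; set L := k3%:P * _.
move: su qpos qn; rewrite sq2; clear.
by move: (size L) (size u) (size q) (size n) => i j l m; lia.
Qed.

(* If the point [P] with coordinates [((u + v y) / q, (r + w y) / q)] had
   [v != 0], the third point [(x, y)] of the curve on the chord through [P] and
   its conjugate would be constant, which bounds the pole of [P]. *)
Lemma chord_point_contra (K : fieldType) (phi : {rmorphism {poly F} -> K}) e2 e3 f u v r w q :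
    injective phi -> e2 != 0 -> e3 != 0 -> e2 != e3 ->
    size f = 4%N -> q != 0 -> v != 0 ->
    (r ^+ 2 + f * w ^+ 2) * q = u ^+ 3 + 3 * f * u * v ^+ 2
       - (e2 + e3)%:P * q * (u ^+ 2 + f * v ^+ 2) + (e2 * e3)%:P * q ^+ 2 * u ->
    2 * r * w * q = 3 * u ^+ 2 * v + f * v ^+ 3 - 2 * (e2 + e3)%:P * q * u * v
       + (e2 * e3)%:P * q ^+ 2 * v ->
  (size (u ^+ 2 - f * v ^+ 2)%R <= size (q ^+ 2)%R)%N.
Proof.
move=> inj e20 e30 e23 sf q0 v0 Re Im.
have phi0 g : g != 0 -> phi g != 0 by move=> g0; rewrite -(rmorph0 phi) (inj_eq inj).
pose Q := phi q; pose V' := phi v; have Q0 : Q != 0 := phi0 _ q0; have V'0 : V' != 0 := phi0 _ v0.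
pose U := phi u / Q; pose V := V' / Q; pose R := phi r / Q; pose W := phi w / Q.
pose s1 := phi (e2 + e3)%:P; pose s2 := phi (e2 * e3)%:P; pose f' := phi f.
have V0 : V != 0 by rewrite mulf_neq0 ?invr_eq0.
have Q3 : Q ^+ 3 != 0 by rewrite expf_neq0.
have Re' : R ^+ 2 + f' * W ^+ 2 = U ^+ 3 + 3 * f' * U * V ^+ 2 - s1 * (U ^+ 2 + f' * V ^+ 2) + s2 * U.
  apply: (mulIf Q3); transitivity (phi ((r ^+ 2 + f * w ^+ 2) * q)).
    transitivity ((phi r ^+ 2 + f' * phi w ^+ 2) * Q); first by rewrite /R /W; field.
    by rewrite /Q /f'; ring.
  transitivity (phi u ^+ 3 + 3 * f' * phi u * V' ^+ 2 - s1 * Q * (phi u ^+ 2 + f' * V' ^+ 2)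
    + s2 * Q ^+ 2 * phi u); last by rewrite /U /V; field.
  by rewrite Re /Q /V' /s1 /s2 /f'; ring.
have Im' : 2 * R * W = 3 * U ^+ 2 * V + f' * V ^+ 3 - 2 * s1 * U * V + s2 * V.
  apply: (mulIf Q3); transitivity (phi (2 * r * w * q)).
    transitivity (2 * phi r * phi w * Q); first by rewrite /R /W; field.
    by rewrite /Q; ring.
  transitivity (3 * phi u ^+ 2 * V' + f' * V' ^+ 3 - 2 * s1 * Q * phi u * V'
    + s2 * Q ^+ 2 * V'); last by rewrite /U /V; field.
  by rewrite Im /Q /V' /s1 /s2 /f'; ring.
have [curve sums] := chord_conjugate V0 Re' Im'.
set l := W / V in curve sums; set x := l ^+ 2 + s1 - 2 * U in curve sums.
set y := l * x + (R - l * U) in curve.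
have lE : l = phi w / V' by rewrite /l /W /V; field; rewrite V'0 Q0.
pose a := w ^+ 2 * q + (e2 + e3)%:P * v ^+ 2 * q - 2 * u * v ^+ 2.
pose b := v ^+ 2 * q; pose c := w * a + r * v ^+ 3 - w * u * v ^+ 2; pose d := v ^+ 3 * q.
have b0 : b != 0 by rewrite mulf_neq0 ?expf_neq0.
have d0 : d != 0 by rewrite mulf_neq0 ?expf_neq0.
have xb : x * phi b = phi a.
  transitivity (phi w ^+ 2 * Q + s1 * V' ^+ 2 * Q - 2 * phi u * V' ^+ 2).
    have -> : phi b = V' ^+ 2 * Q by rewrite /b /V' /Q; ring.
    by rewrite /x lE /U; field; rewrite V'0 Q0.
  by rewrite /a /V' /Q /s1; ring.
have yd : y * phi d = phi c.
  transitivity (phi w * phi a + phi r * V' ^+ 3 - phi w * phi u * V' ^+ 2).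
    have -> : phi d = V' ^+ 3 * Q by rewrite /d /V' /Q; ring.
    have -> : phi a = x * (V' ^+ 2 * Q) by rewrite -xb /b /V' /Q; ring.
    by rewrite /y lE /U /R; field; rewrite V'0 Q0.
  by rewrite /c /V'; ring.
have [k ak] : exists k, a = k%:P * b.
  apply: (@rational_point_const e2 e3 a b c d) => //; apply: inj.
  transitivity (phi c ^+ 2 * phi b ^+ 3); first by ring.
  rewrite -yd exprMn curve.
  transitivity (phi d ^+ 2 * (phi a * ((phi a - phi e2%:P * phi b) * (phi a - phi e3%:P * phi b)))); last by ring.
  by rewrite -xb /s1 /s2; ring.
have xk : x = phi k%:P.
  by apply: (mulIf (phi0 _ b0)); rewrite xb ak; ring.
pose c1 := e2 * e3 + 2 * k ^+ 2 - 2 * (e2 + e3) * k.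
pose kappa := k ^+ 3 - (e2 + e3) * k ^+ 2 + e2 * e3 * k.
pose n := u ^+ 2 - f * v ^+ 2.
have key : (n - (2 * k)%:P * u * q - c1%:P * q ^+ 2) ^+ 2 = 
    (4 * kappa)%:P * (2 * u + (k - (e2 + e3))%:P * q) * q ^+ 3.
  apply: inj.
  (* Squaring eliminates the slope and the ordinate: l^2 = x - s1 + 2 U, and y^2 is the value of the
     cubic at x, which is [kappa] when x is the constant [k]. *)
  have E : U ^+ 2 - f' * V ^+ 2 - 2 * x * U - (s2 + 2 * x ^+ 2 - 2 * s1 * x) = - 2 * l * y.
    have -> : s2 = (U ^+ 2 - f' * V ^+ 2 + 2 * U * x) + 2 * l * (R - l * U) by rewrite sums; ring.
    by rewrite /y /x; ring.
  have E2 : (U ^+ 2 - f' * V ^+ 2 - 2 * x * U - (s2 + 2 * x ^+ 2 - 2 * s1 * x)) ^+ 2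
      = 4 * (x - s1 + 2 * U) * (x ^+ 3 - s1 * x ^+ 2 + s2 * x).
    by rewrite E -curve /x; ring.
  have Q4 : Q ^+ 4 != 0 by rewrite expf_neq0.
  transitivity ((phi u ^+ 2 - f' * V' ^+ 2 - 2 * x * phi u * Q - (s2 + 2 * x ^+ 2 - 2 * s1 * x) * Q ^+ 2) ^+ 2).
    by rewrite xk /n /c1 /f' /V' /Q /s1 /s2; ring.
  transitivity (4 * (x ^+ 3 - s1 * x ^+ 2 + s2 * x) * (2 * phi u + (x - s1) * Q) * Q ^+ 3); last first.
    by rewrite xk /kappa /Q /s1 /s2; ring.
  transitivity (4 * (x - s1 + 2 * U) * (x ^+ 3 - s1 * x ^+ 2 + s2 * x) * Q ^+ 4).
    by rewrite -E2 /U /V; field.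
  by rewrite /U; field.
rewrite leqNgt; apply/negP => sn.
exact: (pole_size_contra (size_norm_l u v sf) q0 sn key).
Qed.

(** The size hypothesis is a pole at infinity, so the chord argument leaves only [v = 0]. Then r w =
    0: if [w = 0] the point is rational over F(x), hence constant, without a pole; if [r = 0] the
    ordinate is w y / q and its square gives the equation. *)
Lemma odd_point e2 e3 f u v r w q : e2 != 0 -> e3 != 0 -> e2 != e3 ->
    size f = 4%N -> coprimep f f^`() -> q != 0 ->
    (r ^+ 2 + f * w ^+ 2) * q = u ^+ 3 + 3 * f * u * v ^+ 2
       - (e2 + e3)%:P * q * (u ^+ 2 + f * v ^+ 2) + (e2 * e3)%:P * q ^+ 2 * u ->
    2 * r * w * q = 3 * u ^+ 2 * v + f * v ^+ 3 - 2 * (e2 + e3)%:P * q * u * v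
       + (e2 * e3)%:P * q ^+ 2 * v ->
    (size (q ^+ 2)%R < size (u ^+ 2 - f * v ^+ 2)%R)%N ->
  exists p q1 s, [/\ coprimep p q1, q1 != 0, (size q1 < size p)%N & f * s ^+ 2 = quartic e2 e3 p q1].
Proof.
move=> e20 e30 e23 sf cf q0 Re Im sqn.
have [v0|v0] := eqVneq v 0.
  have squ : (size q < size u)%N.
    have u0 : u != 0.
      by apply: contraTneq sqn => u0; rewrite u0 v0 !expr0n !mulr0 subr0 size_poly0.
    move: sqn; rewrite v0 expr0n mulr0 subr0 !expr2 !size_mul //.
    by move: q0 u0; clear; plia.
  have {Im} : r * w = 0.
    have : 2%:P * (r * w) * q = 0.
      by transitivity (2 * r * w * q); [ring | rewrite Im v0; ring].
    by move/eqP; rewrite !mulf_eq0 polyC_eq0 pnatr_eq0 /= (negPf q0) orbF -mulf_eq0 => /eqP.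
  have {}Re : (r ^+ 2 + f * w ^+ 2) * q = u * ((u - e2%:P * q) * (u - e3%:P * q)).
    by rewrite Re v0; ring.
  move/eqP; rewrite mulf_eq0 => /orP[/eqP r0|/eqP w0]; last first.
    have [k uk] : exists k, u = k%:P * q.
      apply: (@rational_point_const e2 e3 u q (r * q ^+ 2) (q ^+ 3)) => //; rewrite ?expf_neq0 //.
      by rewrite -Re w0; ring.
    move: squ; rewrite uk mul_polyC => h; exfalso.
    by have := leq_ltn_trans (size_scale_leq k q) h; rewrite ltnn.
  have [g [p [q1 [g0 cpq q10 uE qE]]]] := reduce_fraction u q0.
  have E : (g ^+ 2) ^+ 2 * quartic e2 e3 p q1 = f * (w * q) ^+ 2.
    transitivity (((r ^+ 2 + f * w ^+ 2) * q) * q); last by rewrite r0; ring.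
    by rewrite Re uE qE /quartic; ring.
  have /dvdpP[s sE] := sqr_dvd_sqrfree cf (expf_neq0 2 g0) E.
  exists p, q1, s; split=> //.
    have p0 : p != 0 by apply: contraTneq squ => p0; rewrite uE p0 mul0r size_poly0.
    move: squ; rewrite uE qE !size_mul //.
    by move: g0 p0 q10; clear; plia.
  by apply: (mulfI (expf_neq0 2 (expf_neq0 2 g0))); rewrite E sE; ring.
have inj : injective (@FracField.tofrac {poly F}) by move=> g h /eqP; rewrite tofrac_eq => /eqP.
have := chord_point_contra inj e20 e30 e23 sf q0 v0 Re Im.
by rewrite leqNgt sqn.
Qed.
End FunctionField.

(** * From isogenies to rational functions *)

Section Forms.
Variable f : {poly rat}.
Hypothesis tf : top 3 1 f.
Implicit Types (u v : {poly rat}).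

Local Notation "p ^^" := (map_poly (@ratr algC) p) (at level 2, format "p ^^").

(* [u + v y] has a pole of order at most [3 d] at infinity, with leading
   coefficient [c] there. *)
Definition pole_bound d c u v :=
  if odd d then (size u <= 3 * d./2 + 2)%N /\ top (3 * d./2) c v
  else top (3 * d./2) c u /\ (size v <= 3 * d./2 - 1)%N.

Lemma pole_boundD d c1 c2 u1 v1 u2 v2 : pole_bound d c1 u1 v1 -> pole_bound d c2 u2 v2 ->
  pole_bound d (c1 + c2) (u1 + u2) (v1 + v2).
Proof.
have szD (p q : {poly rat}) k : (size p <= k)%N -> (size q <= k)%N -> (size (p + q)%R <= k)%N.
  by move=> sp sq; apply: leq_trans (size_polyD _ _) _; rewrite geq_max sp.
by rewrite /pole_bound; case: odd => -[a1 b1] [a2 b2]; split; (exact: szD || exact: top_add).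
Qed.

Lemma pole_boundZ d a c u v : pole_bound d c u v -> pole_bound d (a * c) (a *: u) (a *: v).
Proof.
have szZ (p : {poly rat}) k : (size p <= k)%N -> (size (a *: p) <= k)%N.
  by move=> sp; apply: leq_trans (size_scale_leq _ _) _.
have tZ k e p : top k e p -> top k (a * e) (a *: p).
  by move=> te; rewrite -mul_polyC; apply: top_mul (top_const a) te.
by rewrite /pole_bound; case: odd => -[h1 h2]; split; (exact: szZ || exact: tZ).
Qed.

Lemma monomial_pole_bound i j k : exists u v,
  pole_bound (i + j + k) (0 ^+ i * 1 ^+ j * 0 ^+ k) u v /\
  forall x y : algC, y ^+ 2 = f^^.[x] -> x ^+ i * y ^+ j * 1 ^+ k = u^^.[x] + y * v^^.[x].
Proof.
pose w : {poly rat} := 'X^i * f ^+ j./2.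
have tw : top (i + j./2 * 3) 1 w.
  have := top_mul (top_exp i (top_X rat)) (top_exp j./2 tf).
  by rewrite muln1 !expr1n mulr1.
have w_x x y : y ^+ 2 = f^^.[x] -> x ^+ i * y ^+ (j./2.*2) = w^^.[x].
  move=> yE; rewrite rmorphM !rmorphXn /= map_polyX hornerM !horner_exp hornerX -yE.
  by rewrite -exprM mul2n.
have eps : 0 ^+ i * 1 ^+ j * 0 ^+ k = ((i == 0%N) && (k == 0%N))%:R :> rat.
  by rewrite !expr0n expr1n mulr1 -natrM mulnb.
have top0 n : top n 0 (0 : {poly rat}) by apply: top_low; rewrite size_poly0.
rewrite /pole_bound eps; have [jo|je] := boolP (odd j).
  exists 0, w; split; last first.
    move=> x y yE; rewrite rmorph0 horner0 add0r -(w_x x y) // expr1n mulr1.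
    by rewrite -{1}[j]odd_double_half jo exprS; ring.
  case: ifP => hodd.
    split; first by rewrite size_poly0.
    case: (boolP ((i == 0%N) && (k == 0%N))) => [/andP[/eqP i0 /eqP k0]|ik].
      by move: tw; rewrite i0 k0 add0n addn0 mulnC.
    apply: top_low; apply: leq_trans tw.1 _.
    by move: ik jo hodd; clear; rewrite negb_and; lia.
  split; last by apply: leq_trans tw.1 _; move: jo hodd; clear; lia.
  case: (boolP ((i == 0%N) && (k == 0%N))) => [/andP[/eqP i0 /eqP k0]|ik]; last exact: top0.
  by move: hodd; rewrite i0 k0 add0n addn0 jo.
exists w, 0; split; last first.
  move=> x y yE; rewrite rmorph0 horner0 mulr0 addr0 -(w_x x y) // expr1n mulr1.
  by rewrite -{1}[j]odd_double_half (negPf je).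
case: ifP => hodd.
  split; first by apply: leq_trans tw.1 _; move: je hodd; clear; lia.
  case: (boolP ((i == 0%N) && (k == 0%N))) => [/andP[/eqP i0 /eqP k0]|ik]; last exact: top0.
  by move: hodd; rewrite i0 k0 add0n addn0 (negPf je).
split; last by rewrite size_poly0.
case: (boolP ((i == 0%N) && (k == 0%N))) => [/andP[/eqP i0 /eqP k0]|ik].
  by move: tw; rewrite i0 k0 add0n addn0 mulnC.
apply: top_low; apply: leq_trans tw.1 _.
by move: ik je hodd; clear; rewrite negb_and; lia.
Qed.

Definition point3 (R : pzSemiRingType) (x y z : R) (i : 'I_3) : R := [:: x; y; z]`_i.

Lemma big_ord3 (R : pzSemiRingType) (h : 'I_3 -> R) (g : nat -> R) : 
  (forall i : 'I_3, h i = g i) -> \prod_i h i = g 0%N * g 1%N * g 2%N.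
Proof.
move=> hg; rewrite (eq_bigr (fun i : 'I_3 => g i)) => [|i _]; last exact: hg.
by rewrite !big_ord_recr big_ord0 /= mul1r.
Qed.

Lemma form_pole_bound d (P : {mpoly rat[3]}) : P \is d.-homog ->
  exists u v, pole_bound d P.@[point3 0 1 0] u v /\
    forall x y : algC, y ^+ 2 = f^^.[x] ->
      (map_mpoly (@ratr algC) P).@[point3 x y 1] = u^^.[x] + y * v^^.[x].
Proof.
move=> /dhomogP hom; rewrite mevalE.
have evE x y : (map_mpoly (@ratr algC) P).@[point3 x y 1] = 
    \sum_(m <- msupp P) ratr P@_m * \prod_i (point3 x y 1 i) ^+ m i.
  rewrite mevalE (perm_big _ (msupp_map_mpoly P (fmorph_inj (@ratr algC)))) /=.
  by apply: eq_bigr => m _; rewrite mcoeff_map_mpoly.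
suff : forall s : seq 'X_{1..3}, {in s, forall m, mdeg m = d} -> 
    exists u v, pole_bound d (\sum_(m <- s) P@_m * \prod_i (point3 0 1 0 i) ^+ m i) u v /\
      forall x y : algC, y ^+ 2 = f^^.[x] ->
      \sum_(m <- s) ratr P@_m * \prod_i (point3 x y 1 i) ^+ m i = u^^.[x] + y * v^^.[x].
  move=> /(_ _ hom)[u [v [pb ev]]]; exists u, v; split=> // x y yE.
  by rewrite evE ev.
elim=> [|m s IH] hs.
  exists 0, 0; rewrite big_nil; split; last first.
    by move=> x y _; rewrite big_nil rmorph0 horner0 mulr0 addr0.
  have top0 n : top n 0 (0 : {poly rat}) by apply: top_low; rewrite size_poly0.
  by rewrite /pole_bound; case: odd; split=> //; rewrite size_poly0.
have [|u1 [v1 [pb1 ev1]]] := IH; first by move=> m' m's; apply: hs; rewrite inE m's orbT.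
pose mm (n : nat) := m (inord n : 'I_3).
have mprod (R : comPzSemiRingType) (x y z : R) : 
   \prod_i (point3 x y z i) ^+ m i = x ^+ mm 0%N * y ^+ mm 1%N * z ^+ mm 2%N.
  rewrite (@big_ord3 _ _ (fun n => [:: x; y; z]`_n ^+ mm n)) // => i.
  by rewrite /mm inord_val.
have md : (mm 0 + mm 1 + mm 2)%N = d.
  rewrite -(hs m) ?mem_head // mdegE !big_ord_recr big_ord0 /= add0n /mm.
  by congr (m _ + m _ + m _)%N; apply/val_inj; rewrite /= inordK.
have [u2 [v2 [pb2 ev2]]] := monomial_pole_bound (mm 0%N) (mm 1%N) (mm 2%N).
rewrite md in pb2.
exists (P@_m *: u2 + u1), (P@_m *: v2 + v1); rewrite !big_cons mprod; split.
  by apply: pole_boundD => //; apply: pole_boundZ.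
move=> x y yE; rewrite big_cons mprod (ev1 _ _ yE) (ev2 _ _ yE) !rmorphD /= !map_polyZ !hornerD !hornerZ.
by ring.
Qed.

(** The degree in x of the norm of u + v y is its pole order at infinity. For odd [d] the top term
    comes from - f v^2, hence the sign. *)
Lemma norm_top d c u v : pole_bound d c u v ->
  top (3 * d) (if odd d then - c ^+ 2 else c ^+ 2) (u ^+ 2 - f * v ^+ 2).
Proof.
have dE := odd_double_half d; rewrite /pole_bound; case: (odd d) dE => dE -[h1 h2].
  have t1 := top_mul tf (top_mul h2 h2).
  have t2 : top (3 + (3 * d./2 + 3 * d./2)) 0 (u ^+ 2).
    apply: top_low; rewrite expr2; apply: leq_trans (size_polyMleq _ _) _; move: h1; clear.
    by move: (size u) (d./2); lia.
  have := top_sub t2 t1; rewrite sub0r mul1r -!expr2.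
  by apply: top_cast; lia.
have t1 := top_mul h1 h1.
have t2 : top (3 * d./2 + 3 * d./2) 0 (f * v ^+ 2).
  have sv : (size v <= (3 * d./2 - 2).+1)%N.
    have [->|v0] := eqVneq v 0; first by rewrite size_poly0.
    by move: h2 v0; rewrite -size_poly_gt0; clear; move: (size v) (d./2); lia.
  have [->|v0] := eqVneq v 0; first by rewrite expr0n mulr0; apply: top_low; rewrite size_poly0.
  apply: top_low; have [s1 _] := tf; rewrite expr2.
  apply: leq_trans (size_polyMleq _ _) _; have := size_polyMleq v v.
  move: s1 h2 v0; rewrite -size_poly_gt0; clear.
  by move: (size v) (size f) (size (v * v)%R) (d./2); lia.
have := top_sub t1 t2; rewrite subr0 -!expr2.
by apply: top_cast; lia.
Qed.

Lemma affine_zero u v :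
  (forall x y : algC, y ^+ 2 = f^^.[x] -> u^^.[x] + y * v^^.[x] = 0) -> u = 0 /\ v = 0.
Proof.
move=> uv0.
have f0 : f != 0 by have [sf _] := top_monic tf; rewrite -size_poly_gt0 sf.
have map0 (p : {poly rat}) : p^^ = 0 -> p = 0 by move/eqP; rewrite map_poly_eq0 => /eqP.
have both x : u^^.[x] = 0 /\ (f^^.[x] != 0 -> v^^.[x] = 0).
  have yE : sqrtC f^^.[x] ^+ 2 = f^^.[x] by rewrite sqrtCK.
  have E1 := uv0 _ _ yE; have E2 := uv0 x (- sqrtC f^^.[x]).
  rewrite sqrrN in E2; have {}E2 := E2 yE.
  have u0 : u^^.[x] = 0.
    by apply: (mulfI (_ : 2 != 0)); rewrite ?pnatr_eq0 // mulr0 -[RHS](addr0 0) -{1}E1 -E2; ring.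
  split=> // fx; apply/eqP; move: E1; rewrite u0 add0r => /eqP; rewrite mulf_eq0 sqrtC_eq0.
  by rewrite (negPf fx).
split; apply: map0.
  apply: (@poly_eq0_nonroot _ 1); first exact: oner_neq0.
  by move=> x _; case: (both x).
apply: (@poly_eq0_nonroot _ f^^); first by rewrite map_poly_eq0.
by move=> x fx; case: (both x) => _; apply.
Qed.

Lemma norm_eq0 u v : u ^+ 2 - f * v ^+ 2 = 0 -> u = 0 /\ v = 0.
Proof.
move=> n0; have [sf _] := top_monic tf.
have := size_norm_l u v sf; rewrite n0 size_poly0 leqn0 size_poly_eq0 expf_eq0 /= => /eqP u0.
split=> //; move: n0; rewrite u0 expr0n sub0r => /eqP.
rewrite oppr_eq0 mulf_eq0 expf_eq0 /= => /orP[/eqP f0|/eqP //].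
by rewrite f0 size_poly0 in sf.
Qed.

Lemma size_sqr (p : {poly rat}) : size (p ^+ 2) = ((size p).*2.-1)%N.
Proof.
have [->|p0] := eqVneq p 0; first by rewrite expr0n size_poly0.
by rewrite expr2 size_mul // addnn.
Qed.

Lemma size_sqr_sub a (p q : {poly rat}) k : (size (p ^+ 2)%R <= k)%N -> (size (q ^+ 2)%R <= k)%N ->
  (size ((p - a%:P * q) ^+ 2)%R <= k)%N.
Proof.
rewrite !size_sqr => hp hq.
have : (size (p - a%:P * q)%R <= maxn (size p) (size q))%N.
  apply: leq_trans (size_polyD _ _) _; rewrite size_polyN geq_max !leq_max leqnn /=.
  by rewrite mul_polyC (size_scale_leq _ _) orbT.
move: hp hq; clear; set r := p - _.
by move: (size p) (size q) (size r); lia.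
Qed.

(** The ultrametric inequality for the pole order at infinity, which the degree of the norm
    measures. *)
Lemma size_norm_sub a u1 v1 u2 v2 k : (size (u1 ^+ 2 - f * v1 ^+ 2)%R <= k)%N ->
    (size (u2 ^+ 2 - f * v2 ^+ 2)%R <= k)%N ->
  (size ((u1 - a%:P * u2) ^+ 2 - f * (v1 - a%:P * v2) ^+ 2)%R <= k)%N.
Proof.
have [sf _] := top_monic tf.
have f0 : f != 0 by rewrite -size_poly_gt0 sf.
move=> h1 h2; have su1 := leq_trans (size_norm_l u1 v1 sf) h1.
have su2 := leq_trans (size_norm_l u2 v2 sf) h2.
have sv u v : (size (u ^+ 2 - f * v ^+ 2)%R <= k)%N -> (size (u ^+ 2)%R <= k)%N ->
    (size (v ^+ 2)%R <= k - 3)%N.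
  move=> hn hu; have [->|v0] := eqVneq v 0; first by rewrite expr0n size_poly0.
  have : (size (f * v ^+ 2)%R <= k)%N.
    have -> : f * v ^+ 2 = u ^+ 2 - (u ^+ 2 - f * v ^+ 2) by ring.
    by apply: leq_trans (size_polyD _ _) _; rewrite size_polyN geq_max hu hn.
  rewrite (size_mul f0 (expf_neq0 2 v0)) sf; set w := v ^+ 2; clear.
  by move: (size w); lia.
apply: leq_trans (size_polyD _ _) _; rewrite size_polyN geq_max size_sqr_sub //=.
have [->|w0] := eqVneq (v1 - a%:P * v2) 0; first by rewrite expr0n mulr0 size_poly0.
have := size_sqr_sub a (sv _ _ h1 su1) (sv _ _ h2 su2).
rewrite (size_mul f0 (expf_neq0 2 w0)) sf.
have : (0 < size ((v1 - a%:P * v2) ^+ 2)%R)%N by rewrite size_poly_gt0 expf_neq0.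
by set w := _ ^+ 2; clear; move: (size w); lia.
Qed.

End Forms.

Local Notation "p ^^" := (map_poly (@ratr algC) p) (at level 2, format "p ^^").

Definition cubic_curve (a b : rat) : weierstrass rat := Weierstrass 0 a 0 b 0.

Lemma map_cubic (a b : rat) (x : algC) : (cubic a b)^^.[x] = x * (x ^+ 2 + ratr a * x + ratr b).
Proof.
by rewrite /cubic !(rmorphM, rmorphD, rmorphXn) /= !map_polyC map_polyX !hornerE.
Qed.

Lemma on_cubic_curve (a b : rat) (x y : algC) :
  on_curve (map_weierstrass (@ratr algC) (cubic_curve a b)) (Some (x, y)) = (y ^+ 2 == (cubic a b)^^.[x]).
Proof.
rewrite /= rmorph0 !mul0r !addr0 map_cubic; congr (_ == _); ring.
Qed.

Lemma eval_forms_affine (F : 'I_3 -> {mpoly rat[3]}) (x y : algC) i :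
  eval_forms F (hcoord (Some (x, y))) 0 i = (map_mpoly (@ratr algC) (F i)).@[point3 x y 1].
Proof.
rewrite mxE !mevalE; apply: eq_bigr => m _; congr (_ * _); apply: eq_bigr => j _.
by rewrite mxE.
Qed.

Lemma eval_forms_infinity (F : 'I_3 -> {mpoly rat[3]}) i :
  eval_forms F (hcoord None) 0 i = ratr (F i).@[point3 0 1 0].
Proof.
rewrite mxE !mevalE (perm_big _ (msupp_map_mpoly (F i) (fmorph_inj (@ratr algC)))) /=.
rewrite rmorph_sum; apply: eq_bigr => m _; rewrite mcoeff_map_mpoly rmorphM rmorph_prod.
congr (_ * _); apply: eq_bigr => j _; rewrite rmorphXn mxE; congr (_ ^+ _).
by rewrite /point3; case: j => [[|[|[|]]]] //= _; rewrite ?rmorph0 ?rmorph1.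
Qed.

Definition i0 : 'I_3 := @Ordinal 3 0 isT.
Definition i1 : 'I_3 := @Ordinal 3 1 isT.
Definition i2 : 'I_3 := @Ordinal 3 2 isT.

(** The forms [F] valid near infinity describe the map wherever they do not all vanish. As infinity
    goes to infinity, the norm [n1] of the middle form has degree exactly 3 d and the other two
    norms have smaller degree; this is the only local information needed to find the pole of X. *)
Lemma isogeny_odd_point (a b e2 e3 : rat) : let f := cubic a b in
    e2 != 0 -> e3 != 0 -> e2 != e3 -> coprimep f f^`() ->
    isogenous (cubic_curve a b) (cubic_curve (- (e2 + e3)) (e2 * e3)) ->
  exists p q s, [/\ coprimep p q, q != 0, (size q < size p)%N & f * s ^+ 2 = quartic e2 e3 p q].
Proof.
move=> f e20 e30 e23 cf [phi [[onC2 loc] phiO [P0 onP0 phiP0]]].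
have fE : f = cubic a b by []; clearbody f.
have tf : top 3 1 f by rewrite fE; apply: top_cubic.
have [sf fm] := top_monic tf.
have f0 : f != 0 by rewrite monic_neq0.
have eqF (v : 'rV[algC]_3) P : v != 0 -> (v == hcoord P)%MS -> exists2 k, k != 0 & v = k *: hcoord P.
  move=> v0 /andP[/sub_rVP[k vk] _]; exists k => //.
  by apply: contraNneq v0 => k0; rewrite vk k0 scale0r.
have [d [F [homF FO agF]]] := loc None isT.
have [k k0] := eqF _ _ FO (agF None isT FO); rewrite phiO => FOk.
have FOi i : ratr (F i).@[point3 0 1 0] = (k *: hcoord None) 0 i :> algC.
  by rewrite -FOk eval_forms_infinity.
have ratr_eq0 (z : rat) : (ratr z == 0 :> algC) = (z == 0) by rewrite fmorph_eq0.
have FO0 : (F i0).@[point3 0 1 0] = 0 by apply/eqP; rewrite -ratr_eq0 FOi !mxE /= mulr0.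
have FO2 : (F i2).@[point3 0 1 0] = 0 by apply/eqP; rewrite -ratr_eq0 FOi !mxE /= mulr0.
have FO1 : (F i1).@[point3 0 1 0] != 0 by rewrite -ratr_eq0 FOi !mxE /= mulr1.
have [u0 [v0 [pb0 ev0]]] := form_pole_bound tf (homF i0); rewrite FO0 in pb0.
have [u1 [v1 [pb1 ev1]]] := form_pole_bound tf (homF i1).
have [u2 [v2 [pb2 ev2]]] := form_pole_bound tf (homF i2); rewrite FO2 in pb2.
set c1 := (F i1).@[_] in FO1 pb1.
pose n0 := u0 ^+ 2 - f * v0 ^+ 2; pose n1 := u1 ^+ 2 - f * v1 ^+ 2; pose n2 := u2 ^+ 2 - f * v2 ^+ 2.
have low n : top (3 * d) (if odd d then - 0 ^+ 2 else 0 ^+ 2) n -> (size n <= 3 * d)%N.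
  rewrite expr0n /= oppr0 if_same => -[sn nd]; apply/leq_sizeP => j; rewrite leq_eqVlt => /predU1P[<-//|jd].
  by rewrite nth_default // (leq_trans sn).
have s0 : (size n0 <= 3 * d)%N by apply: low; apply: norm_top.
have s2 : (size n2 <= 3 * d)%N by apply: low; apply: norm_top.
have s1 : size n1 = (3 * d).+1.
  have [sn nd] := norm_top tf pb1; apply/anti_leq; rewrite sn ltnNge; apply/negP => h.
  move: nd; rewrite nth_default // => /esym/eqP; case: odd; rewrite ?oppr_eq0 expf_eq0 /= (negPf FO1).
    by [].
  by [].
have n10 : n1 != 0 by rewrite -size_poly_gt0 s1.
have normE u v (x y : algC) : y ^+ 2 = f^^.[x] ->
    (u ^+ 2 - f * v ^+ 2)^^.[x] = (u^^.[x] + y * v^^.[x]) * (u^^.[x] - y * v^^.[x]).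
  move=> yE; rewrite !(rmorphB, rmorphM) /= hornerD hornerN !hornerM -yE.
  by ring.
have onF (x y : algC) : y ^+ 2 = f^^.[x] ->
    on_curve (map_weierstrass (@ratr algC) (cubic_curve a b)) (Some (x, y)).
  by move=> yE; rewrite on_cubic_curve -fE; apply/eqP.
(* Being homogeneous, the relation also holds where the forms all vanish. *)
have eq_h (x y : algC) : y ^+ 2 = f^^.[x] ->
    let g0 := u0^^.[x] + y * v0^^.[x] in let g1 := u1^^.[x] + y * v1^^.[x] in
    let g2 := u2^^.[x] + y * v2^^.[x] in
    g1 ^+ 2 * g2 = g0 * ((g0 - ratr e2 * g2) * (g0 - ratr e3 * g2)).
  move=> yE g0 g1 g2; have E0 := ev0 _ _ yE; have E1 := ev1 _ _ yE; have E2 := ev2 _ _ yE.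
  rewrite -eval_forms_affine in E0; rewrite -eval_forms_affine in E1; rewrite -eval_forms_affine in E2.
  rewrite /g0 /g1 /g2 -E0 -E1 -E2.
  have [->|nz] := eqVneq (eval_forms F (hcoord (Some (x, y)))) 0.
    by rewrite !mxE; ring.
  have [l l0 ->] := eqF _ _ nz (agF _ (onF _ _ yE) nz).
  have := onC2 _ (onF _ _ yE); case: (phi _) => [[X Y]|_]; last by rewrite !mxE /=; ring.
  rewrite on_cubic_curve map_cubic rmorphN rmorphD rmorphM /= => /eqP YE.
  rewrite !mxE /= !mulr1 exprMn YE; ring.
have nonroot (p : {poly rat}) : p != 0 -> exists x : algC, p^^.[x] != 0.
  move=> p0; apply: contrapT => h; case/eqP: p0; apply/eqP; rewrite -(map_poly_eq0 (@ratr algC)).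
  apply/eqP; apply: (@poly_eq0_nonroot _ 1); first exact: oner_neq0.
  by move=> x _; apply/eqP; apply: contrapT => /negP px; apply: h; exists x.
(* If the last form vanished on the whole curve, the map would be infinite wherever [F] is nonzero.
   This fails where [F] meets the forms [G] valid near [P0], whose last form is not identically
   zero. *)
have n20 : n2 != 0.
  apply/eqP => /(norm_eq0 tf)[u20 v20].
  case: P0 => [[xp yp]|] in onP0 phiP0; last exact: phiP0.
  have [d' [G [homG GP agG]]] := loc _ onP0.
  have ypE : yp ^+ 2 = f^^.[xp] by apply/eqP; rewrite fE -on_cubic_curve.
  have [w [z [_ evG]]] := form_pole_bound tf (homG i2).
  have wz : w ^+ 2 - f * z ^+ 2 != 0.
    apply/eqP => /(norm_eq0 tf)[w0 z0].
    have [l l0 lE] := eqF _ _ GP (agG _ onP0 GP).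
    have := evG _ _ ypE; rewrite -eval_forms_affine lE w0 z0 rmorph0 horner0 mulr0 addr0 mxE.
    case: (phi _) phiP0 => [[X Y] _|//]; rewrite mxE /= mulr1 => l00.
    by rewrite l00 eqxx in l0.
  have [x] := nonroot _ (mulf_neq0 n10 wz).
  pose y := sqrtC f^^.[x]; have yE : y ^+ 2 = f^^.[x] by rewrite sqrtCK.
  rewrite rmorphM /= hornerM !(normE _ _ _ _ yE) !mulf_eq0 !negb_or => /andP[/andP[g1 _] /andP[g2 _]].
  have FQ : eval_forms F (hcoord (Some (x, y))) != 0.
    apply: contraNneq g1 => h; rewrite -(ev1 _ _ yE) -eval_forms_affine h mxE //.
  have GQ : eval_forms G (hcoord (Some (x, y))) != 0.
    apply: contraNneq g2 => h; rewrite -(evG _ _ yE) -eval_forms_affine h mxE //.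
  have [l l0 lE] := eqF _ _ FQ (agF _ (onF _ _ yE) FQ).
  have [m m0 mE] := eqF _ _ GQ (agG _ (onF _ _ yE) GQ).
  have := ev2 _ _ yE; have := evG _ _ yE; rewrite -!eval_forms_affine lE mE u20 v20 !mxE.
  rewrite rmorph0 horner0 mulr0 addr0.
  case: (phi _) => [[X Y]|]; rewrite !mxE /= ?mulr1 ?mulr0.
    by move=> _ l00; rewrite l00 eqxx in l0.
  by move=> g20; rewrite -g20 eqxx in g2.
have poly_ext (p q : {poly rat}) : (forall x : algC, p^^.[x] = q^^.[x]) -> p = q.
  move=> pq; apply: (map_inj_poly (fmorph_inj (@ratr algC)) (rmorph0 _)).
  apply/eqP; rewrite -subr_eq0; apply/eqP.
  by apply: (@poly_eq0_nonroot _ 1) => [|x _]; rewrite ?oner_neq0 // hornerD hornerN pq subrr.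
pose n0' e := (u0 - e%:P * u2) ^+ 2 - f * (v0 - e%:P * v2) ^+ 2.
have nE : n1 * n1 * n2 = n0 * (n0' e2 * n0' e3).
  apply: poly_ext => x; pose y := sqrtC f^^.[x]; have yE : y ^+ 2 = f^^.[x] by rewrite sqrtCK.
  have yE' : (- y) ^+ 2 = f^^.[x] by rewrite sqrrN.
  have := eq_h _ _ yE; have := eq_h _ _ yE' => /= H' H.
  have mapM (p q : {poly rat}) : (p * q)^^.[x] = p^^.[x] * q^^.[x] by rewrite rmorphM hornerM.
  have mapS (p q : {poly rat}) e : (p - e%:P * q)^^.[x] = p^^.[x] - ratr e * q^^.[x].
    by rewrite rmorphB rmorphM /= map_polyC hornerD hornerN hornerM hornerC.
  rewrite !mapM /n1 /n2 /n0 /n0' !(normE _ _ _ _ yE) !mapS.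
  move: H H'; move: u0^^.[x] v0^^.[x] u1^^.[x] v1^^.[x] u2^^.[x] v2^^.[x] (ratr e2) (ratr e3).
  move=> U0 V0 U1 V1 U2 V2 E2 E3 H H'.
  transitivity (((U1 + y * V1) ^+ 2 * (U2 + y * V2)) * ((U1 + - y * V1) ^+ 2 * (U2 + - y * V2))); first by ring.
  by rewrite H H'; ring.
(* Otherwise the right side of [nE] has degree at most 3 deg n2, less than 2 deg n1 + deg n2. *)
have n0gt : (size n2 < size n0)%N.
  rewrite ltnNge; apply/negP => le.
  have le' e : (size (n0' e) <= size n2)%N by apply: (size_norm_sub tf).
  have le2 := le' e2; have le3 := le' e3.
  have := congr1 (fun h : {poly rat} => size h) nE; rewrite /=.
  rewrite (size_mul (mulf_neq0 n10 n10) n20) (size_mul n10 n10) s1.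
  have := size_polyMleq n0 (n0' e2 * n0' e3); have := size_polyMleq (n0' e2) (n0' e3).
  move: le le2 le3 s2; have : (0 < size n2)%N by rewrite size_poly_gt0.
  clear; set N := n0 * _; set M := n0' e2 * _.
  move: (size N) (size M) (size (n0' e2)) (size (n0' e3)) (size n0) (size n2); lia.
(* Multiplication by the conjugate of the last form makes the denominator rational: X = (u + v y) /
   n2 and Y = (r + w y) / n2. *)
pose u := u0 * u2 - f * v0 * v2; pose v := v0 * u2 - u0 * v2.
pose r := u1 * u2 - f * v1 * v2; pose w := v1 * u2 - u1 * v2.
have [Re Im] : (r ^+ 2 + f * w ^+ 2) * n2 - (u ^+ 3 + 3 * f * u * v ^+ 2
       - (e2 + e3)%:P * n2 * (u ^+ 2 + f * v ^+ 2) + (e2 * e3)%:P * n2 ^+ 2 * u) = 0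
   /\ 2 * r * w * n2 - (3 * u ^+ 2 * v + f * v ^+ 3 - 2 * (e2 + e3)%:P * n2 * u * v
       + (e2 * e3)%:P * n2 ^+ 2 * v) = 0.
  apply: (affine_zero tf) => x y yE.
  have H := eq_h _ _ yE; move: H => /=.
  pose ev : {rmorphism {poly rat} -> algC} := horner_eval x \o map_poly (@ratr algC).
  have evE p : p^^.[x] = ev p by [].
  have evC e : ratr e = ev e%:P by rewrite /= map_polyC horner_evalE hornerC.
  rewrite !evC !evE in yE *; clearbody ev; set E2 := ev e2%:P; set E3 := ev e3%:P => H.
  pose Y := ev f; pose Q := ev n2; pose U := ev u; pose V := ev v; pose R := ev r; pose W := ev w.
  transitivity ((R ^+ 2 + Y * W ^+ 2) * Q - (U ^+ 3 + 3 * Y * U * V ^+ 2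
      - (E2 + E3) * Q * (U ^+ 2 + Y * V ^+ 2) + E2 * E3 * Q ^+ 2 * U)
    + y * (2 * R * W * Q - (3 * U ^+ 2 * V + Y * V ^+ 3 - 2 * (E2 + E3) * Q * U * V
      + E2 * E3 * Q ^+ 2 * V))).
    by rewrite /E2 /E3; ring.
  have -> : U = ev u0 * ev u2 - Y * ev v0 * ev v2 by rewrite /U /u; ring.
  have -> : V = ev v0 * ev u2 - ev u0 * ev v2 by rewrite /V /v; ring.
  have -> : R = ev u1 * ev u2 - Y * ev v1 * ev v2 by rewrite /R /r; ring.
  have -> : W = ev v1 * ev u2 - ev u1 * ev v2 by rewrite /W /w; ring.
  have -> : Q = ev u2 ^+ 2 - Y * ev v2 ^+ 2 by rewrite /Q /n2; ring.
  rewrite /Y -yE.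
  move: H; move: (ev u0) (ev v0) (ev u1) (ev v1) (ev u2) (ev v2) E2 E3.
  clear => U0 V0 U1 V1 U2 V2 E2 E3 H.
  transitivity ((U2 - y * V2) ^+ 3 * ((U1 + y * V1) ^+ 2 * (U2 + y * V2)
    - (U0 + y * V0) * ((U0 + y * V0 - E2 * (U2 + y * V2)) * (U0 + y * V0 - E3 * (U2 + y * V2))))).
    by ring.
  by rewrite H subrr mulr0.
have nuv : u ^+ 2 - f * v ^+ 2 = n0 * n2 by rewrite /u /v /n0 /n2; ring.
apply: (odd_point e20 e30 e23 sf cf n20 (u := u) (v := v) (r := r) (w := w)).
- by apply/eqP; rewrite -subr_eq0; apply/eqP.
- by apply/eqP; rewrite -subr_eq0; apply/eqP.
have n00 : n0 != 0 by rewrite -size_poly_gt0 (leq_ltn_trans _ n0gt).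
rewrite nuv expr2 (size_mul n20 n20) (size_mul n00 n20).
move: n0gt; have : (0 < size n2)%N by rewrite size_poly_gt0.
by clear; move: (size n0) (size n2); lia.
Qed.

(** * Non-isogeny of Frey curves *)

Lemma cubic_separable (x y : rat) : x != 0 -> y != 0 -> x != y ->
  coprimep (cubic (- (x + y)) (x * y)) (cubic (- (x + y)) (x * y))^`().
Proof.
move=> x0 y0 xy; set f := cubic _ _.
have fE : f = ('X - 0%:P) * (('X - x%:P) * ('X - y%:P)) by rewrite /f /cubic; ring.
have dE z : f^`().[z] = (z - x) * (z - y) + z * ((z - y) + (z - x)).
  by rewrite fE !derivM !derivXsubC !hornerE; ring.
have cop z : f^`().[z] != 0 -> coprimep ('X - z%:P) f^`().
  by move=> h; rewrite coprimep_sym coprimep_XsubC.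
rewrite {1}fE !coprimepMl !cop // dE.
- rewrite (_ : _ + _ = y * (y - x)); last by ring.
  by rewrite mulf_neq0 // subr_eq0 eq_sym.
- rewrite (_ : _ + _ = x * (x - y)); last by ring.
  by rewrite mulf_neq0 // subr_eq0.
rewrite (_ : _ + _ = x * y); last by ring.
by rewrite mulf_neq0.
Qed.

(** The congruences on [A] and [b] put the source in étale shape: B - A is 5 modulo 8 and - A B is
    16 times an odd number. *)
Lemma frey_not_isogenous (A B A' B' b : int) :
    (exists k, A = 8 * k + 3) -> (exists k, b = 2 * k + 1) -> B = 16 * b -> A + B != 0 ->
    A' != 0 -> B' != 0 -> A' + B' != 0 ->
    square_type A' -> square_type (- B') -> square_type (A' + B') ->
  ~ isogenous (frey_curve A B) (frey_curve A' B').
Proof.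
move=> [k Ak] [j bj] Bb AB A'0 B'0 AB'0 tA tB tAB iso.
have A0 : A%:~R != 0 :> rat by rewrite intr_eq0 Ak; lia.
have B0 : (- B)%:~R != 0 :> rat by rewrite intr_eq0 Bb bj; lia.
have E1 : frey_curve A B = cubic_curve (- (A%:~R + (- B)%:~R)) (A%:~R * (- B)%:~R).
  by congr Weierstrass; ring.
have E2 : frey_curve A' B' = cubic_curve (- (A'%:~R + (- B')%:~R)) (A'%:~R * (- B')%:~R).
  by congr Weierstrass; ring.
rewrite E1 E2 in iso.
have e20 : A'%:~R != 0 :> rat by rewrite intr_eq0.
have e30 : (- B')%:~R != 0 :> rat by rewrite intr_eq0 oppr_eq0.
have e23 : A'%:~R != (- B')%:~R :> rat by rewrite eqr_int -addr_eq0.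
have AB0 : A%:~R != (- B)%:~R :> rat by rewrite eqr_int -addr_eq0.
have [p [q [s [cpq q0 qp fs]]]] := isogeny_odd_point e20 e30 e23 (cubic_separable A0 B0 AB0) iso.
set f := cubic _ _ in fs.
have sf : size f = 4%N by have [] := top_monic (top_cubic (- (A%:~R + (- B)%:~R)) (A%:~R * (- B)%:~R) : top 3 1 f).
have [_ [c c0 ode]] := ode_of_curve cpq q0 qp sf e20 e30 e23 fs.
apply: (no_isogeny_ode (e2 := A') (e3 := - B') _ _ _ tA tB _ _ c0 cpq q0 qp ode).
- exact: A'0.
- by rewrite oppr_eq0.
- by rewrite -addr_eq0.
- by rewrite opprK.
left; exists (2 * b - k - 1).
have [l lE] : exists l, - (A * b) = 2 * l + 1.
  by exists (- (8 * k * j + 4 * k + 3 * j + 2)); rewrite Ak bj; ring.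
exists l; rewrite -lE /f; congr cubic.
  by rewrite Bb Ak; ring.
by rewrite Bb; ring.
Qed.

Lemma family_not_isogenous (t : int) : 1 <= t ->
  ~ isogenous (frey_curve (famA t) (famB t)) (frey_curve (famA' t) (famB' t)).
Proof.
move=> t1; pose m := 364 * t + 1; pose n := 364 * t + 5.
have [m0 n0 [mn1 mn2] [q0 mn3]] : [/\ m != 0, n != 0, 256 * n - m != 0 /\ 4 * n - m != 0
    & 16 * m - n != 0 /\ 4 * n + m != 0].
  have m_gt0 : 0 < m by rewrite addr_gt0 // mulr_gt0 // (lt_le_trans _ t1).
  have : n = m + 4 by rewrite /n /m; ring.
  by move: m n m_gt0; clear => m n; split; [lia|lia|split; lia|split; lia].
apply: (@frey_not_isogenous _ _ _ _ (16 * (364 * t + 5) ^+ 2 - (364 * t + 1) ^+ 2)).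
- by exists ((182 * t) * (1365 * t) + 1183 * t + 1); rewrite /famA; ring.
- by exists ((546 * t) * (1820 * t) + 4 * 7189 * t + 199); ring.
- by [].
- rewrite (_ : famA t + famB t = n * (256 * n - m)); last by rewrite /famA /famB /m /n; ring.
  by rewrite mulf_neq0.
- rewrite (_ : famA' t = (4 * n - m) * (4 * n + m)); last by rewrite /famA' /m /n; ring.
  by rewrite mulf_neq0.
- by rewrite !mulf_neq0.
- rewrite (_ : famA' t + famB' t = m * (256 * n - m)); last by rewrite /famA' /famB' /m /n; ring.
  by rewrite mulf_neq0.
- exists ((546 * t) * (455 * t) + 7189 * t + 50); rewrite /famA'; apply: Or42; ring.
- exists (- ((182 * t) * (1365 * t) + 3913 * t + 7)); rewrite /famB'; apply: Or43; ring.
exists ((182 * t) * (91 * (255 * t)) + 1183 * 59 * t + 160); rewrite /famA' /famB'; apply: Or42; ring.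
Qed.

(** * Minimal models and reduction *)

Section Valuation.
Variable p : nat.
Hypothesis pr : prime p.
Implicit Types (x y : rat) (n d : int).

Lemma vp_div n d : n != 0 -> d != 0 -> vp p (n%:~R / d%:~R) = (logn p `|n|%N)%:Z - (logn p `|d|%N)%:Z.
Proof.
move=> n0 d0; set x := _ / _; have d0' : d%:~R != 0 :> rat by rewrite intr_eq0.
have x0 : x != 0 by rewrite mulf_neq0 ?invr_eq0 // intr_eq0.
have : numq x * d = n * denq x.
  apply: (@intr_inj rat); rewrite !rmorphM /=.
  have := divq_num_den x; have : (denq x)%:~R != 0 :> rat by rewrite intr_eq0 denq_neq0.
  by rewrite {3}/x => q0 E; apply: (mulIf (invr_neq0 q0)); rewrite mulrAC E mulfVK // mulfK.
move/(congr1 absz)/(congr1 (logn p)); rewrite !abszM !lognM ?absz_gt0 ?numq_eq0 ?denq_neq0 //.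
rewrite /vp; lia.
Qed.

Lemma vpM x y : x != 0 -> y != 0 -> vp p (x * y) = vp p x + vp p y.
Proof.
have vp_frac n d n' d' : n != 0 -> d != 0 -> n' != 0 -> d' != 0 ->
    vp p (n%:~R / d%:~R * (n'%:~R / d'%:~R)) = vp p (n%:~R / d%:~R) + vp p (n'%:~R / d'%:~R).
  move=> n0 d0 n'0 d'0; rewrite mulrACA -invfM -!rmorphM !vp_div ?mulf_neq0 //.
  by rewrite !abszM !lognM ?absz_gt0 // !PoszD; ring.
move=> x0 y0; rewrite -[x]divq_num_den -[y]divq_num_den.
by apply: vp_frac; rewrite ?numq_eq0 ?denq_neq0.
Qed.

Lemma vp_int n : vp p n%:~R = (logn p `|n|%N)%:Z.
Proof. by rewrite /vp numq_int denq_int logn1 subr0. Qed.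

Lemma vpX x k : x != 0 -> vp p (x ^+ k) = k%:Z * vp p x.
Proof.
move=> x0; elim: k => [|k IH]; first by rewrite mul0r (vp_int 1) logn1.
by rewrite exprS vpM ?expf_neq0 // IH; lia.
Qed.

Lemma p_int_ge0 x : p_int p x -> 0 <= vp p x.
Proof.
rewrite /p_int /vp => pd; rewrite [logn p `|denq x|]lognE (negPf pd) !andbF.
by rewrite subr0.
Qed.

Lemma p_intP x : p_int p x <-> exists n d, ~~ (p %| `|d|)%N /\ x = n%:~R / d%:~R.
Proof.
split=> [px|[n [d [pd xE]]]].
  by exists (numq x), (denq x); rewrite divq_num_den.
have d0 : d != 0 by apply: contraNneq pd => ->; rewrite dvdn0.
apply: contra pd => pd; apply: dvdn_trans pd _.
have /eqP : (numq x)%:~R / (denq x)%:~R = n%:~R / d%:~R :> rat by rewrite divq_num_den.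
rewrite eqr_div ?intr_eq0 ?denq_neq0 // -!rmorphM => /eqP/intr_inj/(congr1 absz).
rewrite !abszM => E; rewrite -(@Gauss_dvdr _ `|numq x|) 1?coprime_sym ?coprime_num_den //.
by rewrite E dvdn_mull.
Qed.

Lemma p_int_intr n : p_int p n%:~R.
Proof. by rewrite /p_int denq_int /= gtnNdvd // prime_gt1. Qed.

Lemma p_intM x y : p_int p x -> p_int p y -> p_int p (x * y).
Proof.
move=> /p_intP[n [d [pd ->]]] /p_intP[n' [d' [pd' ->]]]; apply/p_intP.
exists (n * n'), (d * d'); rewrite abszM Euclid_dvdM // negb_or pd pd'; split=> //.
by rewrite !rmorphM /= mulrACA invfM.
Qed.

Lemma p_intD x y : p_int p x -> p_int p y -> p_int p (x + y).
Proof.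
move=> /p_intP[n [d [pd ->]]] /p_intP[n' [d' [pd' ->]]]; apply/p_intP.
exists (n * d' + n' * d), (d * d'); rewrite abszM Euclid_dvdM // negb_or pd pd'; split=> //.
have d0 : d%:~R != 0 :> rat by rewrite intr_eq0; apply: contraNneq pd => ->; rewrite dvdn0.
have d0' : d'%:~R != 0 :> rat by rewrite intr_eq0; apply: contraNneq pd' => ->; rewrite dvdn0.
by rewrite !(rmorphD, rmorphM) /=; field; rewrite d0 d0'.
Qed.

Lemma p_intN x : p_int p x -> p_int p (- x).
Proof. by move=> px; rewrite -mulN1r p_intM // (p_int_intr (-1)). Qed.

Lemma p_intX x k : p_int p x -> p_int p (x ^+ k).
Proof.
move=> px; elim: k => [|k IH]; first exact: (p_int_intr 1).
by rewrite exprS p_intM.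
Qed.

End Valuation.

(** * Discriminant, c4 and minimality at a prime *)

Definition c4 (K : fieldType) (W : weierstrass K) : K :=
  (a1 W ^+ 2 + 4 * a2 W) ^+ 2 - 24 * (2 * a4 W + a1 W * a3 W).

Lemma isomorphic_disc (K : fieldType) (W W' : weierstrass K) : isomorphic W W' ->
  exists u : K, [/\ u != 0, disc W = u ^+ 12 * disc W' & c4 W = u ^+ 4 * c4 W'].
Proof.
case: W W' => [x1 x2 x3 x4 x6] [y1 y2 y3 y4 y6] [u [r [s [t [u0 /= [E1 E2 E3 E4 E6]]]]]].
exists u; split=> //.
  have -> : u ^+ 12 * disc (Weierstrass y1 y2 y3 y4 y6) =
     disc (Weierstrass (u * y1) (u ^+ 2 * y2) (u ^+ 3 * y3) (u ^+ 4 * y4) (u ^+ 6 * y6)).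
    by rewrite /disc /=; ring.
  by rewrite E1 E2 E3 E4 E6 /disc /=; ring.
have -> : u ^+ 4 * c4 (Weierstrass y1 y2 y3 y4 y6) =
   c4 (Weierstrass (u * y1) (u ^+ 2 * y2) (u ^+ 3 * y3) (u ^+ 4 * y4) (u ^+ 6 * y6)).
  by rewrite /c4 /=; ring.
by rewrite E1 E2 E3 E4 E6 /c4 /=; ring.
Qed.

Lemma p_integral_disc p W : prime p -> p_integral p W -> p_int p (disc W) /\ p_int p (c4 W).
Proof.
move=> pr; case: W => [x1 x2 x3 x4 x6] /and5P[/= h1 h2 h3 h4 h6].
have ph n : p_int p n%:R by apply: (p_int_intr pr n).
by rewrite /disc /c4 /=; split; repeat lazymatch goal with
  | |- is_true (p_int _ (_ + _)) => apply: (p_intD pr)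
  | |- is_true (p_int _ (- _)) => apply: (p_intN pr)
  | |- is_true (p_int _ (_ ^+ _)) => apply: (p_intX pr)
  | |- is_true (p_int _ (_ * _)) => apply: (p_intM pr)
  | |- is_true (p_int _ _%:R) => exact: ph
  | _ => assumption end.
Qed.

(** If p divides [D], then c4 is a unit at p, so an integral model reached with scaling factor u has
    v(u) <= 0, and its discriminant has valuation v(D) - 12 v(u) >= v(D). *)
Lemma minimal_of_coprime p (W : weierstrass rat) (D C : int) : prime p -> p_integral p W ->
  disc W = D%:~R -> c4 W = C%:~R -> D != 0 -> coprimez D C -> minimal_at p W.
Proof.
move=> pr pW dW cW D0 cop; split=> // W' iso pW'.
have [pd pc] := p_integral_disc pr pW'.
have [u [u0 du cu]] := isomorphic_disc iso.
have dW0 : disc W != 0 by rewrite dW intr_eq0.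
have dW'0 : disc W' != 0 by apply: contraNneq dW0 => h; rewrite du h mulr0.
have vd' := p_int_ge0 pd.
have [pD|pD] := boolP (p %| `|D|)%N; last first.
  by rewrite dW vp_int lognE (negPf pD) !andbF.
have pC : ~~ (p %| `|C|)%N.
  apply/negP => pC; have : (p %| gcdn `|D| `|C|)%N by rewrite dvdn_gcd pD.
  have /eqP -> : coprime `|D| `|C| := cop.
  by rewrite dvdn1 => /eqP p1; rewrite p1 in pr.
have C0 : C != 0 by apply: contraNneq pC => ->; rewrite dvdn0.
have c0 : c4 W' != 0.
  have : c4 W != 0 by rewrite cW intr_eq0.
  by apply: contraNneq => h; rewrite cu h mulr0.
have := p_int_ge0 pc; have : vp p (c4 W) = 0 by rewrite cW vp_int lognE (negPf pC) !andbF.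
rewrite cu du (vpM pr (expf_neq0 4 u0) c0) (vpM pr (expf_neq0 12 u0) dW'0) !(vpX pr _ u0).
by clear; lia.
Qed.

(** * Smooth and nodal reductions *)

Lemma disc_map (K L : fieldType) (iota : {rmorphism K -> L}) W :
  disc (map_weierstrass iota W) = iota (disc W).
Proof. by rewrite /disc /=; ring. Qed.

(** The equations of a singular point are linear in a3, a4, a6; solving for these makes the
    discriminant vanish identically. *)
Lemma disc_nonsingular (K : fieldType) (W : weierstrass K) : disc W != 0 -> nonsingular W.
Proof.
move=> dW L iota x y sing; case/eqP: dW; apply: (fmorph_inj iota); rewrite -disc_map rmorph0.
move: sing; case: (map_weierstrass _ _) => [x1 x2 x3 x4 x6] [/= /eqP on Fx Fy].
have E3 : x3 = - 2 * y - x1 * x by apply/eqP; rewrite -subr_eq0 -Fy; apply/eqP; ring.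
have E4 : x4 = x1 * y - 3 * x ^+ 2 - 2 * x2 * x by apply/eqP; rewrite -subr_eq0 -oppr_eq0 -Fx; apply/eqP; ring.
have E6 : x6 = y ^+ 2 + x1 * x * y + x3 * y - (x ^+ 3 + x2 * x ^+ 2 + x4 * x) by rewrite on; ring.
by rewrite /disc /= E6 E4 E3; ring.
Qed.

(** The last hypothesis is the discriminant of the quadratic of tangent slopes, whose square root is
    taken in an algebraic closure. *)
Lemma node_of_double_root (K : countFieldType) (a2 a4 x y : K) : (2 : K) != 0 ->
    y ^+ 2 + x * y = x ^+ 3 + a2 * x ^+ 2 + a4 * x ->
    y - 3 * x ^+ 2 - 2 * a2 * x - a4 = 0 -> 2 * y + x = 0 -> 1 + 4 * (a2 + 3 * x) != 0 ->
  has_node (Weierstrass 1 a2 0 a4 0).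
Proof.
move=> n2 on Fx Fy d0.
have [L [iota _]] := countable_algebraic_closure K.
have [r rE] : exists r : L, r ^+ 2 = iota (1 + 4 * (a2 + 3 * x)).
  have [r rE] := @solve_monicpoly L 2 (fun i => if i == 0%N then iota (1 + 4 * (a2 + 3 * x)) else 0) isT.
  by exists r; rewrite rE !big_ord_recl big_ord0 /= mul0r !addr0 expr0 mulr1.
have r0 : r != 0.
  by apply: contraNneq d0 => r0; rewrite -(fmorph_eq0 iota) -rE r0 expr0n.
have n2' : (2 : L) != 0 by rewrite -(rmorph_nat iota) fmorph_eq0.
exists L, iota, (iota x), (iota y), ((- 1 + r) / 2), ((- 1 - r) / 2); split.
- split=> /=.
  + rewrite rmorph1 rmorph0 !mul1r mul0r !addr0; apply/eqP; rewrite -!rmorphXn -!rmorphM -!rmorphD.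
    by congr (iota _).
  + by rewrite rmorph1 mul1r -(rmorph0 iota) -Fx; ring.
  + by rewrite rmorph1 rmorph0 mul1r addr0 -(rmorph0 iota) -Fy; ring.
- rewrite /tangent_slopes /= rmorph1.
  have n4 : (4 : L) != 0 by rewrite (_ : 4 = 2 * 2 :> L) ?mulf_neq0 //; ring.
  have e2 : iota a2 + 3 * iota x = (r ^+ 2 - 1) / 4.
    by rewrite rE; apply: (mulIf n4); rewrite mulfVK //; ring.
  have sE : (-1 + r) / 2 + (-1 - r) / 2 = -1 by field; rewrite ?n2'.
  have pE : (-1 + r) / 2 * ((-1 - r) / 2) = - (iota a2 + 3 * iota x) by rewrite e2; field; rewrite ?n2' ?n4.
  move: ((-1 + r) / 2) ((-1 - r) / 2) sE pE => al be sE pE.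
  transitivity ('X^2 - (al + be)%:P * 'X + (al * be)%:P); last by ring.
  by rewrite sE pE scale1r; ring.
have dE : (-1 + r) / 2 - (-1 - r) / 2 = r by field; rewrite ?n2'.
by rewrite -subr_eq0 dE.
Qed.

Lemma frey_node (K : countFieldType) (A B : K) : (2 : K) != 0 -> ~~ ((A == 0) && (B == 0)) ->
    [|| A == 0, B == 0 | A + B == 0] ->
  has_node (Weierstrass 1 ((B - A - 1) / 4) 0 (- (A * B / 16)) 0).
Proof.
move=> n2 AB.
have n4 : (4 : K) != 0 by rewrite (_ : 4 = 2 * 2 :> K) ?mulf_neq0 //; ring.
have n8 : (8 : K) != 0 by rewrite (_ : 8 = 2 * 4 :> K) ?mulf_neq0 //; ring.
have n16 : (16 : K) != 0 by rewrite (_ : 16 = 4 * 4 :> K) ?mulf_neq0 //; ring.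
case/or3P => /eqP H.
- apply: (@node_of_double_root _ _ _ 0 0) => //; rewrite ?H; try by field; rewrite ?n2 ?n4 ?n16.
  have -> : 1 + 4 * ((B - 0 - 1) / 4 + 3 * 0) = B by field; rewrite ?n4.
  by apply: contraNneq AB => B0; rewrite H B0 eqxx.
- apply: (@node_of_double_root _ _ _ 0 0) => //; rewrite ?H; try by field; rewrite ?n2 ?n4 ?n16.
  have -> : 1 + 4 * ((0 - A - 1) / 4 + 3 * 0) = - A by field; rewrite ?n4.
  by rewrite oppr_eq0; apply: contraNneq AB => A0; rewrite H A0 eqxx.
have BA : B = - A by apply/eqP; rewrite -addr_eq0 addrC H.
(* The double root of x (x - A) (x + B) is now A; in the minimal model it becomes A / 4, with y = -
   x / 2. *)
apply: (@node_of_double_root _ _ _ (A / 4) (- A / 8)) => //; rewrite ?BA; try by field; rewrite ?n2 ?n4 ?n8 ?n16.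
have -> : 1 + 4 * ((- A - A - 1) / 4 + 3 * (A / 4)) = A by field; rewrite ?n4.
by apply: contraNneq AB => A0; rewrite BA A0 oppr0 eqxx.
Qed.

Definition frey_minimal (k b : int) : weierstrass rat :=
  Weierstrass 1 (4 * b - k)%:~R 0 (- ((4 * k - 1) * b))%:~R 0.

Lemma frey_minimal_iso (k b : int) : isomorphic (frey_curve (4 * k - 1) (16 * b)) (frey_minimal k b).
Proof.
exists 2, 0, 1, 0; split=> //; split=> /=; rewrite ?(rmorphB, rmorphN, rmorphM, rmorphD) /=; ring.
Qed.

Definition frey_radical (k b : int) : int := (4 * k - 1) * (b * (4 * k - 1 + 16 * b)).

Definition frey_c4 (k b : int) : int :=
  (4 * k - 1) ^+ 2 + (4 * k - 1) * (16 * b) + (16 * b) ^+ 2.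

Lemma disc_frey_minimal (k b : int) : disc (frey_minimal k b) = (frey_radical k b ^+ 2)%:~R.
Proof. by rewrite /disc /frey_radical /= !(rmorphB, rmorphN, rmorphM, rmorphD, rmorphXn) /=; ring. Qed.

Lemma c4_frey_minimal (k b : int) : c4 (frey_minimal k b) = (frey_c4 k b)%:~R.
Proof. by rewrite /c4 /frey_c4 /= !(rmorphB, rmorphN, rmorphM, rmorphD, rmorphXn) /=; ring. Qed.

(** A^2 + A B + B^2 is B^2 modulo A, and A^2 modulo B and modulo A + B. *)
Lemma coprime_radical_c4 (k b : int) : coprimez (4 * k - 1) (16 * b) ->
  coprimez (frey_radical k b ^+ 2) (frey_c4 k b).
Proof.
rewrite /frey_radical /frey_c4; set A := 4 * k - 1; set B := 16 * b => cAB.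
have cA : coprimez A (A ^+ 2 + A * B + B ^+ 2).
  rewrite (_ : _ + _ = (A + B) * A + B ^+ 2); last by ring.
  by rewrite /coprimez gcdzMDl; apply: coprimezXr.
have cB : coprimez B (A ^+ 2 + A * B + B ^+ 2).
  rewrite (_ : _ + _ = (A + B) * B + A ^+ 2); last by ring.
  by rewrite /coprimez gcdzMDl; apply: coprimezXr; rewrite coprimez_sym.
have cAB' : coprimez (A + B) (A ^+ 2 + A * B + B ^+ 2).
  rewrite (_ : A ^+ 2 + A * B + B ^+ 2 = B * (A + B) + A ^+ 2); last by ring.
  rewrite /coprimez gcdzMDl; apply: coprimezXr; rewrite coprimez_sym.
  by rewrite (_ : A + B = 1 * A + B) /coprimez ?gcdzMDl //; ring.
apply: coprimezXl; rewrite !coprimezMl cA cAB' andbT /=.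
by apply: coprimez_dvdl cB; rewrite /B abszM dvdn_mull.
Qed.

Section Reduction.
Variables (p : nat) (k b : int).
Hypothesis pr : prime p.

Lemma integral_frey_minimal : p_integral p (frey_minimal k b).
Proof.
by apply/and5P; split; rewrite /=; first [exact: (p_int_intr pr 1) | exact: (p_int_intr pr 0) | exact: p_int_intr].
Qed.

Lemma minimal_frey_minimal : frey_radical k b != 0 -> coprimez (4 * k - 1) (16 * b) ->
  minimal_at p (frey_minimal k b).
Proof.
move=> R0 cop; apply: (minimal_of_coprime pr integral_frey_minimal (disc_frey_minimal k b) (c4_frey_minimal k b)).
  by rewrite expf_neq0.
exact: coprime_radical_c4.
Qed.

Lemma reduction_frey_minimal : reduction p (frey_minimal k b) =
  Weierstrass 1 (4 * b - k)%:~R 0 (- ((4 * k - 1) * b))%:~R 0.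
Proof. by rewrite /reduction /map_weierstrass /=; congr Weierstrass; rewrite ?ratr_int ?(ratr_int _ 1) ?(ratr_int _ 0). Qed.

Lemma intr_Fp_eq0 (n : int) : (n%:~R == 0 :> 'F_p) = (p %| `|n|)%N.
Proof.
have ch := pchar_Fp pr.
case: n => n; first by rewrite -pmulrn -(dvdn_pcharf ch).
by rewrite NegzE rmorphN oppr_eq0 /= -pmulrn -(dvdn_pcharf ch).
Qed.

Lemma good_frey : frey_radical k b != 0 -> coprimez (4 * k - 1) (16 * b) ->
  ~~ (p %| `|frey_radical k b|)%N -> good_reduction p (frey_curve (4 * k - 1) (16 * b)).
Proof.
move=> R0 cop pR; exists (frey_minimal k b); split; [exact: frey_minimal_iso | exact: minimal_frey_minimal |].
apply: disc_nonsingular; rewrite reduction_frey_minimal.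
have -> : disc (Weierstrass 1 (4 * b - k)%:~R 0 (- ((4 * k - 1) * b))%:~R 0) = (frey_radical k b ^+ 2)%:~R :> 'F_p.
  by rewrite /disc /frey_radical /= !(rmorphB, rmorphN, rmorphM, rmorphD, rmorphXn) /=; ring.
by rewrite rmorphXn expf_neq0 //= intr_Fp_eq0.
Qed.

Lemma multiplicative_frey : frey_radical k b != 0 -> coprimez (4 * k - 1) (16 * b) ->
  ~~ (2 %| `|frey_radical k b|)%N ->
  (p %| `|frey_radical k b|)%N -> multiplicative_reduction p (frey_curve (4 * k - 1) (16 * b)).
Proof.
move=> R0 cop odd_R pR; exists (frey_minimal k b); split; [exact: frey_minimal_iso | exact: minimal_frey_minimal |].
rewrite reduction_frey_minimal.
(* With p odd, 16 is invertible and the reduced equation can be rewritten in terms of A and B. *)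
have p2 : p != 2%N by apply: contraNneq odd_R => <-.
have n2 : (2 : 'F_p) != 0.
  rewrite -[2]/(2%:~R) intr_Fp_eq0 /=.
  by rewrite dvdn_prime2.
have n4 : (4 : 'F_p) != 0 by rewrite (_ : 4 = 2 * 2 :> 'F_p) ?mulf_neq0 //; ring.
have n16 : (16 : 'F_p) != 0 by rewrite (_ : 16 = 4 * 4 :> 'F_p) ?mulf_neq0 //; ring.
set A : 'F_p := (4 * k - 1)%:~R; set B : 'F_p := (16 * b)%:~R.
have AB : ~~ ((A == 0) && (B == 0)).
  rewrite !intr_Fp_eq0; apply/negP => /andP[pA pB].
  have : (p %| gcdn `|(4 * k - 1)%R| `|(16 * b)%R|)%N by rewrite dvdn_gcd pA.
  have /eqP -> : coprime `|(4 * k - 1)%R| `|(16 * b)%R| := cop.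
  by rewrite dvdn1 => /eqP p1; have := prime_gt1 pr; rewrite p1.
have kE : k%:~R = (A + 1) / 4 :> 'F_p.
  by apply: (mulIf n4); rewrite mulfVK // /A rmorphB rmorphM /=; ring.
have bE : b%:~R = B / 16 :> 'F_p.
  by apply: (mulIf n16); rewrite mulfVK // /B rmorphM /=; ring.
have a2E : (4 * b - k)%:~R = (B - A - 1) / 4 :> 'F_p.
  by rewrite rmorphB rmorphM /= bE kE; field; rewrite ?n4 ?n16.
have a4E : (- ((4 * k - 1) * b))%:~R = - (A * B / 16) :> 'F_p.
  by rewrite rmorphN rmorphM /= -/A bE; ring.
rewrite a2E a4E.
apply: frey_node => //.
move: pR; rewrite /frey_radical !abszM !Euclid_dvdM // -!intr_Fp_eq0 bE.
case/or3P => [->//|b0|].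
  by move: b0; rewrite mulf_eq0 invr_eq0 (negPf n16) orbF => ->; rewrite orbT.
by rewrite rmorphD /= => ->; rewrite !orbT.
Qed.

End Reduction.

(** * Semistability, minimal discriminant and conductor of Frey curves *)

Lemma frey_elliptic (k b : int) : frey_radical k b != 0 -> elliptic (frey_curve (4 * k - 1) (16 * b)).
Proof.
move=> R0; apply: disc_nonsingular; have [u [u0 -> _]] := isomorphic_disc (frey_minimal_iso k b).
by rewrite mulf_neq0 ?expf_neq0 // disc_frey_minimal intr_eq0 expf_neq0.
Qed.

Lemma frey_semistable (k b : int) : frey_radical k b != 0 -> coprimez (4 * k - 1) (16 * b) ->
  ~~ (2 %| `|frey_radical k b|)%N -> semistable (frey_curve (4 * k - 1) (16 * b)).
Proof.
move=> R0 cop oddR p pr; have [pR|pR] := boolP (p %| `|frey_radical k b|)%N.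
  by right; apply: multiplicative_frey.
by left; apply: good_frey.
Qed.

Lemma frey_minimal_discriminant (k b : int) : frey_radical k b != 0 -> coprimez (4 * k - 1) (16 * b) ->
  minimal_discriminant (frey_curve (4 * k - 1) (16 * b)) (frey_radical k b ^+ 2).
Proof.
move=> R0 cop; exists (frey_minimal k b); split; [exact: frey_minimal_iso | | exact: disc_frey_minimal].
split; first by apply/and5P; split; rewrite /= ?intr_int // ?rpred0 ?rpred1.
by move=> p pr; apply: minimal_frey_minimal.
Qed.

Lemma prod_primes_gt0 (s : seq nat) : all prime s -> (0 < \prod_(q <- s) q)%N.
Proof.
elim: s => [|q s IH] /=; first by rewrite big_nil.
by case/andP=> qp sp; rewrite big_cons muln_gt0 prime_gt0 // IH.
Qed.

Lemma logn_prod_primes p (s : seq nat) : all prime s -> uniq s -> prime p ->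
  logn p (\prod_(q <- s) q)%N = (p \in s).
Proof.
move=> + + pr; elim: s => [|q s IH] /=; first by rewrite big_nil logn1.
move=> /andP[qp sp] /andP[qs us]; have P0 := prod_primes_gt0 sp; have q0 := prime_gt0 qp.
rewrite big_cons lognM // IH // inE logn_prime //.
by case: eqVneq => [->|_]; rewrite ?(negPf qs).
Qed.

Lemma frey_conductor (k b : int) : frey_radical k b != 0 -> coprimez (4 * k - 1) (16 * b) ->
    ~~ (2 %| `|frey_radical k b|)%N ->
  conductor (frey_curve (4 * k - 1) (16 * b)) (\prod_(q <- primes `|frey_radical k b|%N) q)%N.
Proof.
move=> R0 cop oddR; have all_pr : all prime (primes `|frey_radical k b|%N).
  by apply/allP => q; rewrite mem_primes => /and3P[].
split; first exact: prod_primes_gt0.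
move=> p pr; rewrite logn_prod_primes ?primes_uniq // mem_primes pr absz_gt0 R0 /=.
have [pR|pR] := boolP (p %| `|frey_radical k b|)%N.
  by apply: Or32; split=> //; apply: multiplicative_frey.
by apply: Or31; split=> //; apply: good_frey.
Qed.

Lemma frey_twins (k b k' b' : int) : frey_radical k b = frey_radical k' b' -> frey_radical k b != 0 ->
    coprimez (4 * k - 1) (16 * b) -> coprimez (4 * k' - 1) (16 * b') ->
    ~~ (2 %| `|frey_radical k b|)%N ->
  discriminant_twins (frey_curve (4 * k - 1) (16 * b)) (frey_curve (4 * k' - 1) (16 * b')).
Proof.
move=> RR R0 cop cop' oddR; split.
  exists (frey_radical k b ^+ 2); split; first exact: frey_minimal_discriminant.
  by rewrite RR; apply: frey_minimal_discriminant; rewrite -?RR.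
exists (\prod_(q <- primes `|frey_radical k b|%N) q)%N; split; first exact: frey_conductor.
by rewrite RR; apply: frey_conductor; rewrite -?RR.
Qed.

(* [c4 ^ 3 / disc] is an isomorphism invariant, here written in lowest terms. *)
Lemma frey_radical_isomorphic (W : weierstrass rat) (k b k' b' : int) :
    frey_radical k b != 0 -> frey_radical k' b' != 0 ->
    coprimez (4 * k - 1) (16 * b) -> coprimez (4 * k' - 1) (16 * b') ->
    isomorphic W (frey_curve (4 * k - 1) (16 * b)) -> isomorphic W (frey_curve (4 * k' - 1) (16 * b')) ->
  frey_radical k b ^+ 2 = frey_radical k' b' ^+ 2.
Proof.
move=> R0 R0' cop cop' iso iso'.
have inv l c : frey_radical l c != 0 -> isomorphic W (frey_curve (4 * l - 1) (16 * c)) ->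
    disc W != 0 /\ c4 W ^+ 3 * (frey_radical l c ^+ 2)%:~R = (frey_c4 l c ^+ 3)%:~R * disc W.
  move=> Rn /isomorphic_disc[u [u0 du cu]].
  have [v [v0 dv cv]] := isomorphic_disc (frey_minimal_iso l c).
  rewrite du cu dv cv disc_frey_minimal c4_frey_minimal; split.
    by rewrite !mulf_neq0 ?expf_neq0 // intr_eq0 expf_neq0.
  by rewrite !rmorphXn /=; ring.
have [d0 E] := inv _ _ R0 iso; have [_ E'] := inv _ _ R0' iso'.
have key : frey_c4 k b ^+ 3 * frey_radical k' b' ^+ 2 = frey_c4 k' b' ^+ 3 * frey_radical k b ^+ 2.
  apply: (@intr_inj rat); rewrite !(rmorphM _ (_ ^+ 3)) /=; apply: (mulIf d0).
  by rewrite mulrAC -E mulrAC E' mulrAC.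
have d1 : (frey_radical k b ^+ 2 %| frey_radical k' b' ^+ 2)%Z.
  rewrite -(@Gauss_dvdzr _ (frey_c4 k b ^+ 3)); first by rewrite key dvdz_mull.
  by apply: coprimezXr; apply: coprime_radical_c4.
have d2 : (frey_radical k' b' ^+ 2 %| frey_radical k b ^+ 2)%Z.
  rewrite -(@Gauss_dvdzr _ (frey_c4 k' b' ^+ 3)); first by rewrite -key dvdz_mull.
  by apply: coprimezXr; apply: coprime_radical_c4.
have : `|frey_radical k b ^+ 2|%N = `|frey_radical k' b' ^+ 2|%N.
  by apply/eqP; rewrite eqn_dvd; apply/andP; split.
by move=> /(congr1 Posz); rewrite !abszE !ger0_norm ?sqr_ge0.
Qed.

(** * The family *)

(** In terms of m = 364 t + 1 and n = 364 t + 5, the factors are m, 16 m - n, 4 n - m, 4 n + m, n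
    and 256 n - m. *)
Definition family_radical (t : int) : int :=
  (364 * t + 1) * ((5460 * t + 11) * ((1092 * t + 19) * ((1820 * t + 21) * ((364 * t + 5) * (364 * 255 * t + 1279))))).

Lemma coprime_shift (a b c : int) : coprimez a b -> coprimez a (c * a + b).
Proof. by rewrite /coprimez gcdzMDl. Qed.

(** This is where 364 = 4 * 7 * 13 comes from. Both m and n are 1 modulo 4 and differ by 4, hence
    are coprime. A common factor of q and w divides 4095 = 3 * 1365, and q = 15 * 364 t + 11 is 11
    modulo 1365 = 3 * 5 * 7 * 13. *)
Lemma family_coprime (t : int) :
  coprimez (famA t) (famB t) /\ coprimez (famA' t) (famB' t).
Proof.
pose m := 364 * t + 1; pose n := 364 * t + 5; pose q := 16 * m - n; pose w := 16 * n ^+ 2 - m ^+ 2.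
have bez a b u v : u * a + v * b = 1 -> coprimez a b by move=> E; apply/coprimezP; exists (u, v).
have mn : coprimez m n by apply: (bez _ _ (1 + 91 * t) (- (91 * t))); rewrite /m /n; ring.
have m16 : coprimez m 16.
  rewrite (_ : 16 = 4 * 4) // coprimezMr andbb.
  by apply: (bez _ _ 1 (- (91 * t))); rewrite /m; ring.
have n16 : coprimez n 16.
  rewrite (_ : 16 = 4 * 4) // coprimezMr andbb.
  by apply: (bez _ _ 1 (- (91 * t + 1))); rewrite /n; ring.
have qm : coprimez q m.
  rewrite coprimez_sym (_ : q = 16 * m + - n); last by rewrite /q; ring.
  by apply: coprime_shift; rewrite coprimezN.
have qn : coprimez q n.
  rewrite coprimez_sym (_ : q = (- 1) * n + 16 * m); last by rewrite /q; ring.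
  by apply: coprime_shift; rewrite coprimezMr n16 coprimez_sym.
have q16 : coprimez q 16.
  rewrite coprimez_sym (_ : q = m * 16 + - n); last by rewrite /q; ring.
  by apply: coprime_shift; rewrite coprimezN coprimez_sym.
have mw : coprimez m w.
  rewrite (_ : w = (- m) * m + 16 * n ^+ 2); last by rewrite /w; ring.
  by apply: coprime_shift; rewrite coprimezMr m16 coprimezXr.
have nw : coprimez n w.
  rewrite (_ : w = (16 * n) * n + - (m ^+ 2)); last by rewrite /w; ring.
  by apply: coprime_shift; rewrite coprimezN coprimezXr // coprimez_sym.
have w16 : coprimez w 16.
  rewrite coprimez_sym (_ : w = (n ^+ 2) * 16 + - (m ^+ 2)); last by rewrite /w; ring.
  by apply: coprime_shift; rewrite coprimezN coprimezXr // coprimez_sym.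
have q1365 : coprimez q 1365.
  by apply: (bez _ _ (- 124) (1 + 496 * t)); rewrite /q /m /n; ring.
have q3 : coprimez q 3 by apply: coprimez_dvdr q1365.
have qw : coprimez q w.
  (* [n = 16 m - q], so [w = 4095 m ^ 2 mod q] *)
  rewrite (_ : w = (- 16 * (16 * m + n)) * q + 3 * (1365 * m ^+ 2)); last by rewrite /w /q; ring.
  by apply: coprime_shift; rewrite !coprimezMr q3 q1365 qm.
have -> : famA t = m * q by [].
have -> : famB t = 16 * w by [].
have -> : famA' t = w by [].
have -> : famB' t = 16 * n * q by [].
clearbody m n q w.
rewrite !coprimezMl !coprimezMr m16 mw q16 qw w16 /=.
by rewrite ![coprimez w _]coprimez_sym nw qw.
Qed.

Lemma family_frey (t : int) : exists k b k' b' : int,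
  [/\ famA t = 4 * k - 1, famB t = 16 * b, famA' t = 4 * k' - 1 & famB' t = 16 * b'] /\
  frey_radical k b = family_radical t /\ frey_radical k' b' = family_radical t.
Proof.
exists ((364 * t) * (1365 * t) + 2366 * t + 3), (16 * (364 * t + 5) ^+ 2 - (364 * t + 1) ^+ 2),
  ((1092 * t) * (455 * t) + 2 * 7189 * t + 100), ((364 * t + 5) * (16 * (364 * t + 1) - (364 * t + 5))).
split; first by split; rewrite /famA /famB /famA' /famB'; ring.
by split; rewrite /frey_radical /family_radical; ring.
Qed.

Lemma affine_mono (a c s t : int) : 0 < a -> 0 < c -> 1 <= s -> s < t ->
  0 < a * s + c /\ a * s + c < a * t + c.
Proof.
move=> a0 c0 s1 st; split; last by rewrite ltrD2r ltr_pM2l.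
by rewrite addr_gt0 // mulr_gt0 // (lt_le_trans _ s1).
Qed.

Lemma family_radical_mono (s t : int) : 1 <= s -> s < t ->
  0 < family_radical s /\ family_radical s < family_radical t.
Proof.
move=> s1 st.
have mulm (a b c d : int) : 0 < a /\ a < b -> 0 < c /\ c < d -> 0 < a * c /\ a * c < b * d.
  move=> [a0 ab] [c0 cd]; rewrite mulr_gt0 //; split=> //.
  by apply: ltr_pM => //; apply: ltW.
have pos n : 0 < n.+1%:R :> int by rewrite ltr0n.
have aff a c := affine_mono (pos a) (pos c) s1 st.
rewrite /family_radical; apply: (mulm _ _ _ _ (aff 363%N 0%N)); apply: (mulm _ _ _ _ (aff 5459%N 10%N)).
apply: (mulm _ _ _ _ (aff 1091%N 18%N)); apply: (mulm _ _ _ _ (aff 1819%N 20%N)).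
apply: (mulm _ _ _ _ (aff 363%N 4%N)); exact: affine_mono.
Qed.

Lemma family_radical_sqr_mono (s t : int) : 1 <= s -> s < t ->
  family_radical s ^+ 2 < family_radical t ^+ 2.
Proof.
move=> s1 st; have [] := family_radical_mono s1 st.
move: (family_radical s) (family_radical t) => x y x0 xy.
by rewrite ltr_sqr ?nnegrE ?ltW // (lt_trans x0).
Qed.

Lemma family_radical_gt0 (t : int) : 1 <= t -> 0 < family_radical t.
Proof. by move=> t1; have [] := @family_radical_mono t (t + 1) t1 (ltr_pwDr ltr01 (lexx t)). Qed.

Lemma family_radical_odd (t : int) : ~~ (2 %| `|family_radical t|)%N.
Proof.
have odd1 (a c : int) : (exists d, a = 2 * d) -> (exists e, c = 2 * e + 1) ->
    exists k, a * t + c = 2 * k + 1.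
  by move=> [d ->] [e ->]; exists (d * t + e); ring.
have mul_odd1 (x y : int) : (exists k, x = 2 * k + 1) -> (exists k, y = 2 * k + 1) ->
    exists k, x * y = 2 * k + 1.
  by move=> [k ->] [l ->]; exists (2 * k * l + k + l); ring.
have [k ->] : exists k, family_radical t = 2 * k + 1.
  rewrite /family_radical; apply: (mul_odd1); first by apply: (odd1); [exists 182 | exists 0].
  apply: (mul_odd1); first by apply: (odd1); [exists 2730 | exists 5].
  apply: (mul_odd1); first by apply: (odd1); [exists 546 | exists 9].
  apply: (mul_odd1); first by apply: (odd1); [exists 910 | exists 10].
  apply: (mul_odd1); first by apply: (odd1); [exists 182 | exists 2].
  by apply: (odd1); [exists (182 * 255) | exists 639].
by lia.
Qed.

Theorem theorem1p2 :
  (forall t : int, 1 <= t ->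
     let E := frey_curve (famA t) (famB t) in
     let E' := frey_curve (famA' t) (famB' t) in
     [/\ elliptic E /\ elliptic E',
         semistable E /\ semistable E',
         ~ isogenous E E'
       & discriminant_twins E E'])
  /\
  (forall (n : nat) (F : 'I_n -> weierstrass rat * weierstrass rat),
     exists E E' : weierstrass rat,
       [/\ elliptic E /\ elliptic E',
           semistable E /\ semistable E',
           ~ isogenous E E',
           discriminant_twins E E'
         & forall i : 'I_n,
             ~ (isomorphic (F i).1 E /\ isomorphic (F i).2 E') /\
             ~ (isomorphic (F i).1 E' /\ isomorphic (F i).2 E)]).
Proof.
have family : forall t : int, 1 <= t ->
     let E := frey_curve (famA t) (famB t) in
     let E' := frey_curve (famA' t) (famB' t) in
     [/\ elliptic E /\ elliptic E',
         semistable E /\ semistable E',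
         ~ isogenous E E'
       & discriminant_twins E E'].
  move=> t t1 E E'; have niso := family_not_isogenous t1.
  have [k [b [k' [b' [[AE BE AE' BE'] [RE RE']]]]]] := family_frey t.
  have [cop cop'] := family_coprime t; have R0 := family_radical_gt0 t1.
  have oddR := family_radical_odd t.
  rewrite -RE in R0 oddR; have R0' := R0; have oddR' := oddR.
  rewrite RE -RE' in R0' oddR'.
  rewrite AE BE in cop; rewrite AE' BE' in cop'.
  have nR : frey_radical k b != 0 by rewrite gt_eqF.
  have nR' : frey_radical k' b' != 0 by rewrite gt_eqF.
  split; [| |exact: niso|]; rewrite /E /E' ?AE ?BE ?AE' ?BE'.
  - by split; apply: frey_elliptic.
  - by split; apply: frey_semistable.
  by apply: frey_twins => //; rewrite RE RE'.
split=> // n F; apply: contrapT => none.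
(* Pigeonhole: if the list met all of these 2 n + 1 pairs, each [E t] would be isomorphic to one of
   the 2 n curves listed, so two of them would share one, against the strict growth of the
   discriminant. *)
pose E (t : 'I_(n * 2).+1) := frey_curve (famA t.+1) (famB t.+1).
have hit (t : 'I_(n * 2).+1) : exists ib : 'I_n * bool, isomorphic (if ib.2 then (F ib.1).1 else (F ib.1).2) (E t).
  apply: contrapT => miss; apply: none.
  have t1 : 1 <= t.+1%:Z by [].
  have [ell ss niso tw] := family _ t1.
  exists (E t), (frey_curve (famA' t.+1) (famB' t.+1)); split=> // i; split=> -[h1 h2]; apply: miss.
    by exists (i, true).
  by exists (i, false).
have [g gE] := choice hit.
have inj : injective g.
  move=> s t gst; have hs := gE s; have ht := gE t; rewrite -gst in ht.
  have s1 : 1 <= s.+1%:Z by []. have t1 : 1 <= t.+1%:Z by [].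
  have RR : family_radical s.+1 ^+ 2 = family_radical t.+1 ^+ 2.
    move: hs ht; rewrite /E.
    have [k [b [_ [_ [[AE BE _ _] [RE _]]]]]] := family_frey s.+1.
    have [l [c [_ [_ [[AE' BE' _ _] [RE' _]]]]]] := family_frey t.+1.
    have [cop _] := family_coprime s.+1; have [cop' _] := family_coprime t.+1.
    have R0 := family_radical_gt0 s1; have R0' := family_radical_gt0 t1.
    rewrite AE BE in cop *; rewrite AE' BE' in cop' *; rewrite -RE -RE' in R0 R0' *.
    by apply: frey_radical_isomorphic; rewrite ?(lt0r_neq0 R0) ?(lt0r_neq0 R0').
  case: (ltgtP s.+1%:Z t.+1%:Z) => [lt|gt|[/val_inj st]].
  - by have := family_radical_sqr_mono s1 lt; rewrite RR ltxx.
  - by have := family_radical_sqr_mono t1 gt; rewrite RR ltxx.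
  exact: st.
have := leq_card g inj; rewrite card_ord card_prod card_ord card_bool.
by rewrite ltnn.
Qed.
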